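(* Suppose that $1<q\le p\le\infty$, $0<\gamma<\frac{d}{q}$ and $-\frac{d}{q}\le\beta<-\gamma$. Let $\phi\in\mathcal{G}_{q,p}$ be such that there is a constant $C>0$ with $$\int_{r}^{\infty}\phi^{q}(t)\,t^{\frac{dq}{p}-1}\,dt\le C\,\phi^{q}(r)\,r^{\frac{dq}{p}}\quad\text{for every } r>0.$$ Let $\rho:(0,\infty)\to(0,\infty)$ satisfy the doubling condition: there is a constant $C_1>0$ such that for all $r,s>0$, $$\frac12\le\frac rs\le2\ \Longrightarrow\ \frac1{C_1}\le\frac{\rho(r)}{\rho(s)}\le C_1 .$$ Assume also that there is a constant $C'>0$ with $\phi(r)\le C' r^{\beta}$ and $\rho(r)\le C' r^{\gamma}$ for every $r>0$. Put $$\frac{1}{\bar p}=\frac1p\left(1+\frac{\gamma}{\beta}\right)\quad\text{and}\quad \frac{1}{\bar q}=\frac1q\left(1+\frac{\gamma}{\beta}\right),$$ and $\psi(r)=(\phi(r))^{\frac{q}{\bar q}}$ for $r>0$. Then there is a constant $K>0$ such that for all $f\in(L^{q},L^{p})^{\phi}(\mathbb{R}^{d})$, $$\|T_{\rho}f\|_{(L^{\bar q},L^{\bar p})^{\psi}(\mathbb{R}^{d})}\le K\,\|f\|_{(L^{q},L^{p})^{\phi}(\mathbb{R}^{d})}.$$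
   Context: Convention: $\frac1\infty=0$. $L^{0}(\mathbb{R}^{d})$ is the space of (a.e. equivalence classes of) Lebesgue measurable complex-valued functions on $\mathbb{R}^d$; $B(y,r)$ is the open ball with center $y\in\mathbb{R}^d$ and radius $r>0$. For $1\le q\le p\le\infty$, $\mathcal{G}_{q,p}$ is the set of all functions $\phi:(0,\infty)\to(0,\infty)$ such that $t\mapsto\phi(t)t^{d/p}$ is almost decreasing (there is $C>0$ with $\phi(s)s^{d/p}\le C\phi(r)r^{d/p}$ whenever $0<r\le s<\infty$) and $t\mapsto\phi(t)t^{d/q}$ is almost increasing (there is $C>0$ with $\phi(r)r^{d/q}\le C\phi(s)s^{d/q}$ whenever $0<r\le s<\infty$). For $r>0$ and $f\in L^0(\mathbb{R}^d)$, put ${}_{r}\|f\|_{q,p}=\left\|\left[\int_{\mathbb{R}^d}|f\chi_{B(y,r)}|^{q}(x)\,dx\right]^{1/q}\right\|_{p}$, the $L^{p}(\mathbb{R}^d)$-norm being taken in the variable $y$ (usual modification if $q=\infty$). For $\phi\in\mathcal{G}_{q,p}$ the generalized Fofana space $(L^{q},L^{p})^{\phi}(\mathbb{R}^{d})$ is the set of all $f\in L^{0}(\mathbb{R}^{d})$ with $$\|f\|_{(L^{q},L^{p})^{\phi}(\mathbb{R}^{d})}=\sup_{r>0}\frac{1}{\phi(r)}\,r^{d(-\frac1q-\frac1p)}\;{}_{r}\|f\|_{q,p}<\infty.$$ For $\rho:(0,\infty)\to(0,\infty)$, the generalized fractional integral operator is $T_{\rho}f(x)=\int_{\mathbb{R}^{d}}\frac{\rho(|x-y|)}{|x-y|^{d}}f(y)\,dy$,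 $x\in\mathbb{R}^d$. *)

(* Defs.v *)
From HB Require Import structures.
From mathcomp Require Import all_boot all_order all_algebra.
From mathcomp Require Import complex.
From mathcomp Require Import all_classical all_reals all_analysis.

Set Implicit Arguments.
Unset Strict Implicit.
Unset Printing Implicit Defensive.

Import Order.TTheory GRing.Theory Num.Theory.
Import numFieldNormedType.Exports.

Local Open Scope classical_set_scope.
Local Open Scope ring_scope.

Section cons_measure.
Context {R : realType} d (T : measurableType d) (n : nat).
Variables (m1 : {sigma_finite_measure set T -> \bar R})
  (m2 : {sigma_finite_measure set (n.-tuple T) -> \bar R}).

Definition tuple_cons (p : T * n.-tuple T) : n.+1.-tuple T :=
  [tuple of p.1 :: p.2].

Lemma measurable_tuple_cons : measurable_fun [set: T * n.-tuple T] tuple_cons.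
Proof. by apply: measurable_cons; [exact: measurable_fst|exact: measurable_snd]. Qed.

Definition cons_measure : set (n.+1.-tuple T) -> \bar R :=
  fun A => (m1 \x m2)%E (tuple_cons @^-1` A).

Let pf : {measure set (n.+1.-tuple T) -> \bar R} :=
  measure_function_pushforward__canonical__measure_function_Measure
    (m1 \x m2)%E measurable_tuple_cons.

Let cons_measure0 : cons_measure set0 = 0%E.
Proof. exact: (measure0 pf). Qed.

Let cons_measure_ge0 A : (0 <= cons_measure A)%E.
Proof. exact: (measure_ge0 pf). Qed.

Let cons_measure_sigma_additive : semi_sigma_additive cons_measure.
Proof. exact: (@measure_semi_sigma_additive _ _ _ pf). Qed.

HB.instance Definition _ := isMeasure.Build _ _ _ cons_measure
  cons_measure0 cons_measure_ge0 cons_measure_sigma_additive.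

Let cons_measure_sigma_finite : sigma_finite setT cons_measure.
Proof.
have /sigma_finiteP[F [TF ndF Foo]] := sigma_finiteT m1.
have /sigma_finiteP[G [TG ndG Goo]] := sigma_finiteT m2.
pose tb (x : n.+1.-tuple T) : n.-tuple T := [tuple of behead x].
have mth : measurable_fun [set: n.+1.-tuple T] (@thead _ _).
  exact: measurable_tnth.
have mtb : measurable_fun [set: n.+1.-tuple T] tb by exact: measurable_behead.
exists (fun k => (@thead _ _) @^-1` F k `&` tb @^-1` G k).
  apply/esym; rewrite -subTset => x _.
  have : setT (thead x) by [].
  have : setT (tb x) by [].
  rewrite TF TG => -[j _ Gj] [i _ Fi].
  exists (maxn i j) => //; split => /=.
  - by move: Fi; exact/subsetPset/ndF/leq_maxl.
  - by move: Gj; exact/subsetPset/ndG/leq_maxr.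
move=> k; have [mF Fk] := Foo k; have [mG Gk] := Goo k; split.
  apply: measurableI; rewrite -[X in measurable X]setTI; first exact: mth.
  exact: mtb.
rewrite /cons_measure (_ : tuple_cons @^-1` _ = F k `*` G k).
  by rewrite product_measure1E// lte_mul_pinfty// ge0_fin_numE.
apply/seteqP; split=> -[a t] /=.
  rewrite theadE => -[Fa Gt]; split => //.
  by rewrite (_ : t = tb (tuple_cons (a, t)))//; exact/val_inj.
move=> [Fa Gt]; rewrite theadE; split => //.
by rewrite (_ : tb _ = t)//; exact/val_inj.
Qed.

HB.instance Definition _ := Measure_isSigmaFinite.Build _ _ _ cons_measure
  cons_measure_sigma_finite.

End cons_measure.

Section euclidean_space.
Context {R : realType}.

(* d-fold product of the Lebesgue measure on the Borel sigma-algebra of R^d *)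
Fixpoint borel_lebesgue (d : nat) :
    {sigma_finite_measure set (d.-tuple (measurableTypeR R)) -> \bar R} :=
  match d with
  | 0 => \d_([tuple] : 0.-tuple (measurableTypeR R))
  | d'.+1 => cons_measure (@lebesgue_measure R) (borel_lebesgue d')
  end.

(* R^d equipped with the sigma-algebra of Lebesgue (not merely Borel)
   measurable sets *)
Definition Rd (d : nat) :
    measurableType ((borel_lebesgue d)^*%mu).-cara%mdisp :=
  caratheodory_type (borel_lebesgue d)^*%mu.

Definition lebesgue (d : nat) : {measure set (Rd d) -> \bar R} :=
  completed_measure_extension (mu := borel_lebesgue d).

Definition edist d (x y : Rd d) : R :=
  Num.sqrt (\sum_(i < d)
    (tnth (x : d.-tuple R) i - tnth (y : d.-tuple R) i) ^+ 2).

Definition eball d (y : Rd d) (r : R) : set (Rd d) := [set x | edist x y < r].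

End euclidean_space.

Arguments Rd : clear implicits.
Arguments lebesgue : clear implicits.

Section complex_valued_functions.
Context {R : realType} (d : nat).
Implicit Types f g : Rd R d -> R[i].

Definition cmod (z : R[i]) : R := ComplexField.Normc.normc z.

Definition cmeasurable f :=
  measurable_fun [set: Rd R d] (fun x => complex.Re (f x)) /\
  measurable_fun [set: Rd R d] (fun x => complex.Im (f x)).

Definition cintegral f : R[i] :=
  ((\int[lebesgue R d]_x complex.Re (f x)) +i*
   (\int[lebesgue R d]_x complex.Im (f x)))%C.

End complex_valued_functions.

Section fofana.
Context {R : realType} (d : nat).
Implicit Types (phi rho : R -> R) (q p : \bar R) (f : Rd R d -> R[i]).

(* 1 / p as a real number, with 1 / oo = 0 *)
Definition einv p : R := fine p^-1%E.

(* Functions on (0, oo) are represented by functions on R whose values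
   outside (0, oo) are irrelevant. *)
Definition positive_fun phi := forall t, 0 < t -> 0 < phi t.

Definition almost_decreasing (h : R -> R) := exists2 C : R, 0 < C &
  forall r s, 0 < r -> r <= s -> h s <= C * h r.

Definition almost_increasing (h : R -> R) := exists2 C : R, 0 < C &
  forall r s, 0 < r -> r <= s -> h r <= C * h s.

Definition Gclass q p phi := [/\ positive_fun phi,
  almost_decreasing (fun t => phi t * t `^ (d%:R * einv p)) &
  almost_increasing (fun t => phi t * t `^ (d%:R * einv q))].

Definition local_norm q p (r : R) f : \bar R :=
  Lnorm (lebesgue R d) p (fun y =>
    Lnorm (lebesgue R d) q (fun x => (cmod (f x) * \1_(eball y r) x)%:E)).

Definition fofana_norm q p phi f : \bar R :=
  ereal_sup [set (((phi r)^-1 * r `^ (d%:R * (- einv q - einv p)))%:E *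
                  local_norm q p r f)%E | r in [set r : R | 0 < r]].

Definition fofana_space q p phi : set (Rd R d -> R[i]) :=
  [set f | cmeasurable f /\ (fofana_norm q p phi f < +oo)%E].

Definition frac_kernel rho (x y : Rd R d) : R :=
  rho (edist x y) / edist x y ^+ d.

Definition frac_int rho f : Rd R d -> R[i] :=
  fun x => cintegral (fun y => (frac_kernel rho x y)%:C%C * f y).

Definition doubling rho := exists2 C1 : R, 0 < C1 &
  forall r s, 0 < r -> 0 < s ->
    1 / 2 <= r / s <= 2 -> 1 / C1 <= rho r / rho s <= C1.

End fofana.

Arguments Gclass {R} d q p phi.

(* Main.v *)
Require Import Defs.
From HB Require Import structures.
From mathcomp Require Import all_boot all_order all_algebra.
From mathcomp Require Import complex.
From mathcomp Require Import all_classical all_reals all_analysis.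
From mathcomp Require Import measurable_realfun ess_sup_inf lra ring.
(* Gives priority to [Defs.edist] over the extended distance of the library. *)
Import Defs.

(* With theta = 1 + gamma/beta one has qbar = q/theta, pbar = p/theta, and T_rho f
   is dominated by the Riesz potential I g of order gamma, where g = |f|/D and D
   bounds the norm of f. Averaging the norm condition over balls and using
   phi(r) <= C r^beta gives the Morrey bound int_{B(x,t)} g <= C t^(d+beta).

   Local part: splitting I g(x) at a radius adapted to its value yields
     (I g(x))^(q/theta) <= C int |x-y|^(gamma-d) min(g(y), |x-y|^beta)^(q-theta) g(y) dy,
   and integrating in x by Tonelli gives Adams' inequality
   int (I g)^(q/theta) <= C int g^q without any maximal function.

   Tail part: on B(y,r) the contribution of the complement of B(y,2r) is at most
   C sum_i (R_i^(-d/q) |g|_{L^q(B(y,R_i))})^theta with R_i = 2^(i+2) r. The integral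
   condition on phi forces phi(t) t^(d/p) to decay geometrically along dyadic radii,
   so this series is summed in L^(p/theta).

   When the kernel is measurable, replacing it by a Borel version makes the
   convolution jointly measurable, and Tonelli gives the measurability of T_rho f. *)

Set Implicit Arguments.
Unset Strict Implicit.
Unset Printing Implicit Defensive.

Import Order.TTheory GRing.Theory Num.Theory.
Import numFieldNormedType.Exports.

Local Open Scope classical_set_scope.
Local Open Scope ring_scope.

(** * Integrals and powers of extended reals *)

(** Since [theta] solves gamma + beta (1 - theta) = 0, the potential estimates are invariant under
    dilations. In the tail, the mass of a dyadic shell is split into its powers 1 - theta and theta,
    bounded by the Morrey bound and by the L^q average; the kernel and all powers of the radius then
    cancel exactly. No convergence factor is left, so summability has to come from the decay of phi.
    Using the Morrey bound in this way is nonlinear in g; dividing f by D beforehand makes the final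
    estimate homogeneous. T_rho f may fail to be measurable. The integral of a nonnegative function
    is a supremum over the simple functions below it, so monotonicity and positive scaling hold for
    all such functions; the norm estimate applies only these two rules to T_rho f and keeps
    additivity and Tonelli for measurable majorants. Integrals are total, with a default value when
    they diverge; a bound by a majorant survives this, and a separate argument shows that for
    measurable kernels the integral defining T_rho f converges absolutely almost everywhere. *)

Section integral_without_measurability.
Context d (T : measurableType d) (R : realType).
Variable mu : {measure set T -> \bar R}.
Implicit Types (D : set T).
Local Open Scope ereal_scope.

(** A simple function below [f] is also below [g], so the supremum defining the integral can only
    grow. *)
Lemma le_integral_ge0 D (f g : T -> \bar R) :
  (forall x, D x -> 0 <= f x) -> (forall x, D x -> f x <= g x) ->
  \int[mu]_(x in D) f x <= \int[mu]_(x in D) g x.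
Proof.
move=> f0 fg; rewrite !ge0_integralE//; last first.
  by move=> x Dx; exact: le_trans (f0 _ Dx) (fg _ Dx).
apply: ge_ereal_sup => _ [h /= hf <-]; apply: ereal_sup_ubound; exists h => //.
move=> x; apply: le_trans (hf x) _; rewrite /patch; case: ifPn => // xD.
by apply: fg; rewrite inE in xD.
Qed.

Lemma le_integral_subset D D' (f g : T -> \bar R) :
  D `<=` D' -> (forall x, D' x -> 0 <= g x) ->
  (forall x, D x -> 0 <= f x) -> (forall x, D x -> f x <= g x) ->
  \int[mu]_(x in D) f x <= \int[mu]_(x in D') g x.
Proof.
move=> DD' g0 f0 fg; rewrite integral_mkcond [leRHS]integral_mkcond.
apply: le_integral_ge0 => x _; rewrite /patch; case: ifPn => //.
  by rewrite inE => /f0.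
rewrite inE => Dx; rewrite mem_set; first exact: fg.
exact: DD'.
case: ifPn => //; rewrite inE => ? _; exact: g0.
Qed.

Let fine_sub_le (a b c : \bar R) : a <= c -> b <= c -> 0 <= a -> 0 <= b ->
  (`|fine (a - b)|)%:E <= c.
Proof.
case: c => [c||]; last by case: a.
- case: a => // a; case: b => // b; rewrite !lee_fin => ac bc a0 b0.
  by rewrite /= ler_norml; apply/andP; split; lra.
- by move=> *; rewrite leey.
Qed.

(** The positive and negative parts of [h] both lie below [m]. If the integral of [m] is finite, two
    numbers between 0 and it are subtracted; if it is infinite, the bound holds whatever value
    [fine] gives to the difference. *)
Lemma abs_fine_integral_le (h : T -> R) (m : T -> \bar R) :
  (forall x, `|h x|%:E <= m x) ->
  (`|fine (\int[mu]_x (h x)%:E)|)%:E <= \int[mu]_x m x.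
Proof.
move=> hm; rewrite integralE.
have Ap : \int[mu]_x (EFin \o h)^\+ x <= \int[mu]_x m x.
  apply: le_integral_ge0 => x _; rewrite ?funeposE ?le_max ?lexx ?orbT//.
  by apply: le_trans (hm x); rewrite ge_max /= !lee_fin ler_norm normr_ge0.
have An : \int[mu]_x (EFin \o h)^\- x <= \int[mu]_x m x.
  apply: le_integral_ge0 => x _; rewrite ?funenegE ?le_max ?lexx ?orbT//.
  apply: le_trans (hm x); rewrite ge_max /= !lee_fin normr_ge0 andbT.
  by rewrite -normrN ler_norm.
have p0 : 0 <= \int[mu]_x (EFin \o h)^\+ x by apply: integral_ge0.
have n0 : 0 <= \int[mu]_x (EFin \o h)^\- x by apply: integral_ge0.
exact: fine_sub_le.
Qed.

End integral_without_measurability.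

Section ereal_facts.
Context (R : realType).
Local Open Scope ereal_scope.

Lemma le_poweR (r : R) (x y : \bar R) :
  (0 <= r)%R -> 0 <= x -> x <= y -> x `^ r <= y `^ r.
Proof.
move=> r0 x0 xy; apply: gt0_ler_poweR => //; rewrite in_itv/= ?x0 leey//.
by rewrite (le_trans x0 xy).
Qed.

Lemma poweRK (r : R) (x : \bar R) : (0 < r)%R -> 0 <= x ->
  (x `^ r) `^ r^-1 = x.
Proof. by move=> r0 x0; rewrite -poweRrM mulfV ?gt_eqF// poweRe1. Qed.

Lemma poweRVK (r : R) (x : \bar R) : (0 < r)%R -> 0 <= x ->
  (x `^ r^-1) `^ r = x.
Proof. by move=> r0 x0; rewrite -poweRrM mulVf ?gt_eqF// poweRe1. Qed.

(** The sum is at most twice the larger term; this avoids convexity and so covers exponents below 1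
    as well. *)
Lemma poweR_le_addl (s : R) (a b : \bar R) : (0 <= s)%R -> 0 <= a -> 0 <= b ->
  (a + b) `^ s <= (2 `^ s)%:E * (a `^ s + b `^ s).
Proof.
move=> s0; wlog ab : a b / a <= b.
  move=> H a0 b0; have [ab|/ltW ba] := leP a b; first exact: H.
  by rewrite addeC (addeC (a `^ s)); exact: H.
move=> a0 b0.
have -> : (2 `^ s)%:E = (2%:E : \bar R) `^ s by rewrite poweR_EFin.
apply: (@le_trans _ _ ((2%:E * b) `^ s)).
  apply: le_poweR => //; first exact: adde_ge0.
  by rewrite (mule_natl b 2) mule2n leeD2r.
rewrite poweRM ?lee_fin//; apply: lee_pmul => //; rewrite ?poweR_ge0//.
by rewrite leeDr// poweR_ge0.
Qed.

Lemma le_nneseries_term (u : (\bar R)^nat) i :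
  (forall n, 0 <= u n) -> u i <= \sum_(n <oo) u n.
Proof.
move=> u0; apply: (@le_trans _ _ (\sum_(0 <= n < i.+1) u n)).
  by rewrite big_nat_recr//= leeDr// sume_ge0.
by apply: nneseries_lim_ge.
Qed.

Lemma geometric_nneseries (C a : R) : (0 <= C)%R -> (0 <= a)%R -> (a < 1)%R ->
  \sum_(n <oo) (C * a ^+ n)%:E = (C / (1 - a))%:E.
Proof.
move=> C0 a0 a1; apply: cvg_lim => //.
rewrite (_ : (fun n => _) = EFin \o series (geometric C a)); last first.
  by apply/funext => n /=; rewrite -sumEFin.
apply: cvg_EFin; first exact: nearW.
by apply: cvg_geometric_series; rewrite ger0_norm.
Qed.

(** This lets a radius be chosen from a real number [v] below a potential [a] that is not yet known
    to be finite. *)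
Lemma le_poweR_of_fin (a W : \bar R) (s : R) : (0 < s)%R -> 0 <= a -> 0 <= W ->
  (forall v : R, (0 < v)%R -> v%:E <= a -> (v `^ s)%:E <= W) -> a `^ s <= W.
Proof.
move=> s0; case: a => [a|_|//].
  rewrite lee_fin le_eqVlt => /predU1P[<-|a0] W0 H.
    by rewrite poweR0r// gt_eqF.
  by rewrite poweR_EFin; apply: H.
move=> W0 H; rewrite poweRyr ?gt_eqF// leye_eq; apply/eqP.
case: W W0 H => // w; rewrite lee_fin => w0 H.
(* For infinite [a] and real [w], this test value has [s]-th power w + 1, which exceeds the supposed
   bound. *)
have := H (powR (w + 1) s^-1).
rewrite powR_gt0; last by lra.
move=> /(_ isT (leey _)); rewrite -powRrM mulVf ?gt_eqF// powRr1; last by lra.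
by rewrite lee_fin => ?; exfalso; lra.
Qed.

End ereal_facts.

(** * Power kernels on dyadic shells *)

Lemma powR_expR (R : realType) (x a : R) : 0 < x -> x `^ a = expR (a * ln x).
Proof. by move=> x0; rewrite /powR gt_eqF. Qed.

Lemma exp2_unbounded (R : realType) (x : R) : exists i, x <= 2 ^+ i.
Proof. by exists (Num.bound x); exact/ltW/upper_nthrootP. Qed.

Section dyadic_shells.
Context (R : realType).
Implicit Types (t r : R).

Lemma inner_shell t r : 0 < t -> t < r ->
  exists i, r / 2 ^+ i.+1 <= t < r / 2 ^+ i.
Proof.
move=> t0 tr.
have [k hk] : exists k, r <= 2 ^+ k * t.
  by have [k] := exp2_unbounded (r / t); rewrite ler_pdivrMr//; exists k.
have ex : exists k, r <= 2 ^+ k * t by exists k.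
case: (ex_minnP ex) => -[|i] hi mini.
  by move: hi; rewrite expr0 mul1r leNgt tr.
exists i; rewrite ler_pdivrMr ?exprn_gt0// mulrC hi/=.
rewrite ltr_pdivlMr ?exprn_gt0// mulrC ltNge; apply/negP => /mini.
by rewrite ltnn.
Qed.

Lemma outer_shell t r : 0 < r -> r <= t ->
  exists i, r * 2 ^+ i <= t < r * 2 ^+ i.+1.
Proof.
move=> r0 rt.
have [k hk] : exists k, t < r * 2 ^+ k.+1.
  have [k] := exp2_unbounded (t / r).
  rewrite ler_pdivrMr// mulrC => hk; exists k; apply: le_lt_trans hk _.
  by rewrite ltr_pM2l// exprS ltr_pMl ?exprn_gt0// ltr1n.
have ex : exists k, t < r * 2 ^+ k.+1 by exists k.
case: (ex_minnP ex) => -[|i] hi mini; first by exists 0; rewrite expr0 mulr1 rt.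
exists i.+1; rewrite hi andbT leNgt; apply/negP => /mini.
by rewrite ltnn.
Qed.

End dyadic_shells.

Section metric_kernels.
Context dd (T : measurableType dd) (R : realType).
Variable mu : {sigma_finite_measure set T -> \bar R}.
Variable dist : T -> T -> R.
Hypothesis dist_ge0 : forall x y, 0 <= dist x y.
Hypothesis dist_sym : forall x y, dist x y = dist y x.
Hypothesis measurable_dist :
  measurable_fun [set: T * T] (fun z => dist z.1 z.2).

Definition mball x r : set T := [set y | dist x y < r].
(** As [powR] sends 0 to 0 for nonzero exponents, for nonzero [b] the kernel vanishes where the
    distance is 0 instead of being infinite. *)
Definition mker (b : R) x y : R := dist x y `^ (- b).

Lemma mker_sym b x y : mker b x y = mker b y x.
Proof. by rewrite /mker dist_sym. Qed.

Lemma mker_ge0 b x y : 0 <= mker b x y.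
Proof. exact: powR_ge0. Qed.

Lemma measurable_distr x : measurable_fun [set: T] (dist x).
Proof. exact: (measurableT_comp measurable_dist (pair1_measurable x)). Qed.

Lemma measurable_mball x r : measurable (mball x r).
Proof.
rewrite -[mball x r]setTI.
exact: (measurable_distr x _ (measurable_itv `]-oo, r[)).
Qed.

Lemma measurable_mker2 b : measurable_fun [set: T * T] (fun z => mker b z.1 z.2).
Proof. exact: (measurableT_comp (measurable_powR _) measurable_dist). Qed.

Lemma measurable_mker b x : measurable_fun [set: T] (mker b x).
Proof. exact: (measurableT_comp (measurable_powR _) (measurable_distr x)). Qed.

Local Open Scope ereal_scope.

(** On a shell the decreasing kernel is at most its value at the inner radius, and the shell lies in
    the ball of its outer radius. Points at distance 0 belong to no shell, but the kernel is 0
    there. *)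
Lemma mker_dyadic_le (S : set T) (f : T -> \bar R) x (b : R) (s t : R^nat) :
  measurable_fun setT f -> (forall y, 0 <= f y) -> (0 < b)%R ->
  (forall i, (0 < s i)%R) ->
  (forall y, S y -> (0 < dist x y)%R -> exists i, (s i <= dist x y < t i)%R) ->
  \int[mu]_(y in S) ((mker b x y)%:E * f y) <=
  \sum_(i <oo) (s i `^ (- b))%:E * \int[mu]_(y in mball x (t i)) f y.
Proof.
move=> mf f0 b0 s0 st.
have ge0 i y : 0 <= (s i `^ (- b))%:E * (f \_ (mball x (t i))) y.
  by rewrite mule_ge0 ?lee_fin ?powR_ge0//; apply: erestrict_ge0.
apply: (@le_trans _ _
  (\int[mu]_y \sum_(i <oo) (s i `^ (- b))%:E * (f \_ (mball x (t i))) y)).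
  apply: le_integral_subset => //.
  - by move=> y _; apply: nneseries_ge0.
  - by move=> y _; rewrite mule_ge0// lee_fin mker_ge0.
  move=> y Sy; have := dist_ge0 x y; rewrite le_eqVlt => /predU1P[d0|d0].
    rewrite /mker -d0 powR0 ?oppr_eq0 ?gt_eqF// mul0e.
    by apply: nneseries_ge0.
  have [i /andP[si ti]] := st _ Sy d0.
  apply: le_trans (le_nneseries_term i _); last by [].
  rewrite /patch mem_set//; apply: lee_pmul => //.
  - by rewrite lee_fin mker_ge0.
  - rewrite lee_fin /mker !powRN lef_pV2 ?posrE ?powR_gt0//.
    by rewrite ge0_ler_powR// ?nnegrE// ?ltW.
rewrite integral_nneseries//; last first.
  move=> i; apply: measurable_funeM.
  by apply/(measurable_restrictT f); [exact: measurable_mball|exact: measurable_funTS].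
apply: lee_nneseries => // [i _ _|i _]; first by apply: integral_ge0.
rewrite ge0_integralZl//; last 3 first.
- by apply/(measurable_restrictT f); [exact: measurable_mball|exact: measurable_funTS].
- by move=> y _; apply: erestrict_ge0.
- by rewrite lee_fin powR_ge0.
by rewrite -integral_mkcond.
Qed.

(** Shells shrinking to the center contribute a geometric series of ratio 2^(b-a), convergent
    because the mass decays faster than the kernel grows. *)
Lemma mker_near (a b D : R) : (0 < b)%R -> (b < a)%R -> (0 < D)%R ->
  exists2 C : R, (0 < C)%R & forall f x r,
    measurable_fun setT f -> (forall y, 0 <= f y) -> (0 < r)%R ->
    (forall t, (0 < t)%R -> \int[mu]_(y in mball x t) f y <= (D * t `^ a)%:E) ->
    \int[mu]_(y in mball x r) ((mker b x y)%:E * f y) <= (C * r `^ (a - b))%:E.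
Proof.
move=> b0 ba D0; pose k := (2 `^ (b - a) : R)%R.
have k0 : (0 < k)%R by rewrite powR_gt0.
have k1 : (k < 1)%R.
  by rewrite /k powR_expR// expR_lt1 pmulr_llt0 ?subr_lt0// ln_gt0 ?ltr1n.
exists (D * 2 `^ b / (1 - k))%R.
  by rewrite divr_gt0 ?subr_gt0// mulr_gt0// powR_gt0.
move=> f x r mf f0 r0 H.
apply: le_trans (@mker_dyadic_le _ _ _ _ (fun i => r / 2 ^+ i.+1)%R
    (fun i => r / 2 ^+ i)%R mf f0 b0 _ _) _.
- by move=> i; rewrite divr_gt0// exprn_gt0.
- by move=> y /= yr d0; exact: inner_shell.
apply: (@le_trans _ _ (\sum_(i <oo) (D * 2 `^ b * r `^ (a - b) * k ^+ i)%:E)).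
  apply: lee_nneseries => [i _ _|i _].
    by rewrite mule_ge0 ?lee_fin ?powR_ge0//; apply: integral_ge0.
  apply: le_trans (lee_pmul _ _ (lexx _) (H _ _)) _.
  - by rewrite lee_fin powR_ge0.
  - by apply: integral_ge0.
  - by rewrite divr_gt0// exprn_gt0.
  rewrite lee_fin le_eqVlt; apply/orP; left; apply/eqP.
  rewrite /k !powR_expR ?divr_gt0 ?exprn_gt0// !ln_div ?posrE ?exprn_gt0//.
  rewrite !lnXn// -expRM_natl -[RHS]mulrA -[RHS]mulrA mulrCA; congr (_ * _)%R.
  rewrite -!expRD; congr expR.
  rewrite -[(_ *+ i)%R]mulr_natl -[(_ *+ i.+1)%R]mulr_natl -natr1.
  by ring.
rewrite geometric_nneseries//; last 2 first.
  by rewrite !mulr_ge0 ?powR_ge0// ltW.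
  exact: ltW.
by rewrite lee_fin mulrAC.
Qed.

(** The mirror image of [mker_near]: shells growing outwards have ratio 2^(a-b), so the kernel must
    beat the growth of the mass. *)
Lemma mker_far (a b D : R) : (0 < b)%R -> (a < b)%R -> (0 < D)%R ->
  exists2 C : R, (0 < C)%R & forall f x r,
    measurable_fun setT f -> (forall y, 0 <= f y) -> (0 < r)%R ->
    (forall t, (0 < t)%R -> \int[mu]_(y in mball x t) f y <= (D * t `^ a)%:E) ->
    \int[mu]_(y in ~` mball x r) ((mker b x y)%:E * f y) <= (C * r `^ (a - b))%:E.
Proof.
move=> b0 ba D0; pose k := (2 `^ (a - b) : R)%R.
have k0 : (0 < k)%R by rewrite powR_gt0.
have k1 : (k < 1)%R.
  by rewrite /k powR_expR// expR_lt1 pmulr_llt0 ?subr_lt0// ln_gt0 ?ltr1n.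
exists (D * 2 `^ a / (1 - k))%R.
  by rewrite divr_gt0 ?subr_gt0// mulr_gt0// powR_gt0.
move=> f x r mf f0 r0 H.
apply: le_trans (@mker_dyadic_le _ _ _ _ (fun i => r * 2 ^+ i)%R
    (fun i => r * 2 ^+ i.+1)%R mf f0 b0 _ _) _.
- by move=> i; rewrite mulr_gt0// exprn_gt0.
- by move=> y /= /negP; rewrite -leNgt => yr d0; exact: outer_shell.
apply: (@le_trans _ _ (\sum_(i <oo) (D * 2 `^ a * r `^ (a - b) * k ^+ i)%:E)).
  apply: lee_nneseries => [i _ _|i _].
    by rewrite mule_ge0 ?lee_fin ?powR_ge0//; apply: integral_ge0.
  apply: le_trans (lee_pmul _ _ (lexx _) (H _ _)) _.
  - by rewrite lee_fin powR_ge0.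
  - by apply: integral_ge0.
  - by rewrite mulr_gt0// exprn_gt0.
  rewrite lee_fin le_eqVlt; apply/orP; left; apply/eqP.
  rewrite /k !powR_expR ?mulr_gt0 ?exprn_gt0// !lnM ?posrE ?exprn_gt0//.
  rewrite !lnXn// -expRM_natl -[RHS]mulrA -[RHS]mulrA mulrCA; congr (_ * _)%R.
  rewrite -!expRD; congr expR.
  rewrite -[(_ *+ i)%R]mulr_natl -[(_ *+ i.+1)%R]mulr_natl -natr1.
  by ring.
rewrite geometric_nneseries//; last 2 first.
  by rewrite !mulr_ge0 ?powR_ge0// ltW.
  exact: ltW.
by rewrite lee_fin mulrAC.
Qed.

End metric_kernels.

(* Each [c i] is at most [lam^i] times the [1/m]-th power of the right-hand
   series, which avoids distinguishing [m <= 1] from [m > 1]. *)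
Lemma nneseries_powR_le (R : realType) (lam m : R) (c : (\bar R)^nat) :
  0 < lam -> lam < 1 -> 0 < m -> (forall i, (0 <= c i)%E) ->
  ((\sum_(i <oo) c i) `^ m <=
   ((1 - lam)^-1 `^ m)%:E *
     \sum_(i <oo) ((lam ^- i) `^ m)%:E * c i `^ m)%E.
Proof.
move=> l0 l1 m0 c0.
have t0 i : (0 <= ((lam ^- i) `^ m)%:E * c i `^ m)%E.
  by rewrite mule_ge0 ?poweR_ge0// lee_fin powR_ge0.
set S := (\sum_(i <oo) (_ * _))%E.
have S0 : (0 <= S)%E by apply: nneseries_ge0.
have cS i : (c i <= (lam ^+ i)%:E * S `^ m^-1)%E.
  have li : 0 < lam ^- i by rewrite invr_gt0 exprn_gt0.
  rewrite -[leLHS](@poweRK _ m)// -(@poweRK _ m (lam ^+ i)%:E)//; last first.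
    by rewrite lee_fin exprn_ge0// ltW.
  rewrite -poweRM ?poweR_ge0//; apply: le_poweR; rewrite ?poweR_ge0 ?invr_ge0 ?(ltW m0)//.
  apply: (@le_trans _ _ (((lam ^+ i) `^ m)%:E *
      (((lam ^- i) `^ m)%:E * c i `^ m))%E).
    rewrite muleA -EFinM -powRM ?exprn_ge0 ?(ltW li) ?(ltW l0)//.
    by rewrite divff ?powR1 ?mul1e// gt_eqF// exprn_gt0.
  rewrite poweR_EFin; apply: lee_pmul => //; first by rewrite lee_fin powR_ge0.
  exact: (le_nneseries_term i t0).
have l1' : 0 < 1 - lam by rewrite subr_gt0.
have [Soo|SNoo] := eqVneq S +oo%E.
  by rewrite Soo mulry gtr0_sg ?powR_gt0 ?invr_gt0// mul1e leey.
pose s : R := fine (S `^ m^-1)%E.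
have sE : (S `^ m^-1)%E = s%:E.
  by rewrite fineK// fin_num_poweR// ge0_fin_numE// ltey.
have s0 : 0 <= s by rewrite fine_ge0// poweR_ge0.
apply: (@le_trans _ _ (((1 - lam)^-1%:E * S `^ m^-1) `^ m)%E); last first.
  by rewrite poweRM ?poweR_ge0 ?lee_fin ?invr_ge0 ?(ltW l1')// poweRVK.
apply: le_poweR => //; rewrite ?(ltW m0)//; first exact: nneseries_ge0.
apply: (@le_trans _ _ (\sum_(i <oo) (s * lam ^+ i)%:E)%E).
  by apply: lee_nneseries => // i _; rewrite mulrC EFinM -sE.
by rewrite geometric_nneseries ?(ltW l0)// EFinM -sE muleC.
Qed.

(** Hölder's inequality against the constant 1, up to a factor 2, with [V] any upper bound for the
    measure of [A]. It follows by optimizing over [l] a bound that is linear in the integral of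
    g^q. *)
Lemma integral_le_power_mean d (T : measurableType d) (R : realType)
    (mu : {measure set T -> \bar R}) (A : set T) (g : T -> R) (q V : R) :
  measurable A -> measurable_fun setT g -> (forall x, 0 <= g x) ->
  1 < q -> 0 < V -> (mu A <= V%:E)%E ->
  (\int[mu]_(x in A) (g x)%:E <=
   (2 * V)%:E * ((V^-1)%:E * \int[mu]_(x in A) (g x `^ q)%:E) `^ q^-1)%E.
Proof.
move=> mA mg g0 q1 V0 AV; have q0 : 0 < q by lra.
set M := (\int[mu]_(x in A) (g x `^ q)%:E)%E.
have M0 : (0 <= M)%E by apply: integral_ge0 => x _; rewrite lee_fin powR_ge0.
(* Young: [g <= l + l^(1-q) g^q] for every level [l]. *)
have young (l : R) : 0 < l ->
    (\int[mu]_(x in A) (g x)%:E <= (l * V)%:E + (l `^ (1 - q))%:E * M)%E.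
  move=> l0; apply: (@le_trans _ _
     (\int[mu]_(x in A) (l%:E + (l `^ (1 - q))%:E * (g x `^ q)%:E))%E).
    apply: le_integral_ge0 => x _; first by rewrite lee_fin.
    rewrite -EFinM -EFinD lee_fin; have [gl|lg] := leP (g x) l.
      by rewrite (le_trans gl)// lerDl mulr_ge0 ?powR_ge0.
    have gx : 0 < g x by exact: lt_trans lg.
    apply: (@le_trans _ _ (l `^ (1 - q) * g x `^ q)); last by rewrite lerDr ltW.
    rewrite -(opprB q) powRN ler_pdivlMl ?powR_gt0//.
    rewrite -[X in _ <= _ `^ X](subrK 1) [leRHS]powRD ?(gt_eqF gx) ?implybT//.
    rewrite powRr1 ?(ltW gx)// ler_pM2r//.
    apply: ge0_ler_powR; rewrite ?nnegrE ?(ltW l0) ?(ltW gx) ?(ltW lg)//.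
    by rewrite subr_ge0 ltW.
  have mgq : measurable_fun A (fun x => (g x `^ q)%:E).
    apply/measurable_EFinP; apply: measurable_funTS.
    exact: (measurableT_comp (measurable_powR _)).
  rewrite ge0_integralD//; last 3 first.
  - by move=> x _; rewrite lee_fin ltW.
  - by move=> x _; rewrite -EFinM lee_fin mulr_ge0 ?powR_ge0.
  - exact: measurable_funeM.
  rewrite ge0_integralZl//; last 2 first.
  - by move=> x _; rewrite lee_fin powR_ge0.
  - by rewrite lee_fin powR_ge0.
  apply: leeD => //; rewrite integral_cst// EFinM; apply: lee_pmul => //.
  by rewrite lee_fin ltW.
have V0' : (0 <= V^-1%:E)%E by rewrite lee_fin invr_ge0 ltW.
(* For M = 0 the optimal level would be 0, which is not allowed; the levels e / V with e tending to
   0 replace it. *)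
case: (M =P 0%E) => [M00|/eqP Mn0].
  rewrite M00 mule0 poweR0r ?invr_eq0 ?(gt_eqF q0)// mule0.
  apply/lee_addgt0Pr => e e0; rewrite add0e.
  apply: le_trans (young (e / V) _) _; first by rewrite divr_gt0.
  by rewrite M00 mule0 adde0 divfK// gt_eqF.
clearbody M; case: M M0 Mn0 young => [M|_ _ _|//]; last first.
  rewrite mulry gtr0_sg ?invr_gt0// mul1e poweRyr ?invr_eq0 ?(gt_eqF q0)//.
  by rewrite mulry gtr0_sg ?mulr_gt0// mul1e leey.
rewrite lee_fin eqe => M0 Mn0 young.
have {}M0 : 0 < M by rewrite lt_def Mn0.
have MV : 0 < V^-1 * M by rewrite mulr_gt0 ?invr_gt0.
(* At this level both terms of the bound equal l V, whence the factor 2. *)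
set l := (V^-1 * M) `^ q^-1.
have l0 : 0 < l by rewrite powR_gt0.
apply: le_trans (young l l0) _.
rewrite -EFinM poweR_EFin -/l -!EFinM -EFinD lee_fin.
have -> : M = V * l `^ q.
  by rewrite /l -powRrM mulVf ?gt_eqF// powRr1 ?(ltW MV)// mulrA divff ?mul1r// gt_eqF.
rewrite mulrCA -powRD ?(gt_eqF l0) ?implybT// subrK powRr1 ?(ltW l0)//.
by rewrite le_eqVlt; apply/orP; left; apply/eqP; ring.
Qed.

Lemma ge0_integral_splitC d (T : measurableType d) (R : realType)
    (mu : {measure set T -> \bar R}) (D A : set T) (g : T -> \bar R) :
  measurable D -> measurable A -> measurable_fun D g ->
  (forall x, D x -> (0 <= g x)%E) ->
  (\int[mu]_(x in D) g x =
   \int[mu]_(x in D `&` A) g x + \int[mu]_(x in D `&` ~` A) g x)%E.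
Proof.
move=> mD mA mg g0; have DE : D `&` A `|` D `&` ~` A = D.
  by rewrite -setIUr setUCr setIT.
rewrite -[in LHS]DE ge0_integral_setU//.
- exact: measurableI.
- by apply: measurableI => //; exact: measurableC.
- by rewrite DE.
- by rewrite DE.
- by apply/disj_setPS => x [[_ ?] [_]].
Qed.

(** * Potentials on an Ahlfors regular space *)

Lemma powR_average_solve (R : realType) (A B p q : R) :
  0 < B -> 0 <= A -> 0 < p -> 0 < q ->
  (B^-1 * A `^ p) `^ (p / q)^-1 = (A * B `^ (- p^-1)) `^ q.
Proof.
move=> B0 A0 p0 q0; have B0' : 0 <= B^-1 by rewrite invr_ge0 ltW.
have BE : B^-1 = B `^ (-1) by rewrite powR_inv1 // ltW.
rewrite (powRM _ B0' (powR_ge0 _ _)) (powRM _ A0 (powR_ge0 _ _)) {}BE.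
rewrite -3!powRrM [LHS]mulrC.
rewrite (_ : p * (p / q)^-1 = q); last by field; rewrite !gt_eqF.
by rewrite (_ : -1 * (p / q)^-1 = - p^-1 * q)//; field; rewrite !gt_eqF.
Qed.

(** The relation between the exponents makes the total power of [t] vanish, so shells of all radii
    carry the same constant. *)
Lemma tail_power_identity (R : realType) (t D E n gamma beta theta : R) :
  0 < t -> 0 < D -> 0 < E -> gamma + beta * (1 - theta) = 0 ->
  (t / 2) `^ (- (n - gamma)) *
    ((D * t `^ (n + beta)) `^ (1 - theta) * (E * t `^ n) `^ theta) =
  2 `^ (n - gamma) * D `^ (1 - theta) * E `^ theta.
Proof.
move=> t0 D0 E0 gb; have h0 : 0 <= 2^-1 :> R by rewrite invr_ge0.
rewrite (powRM _ (ltW t0) h0) (powRM _ (ltW D0) (powR_ge0 _ _)).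
rewrite (powRM _ (ltW E0) (powR_ge0 _ _)).
have -> : 2^-1 `^ (- (n - gamma)) = 2 `^ (n - gamma) :> R.
  by rewrite -(@powR_inv1 _ 2)// -powRrM mulN1r opprK.
rewrite -2!powRrM.
have tt : t `^ (- (n - gamma)) *
    (t `^ ((n + beta) * (1 - theta)) * t `^ (n * theta)) = 1.
  rewrite -!powRD ?(gt_eqF t0) ?implybT//.
  have -> : - (n - gamma) + ((n + beta) * (1 - theta) + n * theta) = 0.
    by rewrite -gb; ring.
  by rewrite powRr0.
rewrite -[RHS]mulr1 -[X in _ = _ * X]tt.
by ring.
Qed.

Lemma lmass_power_scale (R : realType) (t A n q s : R) : 0 < t -> 0 <= A ->
  q != 0 ->
  (t `^ (- n)) `^ (s / q) * (A * t `^ (n / q)) `^ s = A `^ s.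
Proof.
move=> t0 A0 q0; rewrite (powRM _ A0 (powR_ge0 _ _)) -2!powRrM mulrCA.
rewrite -powRD ?(gt_eqF t0) ?implybT//.
have -> : - n * (s / q) + n / q * s = 0 by ring.
by rewrite powRr0 mulr1.
Qed.

Lemma geometric_weight (R : realType) (k theta p : R) i :
  0 < k -> theta != 0 ->
  ((k `^ (theta / 2)) ^- i) `^ (p / theta) * (k ^+ i) `^ p = (k `^ (p / 2)) ^+ i.
Proof.
move=> k0 th0.
rewrite -[_ ^+ i in X in X `^ _ * _](powR_mulrn _ (powR_ge0 _ _)).
rewrite -(powR_mulrn _ (ltW k0)) -(powR_mulrn _ (powR_ge0 _ _)) -powRN -!powRrM.
rewrite -powRD ?(gt_eqF k0) ?implybT//; congr powR.
by field.
Qed.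

Lemma one_plus_ratio_gt0 (R : realFieldType) (gamma beta : R) :
  0 < gamma -> beta < - gamma -> 0 < 1 + gamma / beta.
Proof.
move=> g0 bg; have b0 : beta < 0 by rewrite (lt_trans bg)// oppr_lt0.
have -> : 1 + gamma / beta = (- beta - gamma) / - beta.
  by field; rewrite lt_eqF.
by apply: divr_gt0; rewrite ?subr_gt0 ?oppr_gt0// ltrNr.
Qed.

(** * Pointwise and integral bounds of the potential *)

Section potential_estimates.
Context dd (T : measurableType dd) (R : realType).
Variable mu : {sigma_finite_measure set T -> \bar R}.
Variable dist : T -> T -> R.
Hypothesis dist_ge0 : forall x y, 0 <= dist x y.
Hypothesis dist_sym : forall x y, dist x y = dist y x.
Hypothesis measurable_dist :
  measurable_fun [set: T * T] (fun z => dist z.1 z.2).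
Local Notation mball := (mball dist).
Local Notation mker := (mker dist).
Variables n c1 gamma beta q : R.
Hypothesis c1_gt0 : 0 < c1.
Hypothesis mball_le :
  forall x r, 0 < r -> (mu (mball x r) <= (c1 * r `^ n)%:E)%E.
Hypothesis gamma_gt0 : 0 < gamma.
Hypothesis gamma_ltn : gamma < n.
Hypothesis beta_lt : beta < - gamma.
Hypothesis q_gt1 : 1 < q.
Local Notation theta := (1 + gamma / beta).

Let beta_lt0 : beta < 0.
Proof. by apply: lt_trans beta_lt _; rewrite oppr_lt0. Qed.

Let beta_neq0 : beta != 0. Proof. by rewrite lt_eqF. Qed.

Let theta_gt0 : 0 < theta. Proof. exact: one_plus_ratio_gt0. Qed.

Let theta_lt1 : theta < 1.
Proof. by rewrite gtrDl pmulr_rlt0// invr_lt0. Qed.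

Definition mpot (f : T -> R) x : \bar R :=
  (\int[mu]_y (mker (n - gamma) x y * f y)%:E)%E.

Lemma mpot_ge0 f x : (forall y, 0 <= f y) -> (0 <= mpot f x)%E.
Proof.
by move=> f0; apply: integral_ge0 => y _; rewrite lee_fin mulr_ge0// mker_ge0.
Qed.

(* Cutting off at [min (f y, |x - y|^beta)] is what makes the kernel both
   dominate the potential ([mpot_pointwise]) and satisfy a Schur bound in [x]
   ([hedberg_ker_schur]); Tonelli then replaces the maximal function. *)
Definition hedberg_ker (f : T -> R) x y : R :=
  mker (n - gamma) x y * (Num.min (f y) (dist x y `^ beta)) `^ (q - theta) * f y.

Lemma hedberg_ker_ge0 f x y : 0 <= f y -> 0 <= hedberg_ker f x y.
Proof.
move=> f0; apply: mulr_ge0 => //.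
by apply: mulr_ge0; [exact: mker_ge0|exact: powR_ge0].
Qed.

(** For each real v below the potential, a fixed part of v comes from points within a radius r where
    f > r^beta. There the minimum in [hedberg_ker] is at least r^beta, so its integral is at least
    r^(beta (q - theta)) v / 2; with r a power of v this is a multiple of v^(q/theta). *)
Lemma mpot_pointwise (D : R) : 0 < D -> exists2 C : R, 0 < C &
  forall f : T -> R, measurable_fun setT f -> (forall y, 0 <= f y) ->
  (forall x t, 0 < t ->
    (\int[mu]_(y in mball x t) (f y)%:E <= (D * t `^ (n + beta))%:E)%E) ->
  forall x, (mpot f x `^ (q / theta) <=
    C%:E * \int[mu]_y (hedberg_ker f x y)%:E)%E.
Proof.
move=> D0; have [g0 gn bl q1] := And4 gamma_gt0 gamma_ltn beta_lt q_gt1.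
have th0 := theta_gt0; have th1 := theta_lt1.
have b0 : 0 < n - gamma by lra.
have [|Cn Cn0 HCn] := mker_near mu dist_ge0 measurable_dist b0 _ c1_gt0 (a := n).
  by lra.
have [|Cf Cf0 HCf] := mker_far mu dist_ge0 measurable_dist b0 _ D0 (a := n + beta).
  by lra.
pose c := Cn + Cf; have c0 : 0 < c by rewrite /c; lra.
exists ((4 * c) `^ (q / theta) / (2 * c)).
  by rewrite divr_gt0 ?powR_gt0; lra.
move=> f mf f0 Hf x.
have qth : 0 < q / theta by rewrite divr_gt0//; lra.
have W0 : (0 <= \int[mu]_y (hedberg_ker f x y)%:E)%E.
  by apply: integral_ge0 => y _; rewrite lee_fin hedberg_ker_ge0.
apply: le_poweR_of_fin => //; first exact: mpot_ge0.
  by rewrite mule_ge0// lee_fin divr_ge0 ?powR_ge0//; lra.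
move=> v v0 vI.
(* At this radius the tail and the part where [f <= r^beta] contribute at most
   [v / 4] each, so that half of [v] comes from [{f > r^beta}] in the ball. *)
pose r := (v / (4 * c)) `^ (gamma + beta)^-1.
have vc0 : 0 < v / (4 * c) by rewrite divr_gt0; lra.
have r0 : 0 < r by rewrite powR_gt0.
have rE : r `^ (gamma + beta) = v / (4 * c).
  rewrite /r -powRrM mulVf ?powRr1 ?ltW// lt_eqF//; lra.
clearbody r; pose s := r `^ beta.
have s0 : 0 < s by rewrite powR_gt0.
pose k := mker (n - gamma) x.
have mk : measurable_fun setT k by exact: measurable_mker.
have k0 y : 0 <= k y by exact: mker_ge0.
have mkf : measurable_fun setT (fun y => (k y * f y)%:E).
  by apply/measurable_EFinP; exact: measurable_funM.
have kf0 y : (0 <= (k y * f y)%:E)%E by rewrite lee_fin mulr_ge0.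
have mB : measurable (mball x r) by exact: measurable_mball.
pose E := [set y | s < f y].
have mE : measurable E.
  rewrite -[E]setTI [X in measurable X](_ : _ = setT `&` f @^-1` `]s, +oo[).
    by apply: mf => //; exact: measurable_itv.
  by congr (_ `&` _); apply/seteqP; split => y; rewrite /E /= in_itv/= andbT.
set H := (\int[mu]_(y in mball x r `&` E) (k y * f y)%:E)%E.
have H0 : (0 <= H)%E by apply: integral_ge0 => y _.
have vH : ((v / 2)%:E <= H)%E.
  have low : (\int[mu]_(y in mball x r `&` ~` E) (k y * f y)%:E <=
      (v / (4 * c) * Cn)%:E)%E.
    apply: (@le_trans _ _ (\int[mu]_(y in mball x r) (s%:E * ((k y)%:E * 1)))%E).
      apply: le_integral_subset => //.
      - by move=> y _; rewrite mule1 -EFinM lee_fin mulr_ge0// ltW.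
      move=> y [_ /negP]; rewrite -leNgt => fs.
      by rewrite mule1 -EFinM lee_fin mulrC ler_pM.
    rewrite ge0_integralZl//; last 3 first.
    - by under eq_fun do rewrite mule1; apply: measurable_funTS; exact/measurable_EFinP.
    - by move=> y _; rewrite mule1 lee_fin.
    - by rewrite lee_fin ltW.
    apply: le_trans (lee_pmul _ _ (lexx _) (HCn (cst 1%E) x r _ _ r0 _)) _ => //.
    - by rewrite lee_fin ltW.
    - by apply: integral_ge0 => y _; rewrite mule1 lee_fin.
    - by move=> t t0; rewrite integral_cst ?mul1e ?mball_le//; exact: measurable_mball.
    rewrite lee_fin -rE /s (_ : n - (n - gamma) = gamma); last by ring.
    by rewrite mulrCA -powRD ?(gt_eqF r0) ?implybT// addrC mulrC.
  have far : (\int[mu]_(y in ~` mball x r) (k y * f y)%:E <=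
      (v / (4 * c) * Cf)%:E)%E.
    have := HCf (EFin \o f) x r _ _ r0 (Hf x).
    rewrite (_ : n + beta - (n - gamma) = gamma + beta); last by ring.
    rewrite rE mulrC; apply; first exact/measurable_EFinP.
    by move=> y; rewrite lee_fin.
  have : (v%:E <= H + (v / (4 * c) * Cn)%:E + (v / (4 * c) * Cf)%:E)%E.
    apply: (le_trans vI).
    rewrite /mpot (@ge0_integral_splitC _ _ _ _ _ (mball x r))// setTI setTI.
    rewrite (@ge0_integral_splitC _ _ _ _ _ E)//; last exact: measurable_funTS.
    apply: leeD; last exact: far.
    by apply: leeD; [exact: lexx|exact: low].
  clearbody H; case: H H0 => [H|_ _|//]; last by rewrite leey.
  rewrite !lee_fin => H0.
  rewrite -addrA -mulrDr -/c (_ : v / (4 * c) * c = v / 4); first by lra.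
  by field; rewrite gt_eqF.
apply: (@le_trans _ _ (((4 * c) `^ (q / theta) / (2 * c))%:E *
   ((s `^ (q - theta))%:E * (v / 2)%:E))%E).
  rewrite -!EFinM lee_fin le_eqVlt; apply/orP; left; apply/eqP.
  have -> : v = 4 * c * r `^ (gamma + beta) by rewrite rE; field; rewrite gt_eqF.
  rewrite powRM ?powR_ge0//; last by lra.
  rewrite /s -!powRrM.
  (* Both sides are beta q, because beta theta = beta + gamma. Hence v^(q/theta) and s^(q-theta) v /
     2 are (4c)^(q/theta) and 2c times the same power of r, and the constant of the lemma is the
     ratio. *)
  have -> : (gamma + beta) * (q / theta) = beta * (q - theta) + (gamma + beta).
    by field; rewrite beta_neq0 /= addrC lt_eqF//; lra.
  rewrite (@powRD _ r (beta * (q - theta))) ?(gt_eqF r0) ?implybT//.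
  by field; rewrite gt_eqF.
apply: lee_pmul => //.
- by rewrite lee_fin divr_ge0 ?powR_ge0//; lra.
- by rewrite -EFinM lee_fin mulr_ge0 ?powR_ge0//; lra.
apply: (@le_trans _ _ ((s `^ (q - theta))%:E * H)%E).
  by apply: lee_pmul => //; rewrite lee_fin ?powR_ge0//; lra.
rewrite /H -ge0_integralZl//; last 3 first.
- exact: measurableI.
- exact: measurable_funTS.
- by rewrite lee_fin powR_ge0.
apply: le_integral_subset => //.
- by move=> y _; rewrite lee_fin hedberg_ker_ge0.
- by move=> y _; rewrite mule_ge0// lee_fin powR_ge0.
move=> y [yr Ey]; rewrite -EFinM lee_fin /hedberg_ker mulrCA mulrA.
apply: ler_wpM2r => //.
rewrite -/(k y).
(* At distance 0 the power of negative exponent [beta] is 0 by convention, so the minimum has no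
   lower bound there; the kernel vanishes at the same points. *)
have := dist_ge0 x y; rewrite le_eqVlt => /predU1P[d0|d0].
  have -> : k y = 0 by rewrite /k /mker -d0 powR0// oppr_eq0 gt_eqF.
  by rewrite !mul0r.
apply: ler_wpM2l => //.
apply: ge0_ler_powR; rewrite ?nnegrE//; first by lra.
- exact: ltW.
- by rewrite le_min f0 powR_ge0.
rewrite le_min (ltW Ey) /= /s.
have -> : beta = - (- beta) by rewrite opprK.
rewrite (powRN r) (powRN (dist x y)) lef_pV2 ?posrE ?powR_gt0//.
apply: ge0_ler_powR; rewrite ?nnegrE ?(ltW r0) ?(ltW d0)//; first by lra.
exact: ltW.
Qed.

Lemma measurable_hedberg_ker f : measurable_fun setT f ->
  measurable_fun [set: T * T] (fun z => hedberg_ker f z.1 z.2).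
Proof.
move=> mf; have mf2 : measurable_fun [set: T * T] (fun z => f z.2).
  exact: (measurableT_comp mf).
apply: measurable_funM => //; apply: measurable_funM.
  exact: measurable_mker2.
apply: (measurableT_comp (measurable_powR _)); apply: measurable_minr => //.
exact: (measurableT_comp (measurable_powR _) measurable_dist).
Qed.

(** Split at the radius r where r^beta = f(y). Inside, the minimum is at most f(y) and the kernel
    integrates to a multiple of r^gamma; outside, the minimum is at most |x-y|^beta and makes the
    kernel integrable at infinity. Both parts are multiples of f(y)^q because beta theta = beta +
    gamma. *)
Lemma hedberg_ker_schur : exists2 C : R, 0 < C &
  forall (f : T -> R) y, measurable_fun setT f -> 0 <= f y ->
  (\int[mu]_x (hedberg_ker f x y)%:E <= C%:E * (f y `^ q)%:E)%E.
Proof.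
have [g0 gn bl q1] := And4 gamma_gt0 gamma_ltn beta_lt q_gt1.
have th0 := theta_gt0; have th1 := theta_lt1; have b0 := beta_lt0.
have thE : beta * theta = beta + gamma by field; rewrite beta_neq0.
(* This exponent equals n - beta (q - 1); it exceeds n because q > 1 and beta < 0. *)
pose b' := n - gamma - beta * (q - theta).
have bq : 0 < - beta * (q - 1) by rewrite mulr_gt0//; lra.
have b'n : n < b' by rewrite /b' mulrBr thE; lra.
have n_gt0 : 0 < n by lra.
have ng0 : 0 < n - gamma by lra.
have ngn : n - gamma < n by lra.
have b'0 : 0 < b' by lra.
have [Cn Cn0 HCn] := mker_near mu dist_ge0 measurable_dist ng0 ngn c1_gt0.
have [Cf Cf0 HCf] := mker_far mu dist_ge0 measurable_dist b'0 b'n c1_gt0.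
have H1 y t : 0 < t -> (\int[mu]_(x in mball y t) cst 1 x <= (c1 * t `^ n)%:E)%E.
  by move=> t0; rewrite integral_cst ?mul1e ?mball_le//; exact: measurable_mball.
exists (Cn + Cf); first by lra.
move=> f y mf; rewrite le_eqVlt => /predU1P[fy0|fy0].
  rewrite integral0_eq; last by move=> x _; rewrite /hedberg_ker -fy0 mulr0.
  by rewrite mule_ge0// lee_fin ?powR_ge0//; lra.
pose r := f y `^ beta^-1.
have r0 : 0 < r by rewrite powR_gt0.
have rE (a : R) : f y `^ a = r `^ (beta * a).
  by rewrite /r -powRrM mulrA mulVf// mul1r.
have mh : measurable_fun setT (fun x => (hedberg_ker f x y)%:E).
  apply/measurable_EFinP.
  exact: (measurable_fun_pair1 y (measurable_hedberg_ker mf)).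
rewrite (@ge0_integral_splitC _ _ _ _ _ (mball y r))//; last 2 first.
- exact: measurable_mball.
- by move=> x _; rewrite lee_fin hedberg_ker_ge0// ltW.
rewrite !setTI EFinD muleDl//; apply: leeD.
  apply: (@le_trans _ _ (\int[mu]_(x in mball y r)
     ((f y `^ (q - theta) * f y)%:E * ((mker (n - gamma) y x)%:E * cst 1 x)))%E).
    apply: le_integral_ge0 => x _; first by rewrite lee_fin hedberg_ker_ge0// ltW.
    rewrite /= mule1 -EFinM lee_fin /hedberg_ker mker_sym// mulrAC [leRHS]mulrC.
    rewrite [leRHS]mulrA [leRHS]mulrAC; apply: ler_wpM2l.
      by rewrite mulr_ge0 ?mker_ge0// ltW.
    apply: ge0_ler_powR; rewrite ?nnegrE ?(ltW fy0) ?ge_min ?lexx//.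
    + by lra.
    + by rewrite le_min ltW// powR_ge0.
  rewrite ge0_integralZl//; last 4 first.
  - exact: measurable_mball.
  - under eq_fun do rewrite mule1; apply: measurable_funTS.
    exact/measurable_EFinP/measurable_mker.
  - by move=> x _; rewrite mule1 lee_fin mker_ge0.
  - by rewrite lee_fin mulr_ge0 ?powR_ge0// ltW.
  apply: le_trans (lee_pmul _ _ (lexx _) (HCn (cst 1%E) y r _ _ r0 (H1 y))) _ => //.
  - by rewrite lee_fin mulr_ge0 ?powR_ge0// ltW.
  - by apply: integral_ge0 => x _; rewrite mule1 lee_fin mker_ge0.
  rewrite -!EFinM lee_fin mulrCA; apply: ler_wpM2l; first exact: ltW.
  have -> : f y `^ (q - theta) * f y = f y `^ (q - theta + 1).
    by rewrite [RHS]powRD ?(gt_eqF fy0) ?implybT// powRr1// ltW.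
  rewrite !rE -powRD ?(gt_eqF r0) ?implybT// le_eqVlt; apply/orP; left.
  by apply/eqP; congr powR; rewrite mulrDr mulrBr thE; ring.
apply: (@le_trans _ _ (\int[mu]_(x in ~` mball y r)
   ((f y)%:E * ((mker b' y x)%:E * cst 1 x)))%E).
  apply: le_integral_ge0 => x; first by rewrite lee_fin hedberg_ker_ge0// ltW.
  move=> /negP; rewrite -leNgt => rx.
  have d0 : 0 < dist y x by exact: lt_le_trans rx.
  rewrite /= mule1 -EFinM lee_fin /hedberg_ker mker_sym// [leRHS]mulrC.
  apply: ler_wpM2r; first exact: ltW.
  rewrite /mker (_ : - b' = - (n - gamma) + beta * (q - theta)); last first.
    by rewrite /b'; ring.
  rewrite [leRHS]powRD ?(gt_eqF d0) ?implybT//.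
  apply: ler_wpM2l; first exact: powR_ge0.
  rewrite powRrM; apply: ge0_ler_powR; rewrite ?nnegrE ?powR_ge0//.
  + by lra.
  + by rewrite le_min ltW// powR_ge0.
  + by rewrite dist_sym ge_min lexx orbT.
rewrite ge0_integralZl//; last 4 first.
- by apply: measurableC; exact: measurable_mball.
- under eq_fun do rewrite mule1; apply: measurable_funTS.
  exact/measurable_EFinP/measurable_mker.
- by move=> x _; rewrite mule1 lee_fin mker_ge0.
- by rewrite lee_fin ltW.
apply: le_trans (lee_pmul _ _ (lexx _) (HCf (cst 1%E) y r _ _ r0 (H1 y))) _ => //.
- by rewrite lee_fin ltW.
- by apply: integral_ge0 => x _; rewrite mule1 lee_fin mker_ge0.
rewrite -!EFinM lee_fin mulrCA; apply: ler_wpM2l; first exact: ltW.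
rewrite -{1}(powRr1 (ltW fy0)) !rE -powRD ?(gt_eqF r0) ?implybT//.
rewrite le_eqVlt; apply/orP; left; apply/eqP; congr powR.
by rewrite /b' mulrBr thE; ring.
Qed.

Lemma adams (D : R) : 0 < D -> exists2 C : R, 0 < C &
  forall f : T -> R, measurable_fun setT f -> (forall y, 0 <= f y) ->
  (forall x t, 0 < t ->
    (\int[mu]_(y in mball x t) (f y)%:E <= (D * t `^ (n + beta))%:E)%E) ->
  (\int[mu]_x (mpot f x `^ (q / theta)) <=
    C%:E * \int[mu]_y (f y `^ q)%:E)%E.
Proof.
move=> D0; have [C1 C10 H1] := mpot_pointwise D0.
have [C2 C20 H2] := hedberg_ker_schur.
exists (C1 * C2); first exact: mulr_gt0.
move=> f mf f0 Hf.
have mh2 : measurable_fun [set: T * T]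
    (fun z => (hedberg_ker f z.1 z.2)%:E : \bar R).
  by apply/measurable_EFinP; exact: measurable_hedberg_ker.
have h0 (z : T * T) : (0 <= (hedberg_ker f z.1 z.2)%:E)%E.
  by rewrite lee_fin hedberg_ker_ge0.
apply: (@le_trans _ _ (\int[mu]_x (C1%:E * \int[mu]_y (hedberg_ker f x y)%:E))%E).
  apply: le_integral_ge0 => x _; first exact: poweR_ge0.
  exact: H1.
rewrite ge0_integralZl//; last 3 first.
- exact: (measurable_fun_fubini_tonelli_F _ mh2 h0).
- by move=> x _; apply: integral_ge0 => y _; exact: (h0 (x, y)).
- by rewrite lee_fin ltW.
rewrite EFinM -muleA; apply: lee_pmul => //.
- by rewrite lee_fin ltW.
- by apply: integral_ge0 => x _; apply: integral_ge0 => y _; exact: (h0 (x, y)).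
rewrite (fubini_tonelli (fun z => (hedberg_ker f z.1 z.2)%:E))//=.
rewrite -ge0_integralZl//; last 3 first.
- by apply/measurable_EFinP; exact: (measurableT_comp (measurable_powR _)).
- by move=> y _; rewrite lee_fin powR_ge0.
- by rewrite lee_fin ltW.
apply: le_integral_ge0 => y _; last exact: H2.
by apply: integral_ge0 => x _; exact: (h0 (x, y)).
Qed.

(** * Local masses, the tail of the potential, and their L^p bounds *)

Variable c0 : R.
Hypothesis c0_gt0 : 0 < c0.
Hypothesis mball_ge :
  forall x r, 0 < r -> ((c0 * r `^ n)%:E <= mu (mball x r))%E.
Hypothesis dist_tri : forall x y z, dist x z <= dist x y + dist y z.

Let q_gt0 : 0 < q. Proof. exact: lt_trans q_gt1. Qed.

Definition lmass (g : T -> R) (r : R) y : \bar R :=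
  (\int[mu]_(x in mball y r) (g x `^ q)%:E)%E.

Definition tail_pot (g : T -> R) (r : R) y : \bar R :=
  (\int[mu]_(z in ~` mball y (2 * r)%R) (mker (n - gamma) y z * g z)%:E)%E.

Lemma lmass_ge0 g r y : (0 <= lmass g r y)%E.
Proof. by apply: integral_ge0 => x _; rewrite lee_fin powR_ge0. Qed.

Lemma measurable_section_integral (S : set (T * T)) (F : T * T -> R) :
  measurable S -> measurable_fun setT F -> (forall z, 0 <= F z) ->
  measurable_fun setT
    (fun y => (\int[mu]_(x in [set x | S (y, x)]) (F (y, x))%:E)%E).
Proof.
move=> mS mF F0; pose G (z : T * T) := (\1_S z * F z)%:E.
have mG : measurable_fun setT G.
  by apply/measurable_EFinP; apply: measurable_funM.
have G0 z : (0 <= G z)%E by rewrite lee_fin mulr_ge0.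
rewrite [X in measurable_fun _ X](_ : _ = fubini_F mu G).
  exact: measurable_fun_fubini_tonelli_F.
apply/funext => y; rewrite /fubini_F [LHS]integral_mkcond.
apply: eq_integral => x _; rewrite /G /patch indicE.
have -> : ((y, x) \in S) = (x \in [set x | S (y, x)]).
  by apply/idP/idP; rewrite !inE.
by case: ifP; rewrite (mul1r, mul0r).
Qed.

Lemma measurable_lmass g r : measurable_fun setT g ->
  measurable_fun setT (lmass g r).
Proof.
move=> mg.
apply: (@measurable_section_integral [set w : T * T | dist w.1 w.2 < r]
  (fun z => g z.2 `^ q)).
- rewrite -[X in measurable X]setTI.
  exact: (measurable_dist _ (measurable_itv `]-oo, r[)).
- apply: (measurableT_comp (measurable_powR _)).
  exact: (measurableT_comp mg).
- by move=> z; exact: powR_ge0.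
Qed.

Lemma measurable_mker_fun g : measurable_fun setT g ->
  measurable_fun [set: T * T] (fun z => mker (n - gamma) z.1 z.2 * g z.2).
Proof.
move=> mg; apply: measurable_funM; first exact: measurable_mker2.
exact: (measurableT_comp mg).
Qed.

Lemma measurable_tail_pot (g : T -> R) r : measurable_fun setT g ->
  (forall x, 0 <= g x) -> measurable_fun setT (tail_pot g r).
Proof.
move=> mg g0.
apply: (@measurable_section_integral (~` [set w : T * T | dist w.1 w.2 < 2 * r])
  (fun z => mker (n - gamma) z.1 z.2 * g z.2)).
- apply: measurableC; rewrite -[X in measurable X]setTI.
  exact: (measurable_dist _ (measurable_itv `]-oo, 2 * r[)).
- exact: measurable_mker_fun.
- by move=> z; rewrite mulr_ge0// mker_ge0.
Qed.

Lemma measurable_mpot (g : T -> R) : measurable_fun setT g ->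
  (forall x, 0 <= g x) -> measurable_fun setT (mpot g).
Proof.
move=> mg g0; apply: (@measurable_section_integral setT
  (fun z => mker (n - gamma) z.1 z.2 * g z.2)) => //.
- exact: measurable_mker_fun.
- by move=> z; rewrite mulr_ge0// mker_ge0.
Qed.

Lemma mball_subset y z r : dist y z < r -> mball y r `<=` mball z (2 * r).
Proof.
move=> yz x; rewrite /mball /= => yx.
apply: le_lt_trans (dist_tri z y x) _.
by rewrite dist_sym mulr_natl mulr2n ltrD.
Qed.

Lemma lmass_le y z g r : dist y z < r -> (lmass g r y <= lmass g (2 * r)%R z)%E.
Proof.
move=> yz; apply: le_integral_subset; [exact: mball_subset|..];
  by move=> *; rewrite lee_fin ?powR_ge0.
Qed.

(** The mass at y for radius r is at most the mass at z for radius 2r, for every z in B(y,r).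
    Integrating over these z gains the measure of the ball, at least c0 r^n. *)
Lemma lmass_pointwise (p A r : R) g y : 0 < p -> 0 <= A -> 0 < r ->
  (\int[mu]_z (lmass g (2 * r)%R z `^ (p / q)) <= (A `^ p)%:E)%E ->
  (lmass g r y <= ((A * (c0 * r `^ n) `^ (- p^-1)) `^ q)%:E)%E.
Proof.
move=> p0 A0 r0 HA; set B := c0 * r `^ n.
have B0 : 0 < B by rewrite mulr_gt0// powR_gt0.
have pq : 0 < p / q by rewrite divr_gt0.
have BA : (B%:E * lmass g r y `^ (p / q) <= (A `^ p)%:E)%E.
  apply: le_trans HA; apply: (@le_trans _ _
     (\int[mu]_(z in mball y r) cst (lmass g r y `^ (p / q)) z)%E).
    rewrite (integral_cst _ (measurable_mball measurable_dist _ _)) [leRHS]muleC.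
    apply: lee_pmul.
    - by rewrite lee_fin ltW.
    - exact: poweR_ge0.
    - exact: mball_ge.
    - exact: lexx.
  apply: le_integral_subset => //.
  - by move=> z _; exact: poweR_ge0.
  - by move=> z _; exact: poweR_ge0.
  move=> z zy; apply: le_poweR; rewrite ?(ltW pq) ?lmass_ge0//.
  exact: lmass_le.
have : (lmass g r y `^ (p / q) <= (B^-1 * A `^ p)%:E)%E.
  by rewrite EFinM muleC lee_pdivlMr// muleC.
move=> H; have qp : 0 <= (p / q)^-1 by rewrite invr_ge0 ltW.
have := le_poweR qp (poweR_ge0 _ _) H.
rewrite (poweRK pq (lmass_ge0 _ _ _)) => /le_trans; apply.
by rewrite poweR_EFin powR_average_solve.
Qed.

(** If the bound failed at y, the bound for radius 2r would fail on all of B(y,r), which has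
    positive measure and fits in no null set. *)
Lemma lmass_pointwise_ae (A r : R) g y : 0 < r ->
  {ae mu, forall z, (lmass g (2 * r)%R z <= A%:E)%E} -> (lmass g r y <= A%:E)%E.
Proof.
move=> r0 [N [mN N0 NA]]; rewrite leNgt; apply/negP => Ag.
have BN : mball y r `<=` N.
  move=> z zy; apply: NA => /= zA; move: Ag; rewrite ltNge => /negP; apply.
  exact: le_trans (lmass_le _ zy) zA.
have : (mu (mball y r) <= 0)%E.
  by rewrite -N0; apply: le_measure; rewrite ?inE//; exact: measurable_mball.
move=> B0; have := le_trans (mball_ge y r0) B0.
by rewrite leNgt lte_fin mulr_gt0// powR_gt0.
Qed.

(** This is a Morrey condition: the q-th mean of [g] over a ball of radius r is at most a multiple
    of r^beta. *)
Definition lmass_bounded (K : R) (g : T -> R) :=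
  forall y r, 0 < r -> (lmass g r y <= ((K * r `^ (beta + n / q)) `^ q)%:E)%E.

Lemma lmass_mean_le (g : T -> R) y r : measurable_fun setT g -> (forall x, 0 <= g x) ->
  0 < r ->
  (\int[mu]_(x in mball y r) (g x)%:E <=
   (2 * c1 `^ (1 - q^-1) * r `^ n)%:E *
     ((r `^ (- n))%:E * lmass g r y) `^ q^-1)%E.
Proof.
move=> mg g0 r0; have V0 : 0 < c1 * r `^ n by rewrite mulr_gt0// powR_gt0.
have := integral_le_power_mean (measurable_mball measurable_dist y r)
  mg g0 q_gt1 V0 (mball_le y r0).
move=> /le_trans; apply.
rewrite le_eqVlt; apply/orP; left; apply/eqP.
rewrite -/(lmass g r y).
have -> : ((c1 * r `^ n)^-1%:E * lmass g r y =
    c1^-1%:E * ((r `^ (- n))%:E * lmass g r y))%E.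
  by rewrite invfM -powRN EFinM muleA.
have c1V : (0 <= c1^-1%:E)%E by rewrite lee_fin invr_ge0 ltW.
have m0 : (0 <= (r `^ (- n))%:E * lmass g r y)%E.
  by rewrite mule_ge0 ?lmass_ge0// lee_fin powR_ge0.
rewrite (poweRM _ c1V m0) poweR_EFin muleA -EFinM; congr (_%:E * _)%E.
have -> : c1^-1 `^ q^-1 = c1 `^ (- q^-1).
  by rewrite -(powR_inv1 (ltW c1_gt0)) -powRrM mulN1r.
rewrite [in RHS]powRD; last by rewrite (gt_eqF c1_gt0) implybT.
by rewrite powRr1 ?(ltW c1_gt0)//; ring.
Qed.

Lemma lmass_morrey (K : R) (g : T -> R) : 0 < K -> measurable_fun setT g ->
  (forall x, 0 <= g x) -> lmass_bounded K g -> forall y r, 0 < r ->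
  (\int[mu]_(x in mball y r) (g x)%:E <=
   (2 * c1 `^ (1 - q^-1) * K * r `^ (n + beta))%:E)%E.
Proof.
move=> K0 mg g0 HK y r r0; apply: le_trans (lmass_mean_le y mg g0 r0) _.
apply: (@le_trans _ _ ((2 * c1 `^ (1 - q^-1) * r `^ n)%:E *
  ((r `^ (- n))%:E * ((K * r `^ (beta + n / q)) `^ q)%:E) `^ q^-1)%E).
  apply: lee_pmul => //.
  - by rewrite lee_fin !mulr_ge0 ?powR_ge0.
  - exact: poweR_ge0.
  apply: le_poweR; first by rewrite invr_ge0 ltW.
    by rewrite mule_ge0 ?lmass_ge0// lee_fin powR_ge0.
  apply: lee_pmul => //; rewrite ?lmass_ge0 ?HK//.
  by rewrite lee_fin powR_ge0.
rewrite -(EFinM (r `^ (- n))) poweR_EFin -EFinM lee_fin.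
rewrite le_eqVlt; apply/orP; left; apply/eqP.
have Kr0 : 0 <= K * r `^ (beta + n / q) by rewrite mulr_ge0 ?powR_ge0// ltW.
rewrite (powRM _ (powR_ge0 _ _) (powR_ge0 _ _)) -!powRrM mulfV ?(gt_eqF q_gt0)//.
rewrite (powRr1 Kr0) [in RHS]powRD ?(gt_eqF r0) ?implybT//.
rewrite [r `^ (beta + _)]powRD ?(gt_eqF r0) ?implybT//.
have : r `^ (- n / q) * r `^ (n / q) = 1.
  by rewrite -powRD ?(gt_eqF r0) ?implybT// mulNr addNr powRr0.
move: (r `^ (- n / q)) (r `^ (n / q)) => a b ab.
rewrite [LHS](_ : _ = 2 * c1 `^ (1 - q^-1) * K * (r `^ n * r `^ beta) * (a * b)).
  by rewrite ab mulr1.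
by ring.
Qed.

(** The integral a of g over the ball enclosing a shell is written a^(1-theta) a^theta. The first
    factor takes the Morrey bound, the second the mean bound, and [tail_power_identity] removes the
    radius and the kernel. *)
Lemma tail_pot_le (K : R) : 0 < K -> exists2 C : R, 0 < C &
  forall g : T -> R, measurable_fun setT g -> (forall x, 0 <= g x) ->
  lmass_bounded K g -> forall y r, 0 < r ->
  (tail_pot g r y <= C%:E * \sum_(i <oo)
    (((r * 2 ^+ i.+2) `^ (- n))%:E * lmass g (r * 2 ^+ i.+2)%R y) `^ (theta / q))%E.
Proof.
move=> K0; have [g0 gn bl q1] := And4 gamma_gt0 gamma_ltn beta_lt q_gt1.
have th0 := theta_gt0; have th1 := theta_lt1.
(* The constants of [lmass_morrey] and [lmass_mean_le], respectively. *)
pose D := 2 * c1 `^ (1 - q^-1) * K.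
pose E := 2 * c1 `^ (1 - q^-1).
have E0 : 0 < E by rewrite mulr_gt0// powR_gt0.
have D0 : 0 < D by rewrite mulr_gt0.
exists (2 `^ (n - gamma) * D `^ (1 - theta) * E `^ theta).
  by rewrite !mulr_gt0// powR_gt0.
move=> g mg gge0 HK y r r0.
have ng0 : 0 < n - gamma by lra.
rewrite /tail_pot; under eq_integral do rewrite EFinM.
apply: le_trans (@mker_dyadic_le _ _ _ mu dist dist_ge0 measurable_dist
  (~` mball y (2 * r)) (fun z => (g z)%:E) y (n - gamma)
  (fun i => r * 2 ^+ i.+1) (fun i => r * 2 ^+ i.+2) _ _ ng0 _ _) _.
- exact/measurable_EFinP.
- by move=> z; rewrite lee_fin.
- by move=> i; rewrite mulr_gt0// exprn_gt0.
- move=> z /negP; rewrite -leNgt => rz d0.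
  have [|i] := @outer_shell _ (dist y z) (2 * r) _ rz; first by rewrite mulr_gt0.
  by rewrite [2 * r]mulrC -!mulrA -!exprS => ?; exists i.
rewrite -nneseriesZl; last by move=> i _; exact: poweR_ge0.
apply: lee_nneseries => [i _ _|i _].
  by rewrite mule_ge0 ?lee_fin ?powR_ge0//; apply: integral_ge0 => z _; rewrite lee_fin.
set t := r * 2 ^+ i.+2.
have t0 : 0 < t by rewrite mulr_gt0// exprn_gt0.
have -> : r * 2 ^+ i.+1 = t / 2 by rewrite /t [2 ^+ i.+2]exprSr mulrA mulfK ?pnatr_eq0.
have a0 : (0 <= \int[mu]_(x in mball y t) (g x)%:E)%E.
  by apply: integral_ge0 => z _; rewrite lee_fin.
have := lmass_morrey K0 mg gge0 HK y t0.
have := lmass_mean_le y mg gge0 t0.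
rewrite -/D -/E; move: a0.
have m0 : (0 <= (t `^ (- n))%:E * lmass g t y)%E.
  by rewrite mule_ge0 ?lmass_ge0// lee_fin powR_ge0.
move: (integral _ _ _) ((t `^ (- n))%:E * lmass g t y)%E m0 => [a| |]// m m0.
rewrite !lee_fin => a0 aE aD.
have aE' : ((a `^ theta)%:E <= ((E * t `^ n) `^ theta)%:E * m `^ (theta / q))%E.
  have := le_poweR (ltW th0) _ aE; rewrite lee_fin => /(_ a0).
  rewrite poweR_EFin => /le_trans; apply.
  have Et0 : (0 <= (E * t `^ n)%:E)%E.
    by rewrite lee_fin mulr_ge0 ?powR_ge0// ltW.
  by rewrite (poweRM _ Et0 (poweR_ge0 _ _)) poweR_EFin -poweRrM [q^-1 * _]mulrC.
have aD' : a `^ (1 - theta) <= (D * t `^ (n + beta)) `^ (1 - theta).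
  apply: ge0_ler_powR; rewrite ?nnegrE//; first lra.
  by rewrite mulr_ge0 ?powR_ge0// ltW.
have aS : a = a `^ (1 - theta) * a `^ theta.
  by rewrite -powRD subrK ?oner_eq0// powRr1.
rewrite aS.
apply: (@le_trans _ _ (((t / 2) `^ (- (n - gamma)))%:E *
   (((D * t `^ (n + beta)) `^ (1 - theta))%:E *
    (((E * t `^ n) `^ theta)%:E * m `^ (theta / q))))%E).
  apply: lee_pmul => //; rewrite ?lee_fin ?mulr_ge0 ?powR_ge0//.
  by rewrite EFinM; apply: lee_pmul => //; rewrite lee_fin ?powR_ge0.
have -> (u1 u2 u3 : R) (w : \bar R) :
    (u1%:E * (u2%:E * (u3%:E * w)) = (u1 * (u2 * u3))%:E * w)%E.
  by rewrite !EFinM !muleA.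
rewrite tail_power_identity//.
by field; rewrite beta_neq0.
Qed.

(** Here [H] stands for phi(r) r^(n/p) and k^i for its decay at radius r 2^i. Weighting the series
    before raising it to the power p/theta allows termwise integration, whether that power is below
    or above 1. *)
Lemma tail_Lp (K C k p : R) : 0 < K -> 0 < C -> 0 < k < 1 -> 0 < p ->
  exists2 C' : R, 0 < C' &
  forall g : T -> R, measurable_fun setT g -> (forall x, 0 <= g x) ->
  lmass_bounded K g -> forall r H, 0 < r -> 0 <= H ->
  (forall i : nat, (\int[mu]_y (lmass g (r * 2 ^+ i)%R y `^ (p / q)) <=
    ((C * k ^+ i * H * (r * 2 ^+ i) `^ (n / q)) `^ p)%:E)%E) ->
  (\int[mu]_y (tail_pot g r y `^ (p / theta)) <= (C' * H `^ p)%:E)%E.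
Proof.
move=> K0 C0 /andP[k0 k1] p0.
have th0 := theta_gt0; have pt0 : 0 < p / theta by rewrite divr_gt0.
have [C1 C10 HC1] := tail_pot_le K0.
(* Each term decays like k^(theta i). Half of this pays for the weights of [nneseries_powR_le]; the
   other half, raised to p/theta, is the ratio [k'] below. *)
pose l := k `^ (theta / 2).
have l0 : 0 < l by rewrite powR_gt0.
have l1 : l < 1.
  by rewrite /l powR_expR// expR_lt1 pmulr_rlt0 ?divr_gt0// ln_lt0 ?k0.
pose k' := k `^ (p / 2).
have k'0 : 0 < k' by rewrite powR_gt0.
have k'1 : k' < 1.
  by rewrite /k' powR_expR// expR_lt1 pmulr_rlt0 ?divr_gt0// ln_lt0 ?k0.
pose A := C1 `^ (p / theta) * (1 - l)^-1 `^ (p / theta).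
have A0 : 0 < A by rewrite mulr_gt0 ?powR_gt0 ?invr_gt0 ?subr_gt0.
(* The balls of [tail_pot_le] start at radius r 2^2, which leaves the factor [k ^+ 2]. *)
exists (A * ((C * k ^+ 2) `^ p / (1 - k'))).
  by rewrite !mulr_gt0 ?powR_gt0 ?mulr_gt0 ?exprn_gt0 ?invr_gt0 ?subr_gt0.
move=> g mg g0 HK r H r0 H0 HL.
pose t i := r * 2 ^+ i.+2.
have t0 i : 0 < t i by rewrite mulr_gt0// exprn_gt0.
pose m i y := (((t i `^ (- n))%:E * lmass g (t i) y) `^ (theta / q))%E.
have m0 i y : (0 <= m i y)%E by exact: poweR_ge0.
pose w i := ((l ^- i) `^ (p / theta)).
apply: (@le_trans _ _
  (\int[mu]_y (A%:E * \sum_(i <oo) ((w i)%:E * m i y `^ (p / theta))))%E).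
  apply: le_integral_ge0 => y _; first exact: poweR_ge0.
  apply: le_trans (le_poweR (ltW pt0) _ (HC1 g mg g0 HK y r r0)) _.
    by apply: integral_ge0 => z _; rewrite lee_fin mulr_ge0 ?mker_ge0.
  rewrite poweRM ?lee_fin ?(ltW C10)//; last first.
    by apply: nneseries_ge0 => i _ _; exact: poweR_ge0.
  rewrite poweR_EFin /A EFinM -muleA; apply: lee_pmul => //.
  - by rewrite lee_fin powR_ge0.
  - exact: poweR_ge0.
  exact: (nneseries_powR_le l0 l1 pt0 (m0 ^~ y)).
have mm i : measurable_fun setT (fun y => ((w i)%:E * m i y `^ (p / theta))%E).
  apply: measurable_funeM; apply: (measurableT_comp (measurable_poweR _)).
  apply: (measurableT_comp (measurable_poweR _)).
  by apply: measurable_funeM; exact: measurable_lmass.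
have wm0 i y : (0 <= (w i)%:E * m i y `^ (p / theta))%E.
  by rewrite mule_ge0 ?poweR_ge0// lee_fin powR_ge0.
rewrite ge0_integralZl//; last 3 first.
- by apply: ge0_emeasurable_sum => // i y _ _.
- by move=> y _; apply: nneseries_ge0.
- by rewrite lee_fin ltW.
rewrite -mulrA [leRHS]EFinM; apply: lee_pmul => //.
- by rewrite lee_fin ltW.
- by apply: integral_ge0 => y _; apply: nneseries_ge0.
rewrite integral_nneseries//.
apply: (@le_trans _ _ (\sum_(i <oo) ((C * k ^+ 2) `^ p * H `^ p * k' ^+ i)%:E)%E).
  apply: lee_nneseries => [i _ _|i _]; first by apply: integral_ge0.
  rewrite ge0_integralZl//; last 3 first.
  - apply: (measurableT_comp (measurable_poweR _)).
    apply: (measurableT_comp (measurable_poweR _)).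
    by apply: measurable_funeM; exact: measurable_lmass.
  - by move=> y _; exact: poweR_ge0.
  - by rewrite lee_fin powR_ge0.
  have mE y : (m i y `^ (p / theta) =
      ((t i `^ (- n)) `^ (p / q))%:E * lmass g (t i) y `^ (p / q))%E.
    rewrite /m -poweRrM (_ : theta / q * (p / theta) = p / q); last first.
      move: (theta) th0 => th th0.
      by field; rewrite !gt_eqF.
    by rewrite poweRM ?lmass_ge0// lee_fin powR_ge0.
  under eq_integral do rewrite mE.
  rewrite ge0_integralZl//; last 3 first.
  - apply: (measurableT_comp (measurable_poweR _)).
    exact: measurable_lmass.
  - by move=> y _; exact: poweR_ge0.
  - by rewrite lee_fin powR_ge0.
  apply: le_trans (lee_pmul _ _ (lexx _) (lee_pmul _ _ (lexx _) (HL i.+2))) _.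
  - by rewrite lee_fin powR_ge0.
  - by rewrite mule_ge0 ?lee_fin ?powR_ge0//; apply: integral_ge0 => y _; exact: poweR_ge0.
  - by rewrite lee_fin powR_ge0.
  - by apply: integral_ge0 => y _; exact: poweR_ge0.
  rewrite -/(t i) -!EFinM lee_fin le_eqVlt; apply/orP; left; apply/eqP.
  have ki0 : 0 <= C * k ^+ i.+2 * H.
    by rewrite mulr_ge0// mulr_ge0 ?exprn_ge0// ltW.
  rewrite (lmass_power_scale _ _ (t0 i) ki0 (lt0r_neq0 q_gt0)).
  have Ck0 : 0 <= C * k ^+ 2 by rewrite mulr_ge0 ?exprn_ge0// ltW.
  have ki : 0 <= k ^+ i by rewrite exprn_ge0// ltW.
  have -> : C * k ^+ i.+2 * H = C * k ^+ 2 * (k ^+ i * H).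
    by rewrite -addn2 exprD; ring.
  rewrite (powRM _ Ck0 (mulr_ge0 ki H0)) (powRM _ ki H0).
  rewrite /k' -(geometric_weight p i k0 (lt0r_neq0 th0)) -/l /w.
  by ring.
rewrite geometric_nneseries ?(ltW k'0)//; last by rewrite mulr_ge0 ?powR_ge0.
by rewrite lee_fin mulrAC.
Qed.

Lemma tail_Linfty (K C k : R) : 0 < K -> 0 < C -> 0 < k < 1 ->
  exists2 C' : R, 0 < C' &
  forall g : T -> R, measurable_fun setT g -> (forall x, 0 <= g x) ->
  lmass_bounded K g -> forall r H y, 0 < r -> 0 <= H ->
  (forall i : nat, (lmass g (r * 2 ^+ i)%R y <=
    ((C * k ^+ i * H * (r * 2 ^+ i) `^ (n / q)) `^ q)%:E)%E) ->
  (tail_pot g r y <= (C' * H `^ theta)%:E)%E.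
Proof.
move=> K0 C0 /andP[k0 k1]; have th0 := theta_gt0.
have [C1 C10 HC1] := tail_pot_le K0.
pose k' := k `^ theta.
have k'0 : 0 < k' by rewrite powR_gt0.
have k'1 : k' < 1.
  by rewrite /k' powR_expR// expR_lt1 pmulr_rlt0// ln_lt0 ?k0.
exists (C1 * ((C * k ^+ 2) `^ theta / (1 - k'))).
  by rewrite !mulr_gt0 ?powR_gt0 ?mulr_gt0 ?exprn_gt0 ?invr_gt0 ?subr_gt0.
move=> g mg g0 HK r H y r0 H0 HL.
pose t i := r * 2 ^+ i.+2.
have t0 i : 0 < t i by rewrite mulr_gt0// exprn_gt0.
apply: le_trans (HC1 g mg g0 HK y r r0) _.
rewrite -mulrA EFinM; apply: lee_pmul => //.
- by rewrite lee_fin ltW.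
- by apply: nneseries_ge0 => i _ _; exact: poweR_ge0.
apply: (@le_trans _ _ (\sum_(i <oo) ((C * k ^+ 2) `^ theta * H `^ theta * k' ^+ i)%:E)%E).
  apply: lee_nneseries => [i _ _|i _]; first exact: poweR_ge0.
  have tq : 0 <= theta / q by rewrite divr_ge0 ?ltW.
  apply: le_trans (le_poweR tq _ (lee_pmul _ _ (lexx _) (HL i.+2))) _.
  - by rewrite mule_ge0 ?lmass_ge0// lee_fin powR_ge0.
  - by rewrite lee_fin powR_ge0.
  - exact: lmass_ge0.
  rewrite -/(t i) -EFinM poweR_EFin lee_fin le_eqVlt; apply/orP; left; apply/eqP.
  have ki0 : 0 <= C * k ^+ i.+2 * H.
    by rewrite mulr_ge0// mulr_ge0 ?exprn_ge0// ltW.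
  have -> : t i `^ (- n) * (C * k ^+ i.+2 * H * t i `^ (n / q)) `^ q =
      (C * k ^+ i.+2 * H) `^ q.
    rewrite -[RHS](lmass_power_scale n q (t0 i) ki0 (lt0r_neq0 q_gt0)).
    by rewrite mulfV ?(gt_eqF q_gt0)// powRr1 ?powR_ge0.
  rewrite -powRrM [q * _]mulrC (divfK (lt0r_neq0 q_gt0)).
  have Ck0 : 0 <= C * k ^+ 2 by rewrite mulr_ge0 ?exprn_ge0// ltW.
  have ki : 0 <= k ^+ i by rewrite exprn_ge0// ltW.
  have -> : C * k ^+ i.+2 * H = C * k ^+ 2 * (k ^+ i * H).
    by rewrite -addn2 exprD; ring.
  rewrite (powRM _ Ck0 (mulr_ge0 ki H0)) (powRM _ ki H0).
  have -> : (k ^+ i) `^ theta = k' ^+ i.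
    rewrite -(powR_mulrn _ (ltW k0)) -(powR_mulrn _ (ltW k'0)) -!powRrM.
    by rewrite [theta * _]mulrC.
  by ring.
rewrite geometric_nneseries ?(ltW k'0)//; last by rewrite mulr_ge0 ?powR_ge0.
by rewrite lee_fin mulrAC.
Qed.

(** For x in B(y,r) and z outside B(y,2r), the triangle inequality gives |x-z| >= |y-z| / 2, so
    moving the pole of the kernel from x to y costs 2^(n-gamma). *)
Lemma mpot_split_le (g : T -> R) y r x : measurable_fun setT g ->
  (forall z, 0 <= g z) -> mball y r x ->
  (mpot g x <= mpot (g \* \1_(mball y (2 * r)))%R x +
     (2 `^ (n - gamma))%:E * tail_pot g r y)%E.
Proof.
move=> mg g0 yx; have [gam0 gn bl q1] := And4 gamma_gt0 gamma_ltn beta_lt q_gt1.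
have mkg w : measurable_fun setT (fun z => (mker (n - gamma) w z * g z)%:E).
  apply/measurable_EFinP; apply: measurable_funM => //.
  exact: measurable_mker.
have kg0 w z : (0 <= (mker (n - gamma) w z * g z)%:E)%E.
  by rewrite lee_fin mulr_ge0// mker_ge0.
have mB : measurable (mball y (2 * r)) by exact: measurable_mball.
rewrite /mpot (@ge0_integral_splitC _ _ _ _ _ (mball y (2 * r)))// !setTI.
apply: leeD.
  apply: le_integral_subset => // z.
    by move=> _; rewrite lee_fin mulr_ge0 ?mker_ge0//= mulr_ge0.
  by move=> yz; rewrite lee_fin /= indicE mem_set// mulr1.
rewrite /tail_pot -ge0_integralZl//; last 2 first.
- exact: measurableC.
- exact: measurable_funTS.
apply: le_integral_ge0 => // z /negP; rewrite -leNgt => rz.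
rewrite -EFinM lee_fin mulrA; apply: ler_wpM2r => //.
have r0 : 0 < r by apply: le_lt_trans yx; exact: dist_ge0.
have yz0 : 0 < dist y z by apply: lt_le_trans rz; rewrite mulr_gt0.
have xz : dist y z / 2 <= dist x z.
  have := dist_tri y x z; move: rz yx; rewrite /mball /= => rz yx tri.
  by rewrite ler_pdivrMr//; lra.
have xz0 : 0 < dist x z by apply: lt_le_trans xz; rewrite divr_gt0.
rewrite /mker !powRN -[X in X / _]invrK -invfM lef_pV2; last 2 first.
- by rewrite posrE powR_gt0.
- by rewrite posrE mulr_gt0 ?invr_gt0 ?powR_gt0.
rewrite -(powR_inv1 (powR_ge0 _ _)) -powRrM mulrN1 -mulN1r powRrM powR_inv1//.
rewrite -powRM ?(ltW yz0)//; apply: ge0_ler_powR; rewrite ?nnegrE//.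
- by lra.
- by rewrite mulr_ge0// ltW.
- by rewrite mulrC.
Qed.

(** Cutting [g] off outside B(y,2r) preserves its Morrey bound, so [adams] applies and returns the
    local mass. The tail is constant in x and only picks up the measure of the ball. *)
Lemma local_pot_le (K : R) : 0 < K -> exists2 C : R, 0 < C &
  forall g : T -> R, measurable_fun setT g -> (forall x, 0 <= g x) ->
  lmass_bounded K g -> forall y r, 0 < r ->
  (\int[mu]_(x in mball y r) (mpot g x `^ (q / theta)) <=
    C%:E * (lmass g (2 * r)%R y + (r `^ n)%:E * tail_pot g r y `^ (q / theta)))%E.
Proof.
move=> K0; have th0 := theta_gt0; have q0 := q_gt0.
pose s := q / theta; have s0 : 0 < s by rewrite divr_gt0.
have D0 : 0 < 2 * c1 `^ (1 - q^-1) * K by rewrite !mulr_gt0// powR_gt0.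
have [A A0 HA] := adams D0.
pose B := 2 `^ (n - gamma) : R; have B0 : 0 < B by rewrite powR_gt0.
pose E := B `^ s * c1; have E0 : 0 < E by rewrite mulr_gt0// powR_gt0.
exists (2 `^ s * (A + E)); first by rewrite mulr_gt0 ?powR_gt0 ?addr_gt0.
move=> g mg g0 HK y r r0.
pose f := (g \* \1_(mball y (2 * r)))%R.
have mB : measurable (mball y (2 * r)) by exact: measurable_mball.
have mBr : measurable (mball y r) by exact: measurable_mball.
have mf : measurable_fun setT f by exact: measurable_funM.
have f0 z : 0 <= f z by rewrite /f/= mulr_ge0.
have fg z : f z <= g z by rewrite /f /= ler_piMr// indicE; case: (_ \in _).
have t0 : (0 <= tail_pot g r y)%E.
  by apply: integral_ge0 => z _; rewrite lee_fin mulr_ge0 ?mker_ge0.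
have mpf : measurable_fun setT (fun x => mpot f x `^ s)%E.
  by apply: (measurableT_comp (measurable_poweR _)); exact: measurable_mpot.
set t := (B%:E * tail_pot g r y)%E.
have tt0 : (0 <= t)%E by rewrite mule_ge0 ?lee_fin ?(ltW B0).
apply: (@le_trans _ _ (\int[mu]_(x in mball y r)
   ((2 `^ s)%:E * (mpot f x `^ s + t `^ s)))%E).
  apply: le_integral_ge0 => x yx; first exact: poweR_ge0.
  apply: le_trans (le_poweR (ltW s0) _ (mpot_split_le mg g0 yx)) _.
    exact: mpot_ge0.
  by apply: poweR_le_addl; rewrite ?(ltW s0)//; exact: mpot_ge0.
rewrite ge0_integralZl//; last 2 first.
- by apply: emeasurable_funD => //; exact: measurable_funTS.
- by move=> x _; rewrite adde_ge0 ?poweR_ge0.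
rewrite EFinM -muleA; apply: lee_pmul => //; rewrite ?lee_fin ?powR_ge0//.
  by apply: integral_ge0 => x _; rewrite adde_ge0 ?poweR_ge0.
rewrite ge0_integralD//; last 3 first.
- by move=> x _; exact: poweR_ge0.
- exact: measurable_funTS.
- by move=> x _; exact: poweR_ge0.
have l0 := lmass_ge0 g (2 * r) y.
set u := (tail_pot g r y `^ s)%E; have u0 : (0 <= u)%E by exact: poweR_ge0.
have ru0 : (0 <= (r `^ n)%:E * u)%E by rewrite mule_ge0// lee_fin powR_ge0.
apply: (@le_trans _ _ (A%:E * lmass g (2 * r)%R y + E%:E * ((r `^ n)%:E * u))%E).
  apply: leeD.
    apply: (@le_trans _ _ (A%:E * \int[mu]_z (f z `^ q)%:E)%E).
      apply: (@le_trans _ _ (\int[mu]_x (mpot f x `^ s))%E).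
        by apply: le_integral_subset => // x _; exact: poweR_ge0.
      apply: HA => // x v v0; apply: le_trans (lmass_morrey K0 mg g0 HK x v0).
      by apply: le_integral_ge0 => z _; rewrite lee_fin.
    apply: lee_wpmul2l; first by rewrite lee_fin ltW.
    rewrite /lmass [leRHS]integral_mkcond; apply: le_integral_ge0 => z _.
      by rewrite lee_fin powR_ge0.
    rewrite /f /patch /= indicE; case: ifP => _; first by rewrite mulr1.
    by rewrite mulr0 powR0// gt_eqF.
  rewrite integral_cst// /t (poweRM _ _ t0) ?lee_fin ?(ltW B0)// poweR_EFin -/u.
  rewrite /E EFinM -!muleA; apply: lee_pmul => //.
  - by rewrite lee_fin powR_ge0.
  - by rewrite mule_ge0.
  rewrite muleA -EFinM [leRHS]muleC; apply: lee_pmul => //.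
  exact: mball_le.
rewrite EFinD ge0_muleDl ?lee_fin ?(ltW A0) ?(ltW E0)//.
by apply: leeD; apply: lee_pmul; rewrite ?lee_fin ?(ltW A0) ?(ltW E0)//;
  [rewrite leeDl|rewrite leeDr].
Qed.

(** For mere finiteness the Morrey growth suffices to control the tail, since n + beta < n - gamma.
    This later gives the almost everywhere convergence of the fractional integral. *)
Lemma local_pot_lty (K : R) (g : T -> R) y r : 0 < K -> measurable_fun setT g ->
  (forall x, 0 <= g x) -> lmass_bounded K g -> 0 < r ->
  (\int[mu]_(x in mball y r) (mpot g x `^ (q / theta)) < +oo)%E.
Proof.
move=> K0 mg g0 HK r0; have [C C0 HC] := local_pot_le K0.
have [gam0 gn bl q1] := And4 gamma_gt0 gamma_ltn beta_lt q_gt1.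
apply: le_lt_trans (HC g mg g0 HK y r r0) _.
have r20 : 0 < 2 * r by rewrite mulr_gt0.
have D0 : 0 < 2 * c1 `^ (1 - q^-1) * K by rewrite !mulr_gt0// powR_gt0.
have b0 : 0 < n - gamma by lra.
have ab : n + beta < n - gamma by lra.
have [F F0 HF] := mker_far mu dist_ge0 measurable_dist b0 ab D0.
have tl : (tail_pot g r y < +oo)%E.
  apply: le_lt_trans (HF (EFin \o g) y (2 * r) _ _ r20 (lmass_morrey K0 mg g0 HK y)) _.
  - exact/measurable_EFinP.
  - by move=> z; rewrite lee_fin.
  - exact: ltry.
have ll : (lmass g (2 * r)%R y < +oo)%E by apply: le_lt_trans (HK y _ r20) _; exact: ltry.
rewrite lte_mul_pinfty ?lee_fin ?(ltW C0)//.
rewrite lte_add_pinfty// lte_mul_pinfty ?lee_fin ?powR_ge0//.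
exact: poweR_lty.
Qed.

(** The local term is the hypothesis at i = 1, that is at radius 2r. In the other term (q/theta)
    (p/q) = p/theta is the exponent of [tail_Lp], and r^n to the power p/q supplies the remaining
    power of r. *)
Lemma pot_Lp (K C k p : R) : 0 < K -> 0 < C -> 0 < k < 1 -> 0 < p ->
  exists2 C' : R, 0 < C' &
  forall g : T -> R, measurable_fun setT g -> (forall x, 0 <= g x) ->
  lmass_bounded K g -> forall r H, 0 < r -> 0 <= H ->
  (forall i : nat, (\int[mu]_y (lmass g (r * 2 ^+ i)%R y `^ (p / q)) <=
    ((C * k ^+ i * H * (r * 2 ^+ i) `^ (n / q)) `^ p)%:E)%E) ->
  (\int[mu]_y ((\int[mu]_(x in mball y r) (mpot g x `^ (q / theta))) `^ (p / q))
     <= (C' * (H * r `^ (n / q)) `^ p)%:E)%E.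
Proof.
move=> K0 C0 k01 p0; have /andP[k0 k1] := k01.
have th0 := theta_gt0; have q0 := q_gt0.
have s0 : 0 < p / q by rewrite divr_gt0.
have [A A0 HA] := local_pot_le K0.
have [F F0 HF] := tail_Lp K0 C0 k01 p0.
pose B := C * k * 2 `^ (n / q); have B0 : 0 < B by rewrite !mulr_gt0// powR_gt0.
exists (A `^ (p / q) * 2 `^ (p / q) * (B `^ p + F)).
  by rewrite !mulr_gt0 ?powR_gt0// addr_gt0// powR_gt0.
move=> g mg g0 HK r H r0 H0 HL.
pose s := p / q; rewrite -/s in s0 *.
pose X y : \bar R := (lmass g (2 * r)%R y `^ s)%E.
pose Y y : \bar R := (tail_pot g r y `^ (p / theta))%E.
have X0 y : (0 <= X y)%E by exact: poweR_ge0.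
have Y0 y : (0 <= Y y)%E by exact: poweR_ge0.
have rn0 : (0 <= ((r `^ n) `^ s)%:E)%E by rewrite lee_fin powR_ge0.
have mX : measurable_fun setT X.
  by apply: (measurableT_comp (measurable_poweR _)); exact: measurable_lmass.
have mY : measurable_fun setT Y.
  by apply: (measurableT_comp (measurable_poweR _)); exact: measurable_tail_pot.
have A2 : 0 <= A `^ s * 2 `^ s by rewrite mulr_ge0 ?powR_ge0.
apply: (@le_trans _ _ (\int[mu]_y
   ((A `^ s * 2 `^ s)%:E * (X y + ((r `^ n) `^ s)%:E * Y y)))%E).
  apply: le_integral_ge0 => y _; first exact: poweR_ge0.
  apply: le_trans (le_poweR (ltW s0) _ (HA g mg g0 HK y r r0)) _.
    by apply: integral_ge0 => x _; exact: poweR_ge0.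
  have u0 : (0 <= (r `^ n)%:E * tail_pot g r y `^ (q / theta))%E.
    by rewrite mule_ge0 ?poweR_ge0// lee_fin powR_ge0.
  have A0' : (0 <= A%:E)%E by rewrite lee_fin ltW.
  have rnE : (0 <= (r `^ n)%:E)%E by rewrite lee_fin powR_ge0.
  rewrite (poweRM _ A0' (adde_ge0 (lmass_ge0 _ _ _) u0)) poweR_EFin.
  rewrite [(A `^ s * _)%:E]EFinM -muleA.
  apply: lee_wpmul2l; first by rewrite lee_fin powR_ge0.
  apply: le_trans (poweR_le_addl (ltW s0) (lmass_ge0 _ _ _) u0) _.
  rewrite (poweRM _ rnE (poweR_ge0 _ _)) poweR_EFin.
  rewrite -poweRrM (_ : q / theta * s = p / theta)//.
  rewrite /s; move: (theta) th0 => th th0.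
  by field; rewrite !gt_eqF.
rewrite ge0_integralZl//; last 2 first.
- by apply: emeasurable_funD => //; exact: measurable_funeM.
- by move=> y _; rewrite adde_ge0// mule_ge0.
rewrite -[X in (X <= _)%E]/(_ * _)%E -mulrA [leRHS]EFinM.
apply: lee_pmul => //.
- by apply: integral_ge0 => y _; rewrite adde_ge0// mule_ge0.
rewrite ge0_integralD//; last 2 first.
- by move=> y _; rewrite mule_ge0.
- exact: measurable_funeM.
rewrite ge0_integralZl// mulrDl EFinD; apply: leeD.
  have := HL 1%N; rewrite expr1 expr1 (mulrC r) => /le_trans; apply.
  rewrite lee_fin -powRM ?(ltW B0) ?mulr_ge0 ?powR_ge0//.
  rewrite (powRM _ _ (ltW r0))// le_eqVlt; apply/orP; left; apply/eqP; congr powR.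
  by rewrite /B; ring.
have HFr := HF g mg g0 HK r H r0 H0 HL.
apply: le_trans (lee_pmul rn0 _ (lexx _) HFr) _.
  by apply: integral_ge0 => y _; exact: Y0.
have rE : (r `^ n) `^ s = (r `^ (n / q)) `^ p.
  by rewrite -!powRrM; congr powR; rewrite /s; ring.
by rewrite -EFinM lee_fin (powRM _ H0 (powR_ge0 _ _)) rE mulrCA [leRHS]mulrA mulrAC mulrA.
Qed.

Lemma pot_Linfty (K C k : R) : 0 < K -> 0 < C -> 0 < k < 1 ->
  exists2 C' : R, 0 < C' &
  forall g : T -> R, measurable_fun setT g -> (forall x, 0 <= g x) ->
  lmass_bounded K g -> forall r H y, 0 < r -> 0 <= H ->
  (forall i : nat, (lmass g (r * 2 ^+ i)%R y <=
    ((C * k ^+ i * H * (r * 2 ^+ i) `^ (n / q)) `^ q)%:E)%E) ->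
  (\int[mu]_(x in mball y r) (mpot g x `^ (q / theta)) <=
     (C' * (H * r `^ (n / q)) `^ q)%:E)%E.
Proof.
move=> K0 C0 k01; have /andP[k0 k1] := k01.
have th0 := theta_gt0; have q0 := q_gt0.
have [A A0 HA] := local_pot_le K0.
have [F F0 HF] := tail_Linfty K0 C0 k01.
pose B := C * k * 2 `^ (n / q); have B0 : 0 < B by rewrite !mulr_gt0// powR_gt0.
exists (A * (B `^ q + F `^ (q / theta))).
  by rewrite !mulr_gt0 ?powR_gt0// addr_gt0// powR_gt0.
move=> g mg g0 HK r H y r0 H0 HL.
have s0 : 0 < q / theta by rewrite divr_gt0.
have t0 : (0 <= tail_pot g r y)%E.
  by apply: integral_ge0 => z _; rewrite lee_fin mulr_ge0 ?mker_ge0.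
apply: le_trans (HA g mg g0 HK y r r0) _.
rewrite -mulrA [leRHS]EFinM; apply: lee_pmul => //.
- by rewrite lee_fin ltW.
- by rewrite adde_ge0 ?lmass_ge0// mule_ge0 ?poweR_ge0// lee_fin powR_ge0.
rewrite [X in (_ <= X%:E)%E]mulrDl [leRHS]EFinD; apply: leeD.
  have := HL 1%N; rewrite expr1 expr1 (mulrC r) => /le_trans; apply.
  rewrite lee_fin -powRM ?(ltW B0) ?mulr_ge0 ?powR_ge0//.
  rewrite (powRM _ _ (ltW r0))// le_eqVlt; apply/orP; left; apply/eqP; congr powR.
  by rewrite /B; ring.
have HFr := le_poweR (ltW s0) t0 (HF g mg g0 HK r H y r0 H0 HL).
apply: (@le_trans _ _ ((r `^ n)%:E * (F * H `^ theta)%:E `^ (q / theta))%E).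
  by apply: lee_pmul; rewrite ?lee_fin ?powR_ge0 ?poweR_ge0.
rewrite poweR_EFin -EFinM lee_fin (powRM _ (ltW F0) (powR_ge0 _ _)).
rewrite (powRM _ H0 (powR_ge0 _ _)) -!powRrM [theta * _]mulrC divfK ?gt_eqF//.
rewrite (divfK (lt0r_neq0 q0)) le_eqVlt; apply/orP; left; apply/eqP.
by ring.
Qed.

(** * Potential bounds from the growth and decay of [phi] *)

Section growth_function.
Variables (phi : R -> R) (Cg Ch k : R).
Hypothesis phi_gt0 : positive_fun phi.
Hypothesis Cg_gt0 : 0 < Cg.
Hypothesis phi_le : forall r, 0 < r -> phi r <= Cg * r `^ beta.
Hypothesis Ch_gt0 : 0 < Ch.
Hypothesis k01 : 0 < k < 1.

Lemma fofana_pot_Lp (p : R) : 0 < p ->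
  (forall r i, 0 < r -> phi (r * 2 ^+ i) * (r * 2 ^+ i) `^ (n / p) <=
     Ch * k ^+ i * (phi r * r `^ (n / p))) ->
  exists B K : R, [/\ 0 < B, 0 < K & forall g : T -> R,
    measurable_fun setT g -> (forall x, 0 <= g x) ->
    (forall r, 0 < r -> (\int[mu]_y (lmass g r y `^ (p / q)) <=
       ((phi r * r `^ (n / p) * r `^ (n / q)) `^ p)%:E)%E) ->
    lmass_bounded B g /\ forall r, 0 < r ->
    (\int[mu]_y ((\int[mu]_(x in mball y r) (mpot g x `^ (q / theta))) `^ (p / q))
     <= (K * (phi r * r `^ (n / p) * r `^ (n / q)) `^ p)%:E)%E].
Proof.
move=> p0 dec.
(* Averaging doubles the radius, which costs [c2], and divides by the measure of a ball, which
   brings in [c0]. The powers r^(n/p) cancel, so the bound on [phi] leaves exactly r^(beta +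
   n/q). *)
pose c2 := 2 `^ (beta + n / p + n / q) : R.
pose B := Cg * c2 * c0 `^ (- p^-1).
have B0 : 0 < B by rewrite /B !mulr_gt0 ?powR_gt0.
have [K K0 HK] := pot_Lp B0 Ch_gt0 k01 p0.
exists B, K; split => // g mg g0 Hg.
have bg : lmass_bounded B g.
  move=> y r r0; have r20 : 0 < 2 * r by rewrite mulr_gt0.
  have A0 : 0 <= phi (2 * r) * (2 * r) `^ (n / p) * (2 * r) `^ (n / q).
    by rewrite !mulr_ge0 ?powR_ge0// ltW// phi_gt0.
  apply: le_trans (lmass_pointwise y p0 A0 r0 (Hg _ r20)) _; rewrite lee_fin.
  apply: ge0_ler_powR; rewrite ?nnegrE ?(ltW q_gt0)//.
  - by rewrite mulr_ge0// powR_ge0.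
  - by rewrite mulr_ge0 ?powR_ge0// ltW.
  have two0 : 0 <= 2 :> R by [].
  apply: (@le_trans _ _ (Cg * (2 * r) `^ beta * (2 * r) `^ (n / p) *
      (2 * r) `^ (n / q) * (c0 * r `^ n) `^ (- p^-1))).
    do 3! (apply: ler_wpM2r; first exact: powR_ge0).
    exact: phi_le.
  rewrite (powRM _ (ltW c0_gt0) (powR_ge0 _ _)) !(powRM _ two0 (ltW r0)).
  rewrite -powRrM.
  have -> : B * r `^ (beta + n / q) = Cg * c0 `^ (- p^-1) *
      (2 `^ beta * 2 `^ (n / p) * 2 `^ (n / q)) *
      (r `^ beta * r `^ (n / q) * (r `^ (n / p) * r `^ (n * - p^-1))).
    rewrite -[r `^ (n / p) * _]powRD ?(gt_eqF r0) ?implybT//.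
    rewrite -[r `^ beta * _]powRD ?(gt_eqF r0) ?implybT//.
    rewrite mulrN subrr powRr0 mulr1 /B /c2.
    rewrite -!(@powRD _ 2) ?pnatr_eq0 ?implybT//.
    by rewrite (mulrAC Cg).
  by rewrite le_eqVlt; apply/orP; left; apply/eqP; ring.
split => // r r0; apply: HK => //.
  by rewrite mulr_ge0 ?powR_ge0// ltW// phi_gt0.
move=> i; have ri0 : 0 < r * 2 ^+ i by rewrite mulr_gt0// exprn_gt0.
apply: le_trans (Hg _ ri0) _; rewrite lee_fin.
have H0 : 0 <= phi (r * 2 ^+ i) * (r * 2 ^+ i) `^ (n / p).
  by rewrite mulr_ge0 ?powR_ge0// ltW// phi_gt0.
apply: ge0_ler_powR; rewrite ?nnegrE ?(ltW p0)//.
- by rewrite mulr_ge0 ?powR_ge0.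
- by rewrite mulr_ge0 ?powR_ge0// (le_trans H0)// dec.
by apply: ler_wpM2r; [exact: powR_ge0|exact: dec].
Qed.

Lemma fofana_pot_Linfty :
  (forall r i, 0 < r -> phi (r * 2 ^+ i) <= Ch * k ^+ i * phi r) ->
  exists B K : R, [/\ 0 < B, 0 < K & forall g : T -> R,
    measurable_fun setT g -> (forall x, 0 <= g x) ->
    (forall r, 0 < r -> {ae mu, forall y, (lmass g r y <=
       ((phi r * r `^ (n / q)) `^ q)%:E)%E}) ->
    lmass_bounded B g /\ forall r y, 0 < r ->
    (\int[mu]_(x in mball y r) (mpot g x `^ (q / theta))
     <= (K * (phi r * r `^ (n / q)) `^ q)%:E)%E].
Proof.
move=> dec.
pose Lc := 2 `^ (n / q) : R; have Lc0 : 0 < Lc by rewrite powR_gt0.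
pose B := Cg * 2 `^ (beta + n / q).
have B0 : 0 < B by rewrite /B !mulr_gt0 ?powR_gt0.
(* Passing from almost every to every center doubles the radius: the dyadic index moves from i to i
   + 1, which gives [k], and the volume factor gives [Lc]. *)
have C2' : 0 < Ch * k * Lc by rewrite !mulr_gt0//; case/andP: k01.
have [K K0 HK] := pot_Linfty B0 C2' k01.
exists B, K; split => // g mg g0 Hg.
have pw y r : 0 < r ->
    (lmass g r y <= ((phi (2 * r) * (2 * r) `^ (n / q)) `^ q)%:E)%E.
  by move=> r0; apply: lmass_pointwise_ae => //; apply: Hg; rewrite mulr_gt0.
have bg : lmass_bounded B g.
  move=> y r r0; have r20 : 0 < 2 * r by rewrite mulr_gt0.
  have two0 : 0 <= 2 :> R by [].
  apply: le_trans (pw y r r0) _; rewrite lee_fin.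
  apply: ge0_ler_powR; rewrite ?nnegrE ?(ltW q_gt0)//.
  - by rewrite mulr_ge0 ?powR_ge0// ltW// phi_gt0.
  - by rewrite mulr_ge0 ?powR_ge0// ltW.
  apply: (@le_trans _ _ (Cg * (2 * r) `^ beta * (2 * r) `^ (n / q))).
    by apply: ler_wpM2r; [exact: powR_ge0|exact: phi_le].
  rewrite -mulrA -powRD ?(gt_eqF r20) ?implybT//.
  by rewrite (powRM _ two0 (ltW r0)) mulrA.
split => // r y r0; apply: HK => //; first by rewrite ltW// phi_gt0.
move=> i; have ri0 : 0 < r * 2 ^+ i by rewrite mulr_gt0// exprn_gt0.
apply: le_trans (pw y _ ri0) _; rewrite lee_fin.
have p0 : 0 <= phi (2 * (r * 2 ^+ i)) by rewrite ltW// phi_gt0// mulr_gt0.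
have E : 2 * (r * 2 ^+ i) = r * 2 ^+ i.+1 by rewrite mulrCA -exprS.
have two0 : 0 <= 2 :> R by [].
rewrite (powRM _ two0 (ltW ri0)) -/Lc.
have -> : Ch * k * Lc * k ^+ i * phi r * (r * 2 ^+ i) `^ (n / q) =
    Ch * k ^+ i.+1 * phi r * (Lc * (r * 2 ^+ i) `^ (n / q)).
  by rewrite exprS; ring.
have q0 := q_gt0.
apply: ge0_ler_powR; rewrite ?nnegrE ?(ltW q0)//.
- by rewrite !mulr_ge0 ?powR_ge0// ltW.
- rewrite !mulr_ge0 ?exprn_ge0 ?powR_ge0 ?(ltW Ch_gt0) ?(ltW Lc0)// ltW//.
    by case/andP: k01.
  exact: phi_gt0.
apply: ler_wpM2r; first by rewrite mulr_ge0 ?powR_ge0// ltW.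
by rewrite E; exact: dec.
Qed.

End growth_function.

End potential_estimates.

(** * Lebesgue measure of Euclidean balls *)

Section Rd_measure.
Context {R : realType} (d : nat).

Lemma lebesgue_sigma_finite : sigma_finite [set: Rd R d] (lebesgue R d).
Proof.
apply: completed_measure_extension_sigma_finite.
exact: (sigma_finiteT (borel_lebesgue d)).
Qed.

(* A copy carrying the sigma-finite structure that Tonelli's theorem needs. *)
Definition lebesgue_fun : set (Rd R d) -> \bar R := lebesgue R d.

HB.instance Definition _ := Measure.copy lebesgue_fun (lebesgue R d).
HB.instance Definition _ :=
  Measure_isSigmaFinite.Build _ _ _ lebesgue_fun lebesgue_sigma_finite.

Definition lebesgueS : {sigma_finite_measure set (Rd R d) -> \bar R} :=
  lebesgue_fun.

Lemma borel_measurable_Rd (A : set (d.-tuple (measurableTypeR R))) :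
  measurable A -> measurable (A : set (Rd R d)).
Proof. exact: caratheodory_measurable_mu_ext. Qed.

Lemma lebesgue_borelE (A : set (d.-tuple (measurableTypeR R))) :
  measurable A -> lebesgue R d A = borel_lebesgue d A.
Proof. by move=> mA; exact: measurable_mu_extE. Qed.

Lemma measurable_borel_id :
  measurable_fun [set: Rd R d] (id : Rd R d -> d.-tuple (measurableTypeR R)).
Proof. by move=> _ A mA; rewrite setTI; exact: borel_measurable_Rd. Qed.

Lemma measurable_coord (i : 'I_d) :
  measurable_fun [set: Rd R d] (fun x : Rd R d => tnth (x : d.-tuple R) i).
Proof.
exact: (measurableT_comp (measurable_tnth i) measurable_borel_id).
Qed.

Lemma measurable_edist :
  measurable_fun [set: Rd R d * Rd R d] (fun z => edist z.1 z.2).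
Proof.
rewrite /edist; apply: (measurableT_comp (continuous_measurable_fun _)).
  exact: sqrt_continuous.
apply: measurable_sum => i; apply: measurable_funX; apply: measurable_funB.
  exact: (measurableT_comp (measurable_coord i)).
exact: (measurableT_comp (measurable_coord i)).
Qed.

Lemma edist_ge0 (x y : Rd R d) : 0 <= edist x y.
Proof. exact: sqrtr_ge0. Qed.

Lemma edist_sym (x y : Rd R d) : edist x y = edist y x.
Proof.
rewrite /edist; congr Num.sqrt; apply: eq_bigr => i _.
by rewrite -sqrrN opprB.
Qed.

End Rd_measure.

(** With A and B the sums of squares and C the mixed sum, the sum of (t a_i - s b_i)^2 is
    nonnegative. Taking t = B and s = C settles B > 0; for B = 0, the choice t = 1, s = (A + 1)/C
    excludes a nonzero C. *)
Lemma cauchy_schwarz_sum (R : realType) (I : finType) (a b : I -> R) :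
  (\sum_i a i * b i) ^+ 2 <= (\sum_i a i ^+ 2) * (\sum_i b i ^+ 2).
Proof.
set A := \sum_i a i ^+ 2; set B := \sum_i b i ^+ 2; set C := \sum_i a i * b i.
have A0 : 0 <= A by apply: sumr_ge0 => i _; exact: sqr_ge0.
have B0 : 0 <= B by apply: sumr_ge0 => i _; exact: sqr_ge0.
have key (t s : R) : 0 <= t ^+ 2 * A - 2 * t * s * C + s ^+ 2 * B.
  have -> : t ^+ 2 * A - 2 * t * s * C + s ^+ 2 * B =
      \sum_i (t * a i - s * b i) ^+ 2.
    rewrite /A /B /C !mulr_sumr -sumrB -big_split /=; apply: eq_bigr => i _.
    by ring.
  by apply: sumr_ge0 => i _; exact: sqr_ge0.
have [B00|Bn0] := eqVneq B 0.
  have [->|C0] := eqVneq C 0; first by rewrite expr0n/= B00 mulr0.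
  have := key 1 ((A + 1) / C).
  have -> : 1 ^+ 2 * A - 2 * 1 * ((A + 1) / C) * C + ((A + 1) / C) ^+ 2 * B =
      - A - 2 by rewrite B00; field.
  by move=> ?; exfalso; lra.
have := key B C.
have {}B0 : 0 < B by rewrite lt_def Bn0.
have -> : B ^+ 2 * A - 2 * B * C * C + C ^+ 2 * B = B * (A * B - C ^+ 2) by ring.
by rewrite pmulr_rge0// subr_ge0.
Qed.

Lemma edist_triangle (R : realType) d (x y z : Rd R d) :
  edist x z <= edist x y + edist y z.
Proof.
rewrite /edist.
pose a i := tnth (x : d.-tuple R) i - tnth (y : d.-tuple R) i.
pose b i := tnth (y : d.-tuple R) i - tnth (z : d.-tuple R) i.
have -> : \sum_(i < d) (tnth (x : d.-tuple R) i - tnth (z : d.-tuple R) i) ^+ 2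
    = \sum_i a i ^+ 2 + 2 * (\sum_i a i * b i) + \sum_i b i ^+ 2.
  rewrite mulr_sumr -!big_split /=; apply: eq_bigr => i _.
  by rewrite /a /b; ring.
rewrite -/(a _); have CS := cauchy_schwarz_sum a b.
have A0 : 0 <= \sum_i a i ^+ 2 by apply: sumr_ge0 => i _; exact: sqr_ge0.
have B0 : 0 <= \sum_i b i ^+ 2 by apply: sumr_ge0 => i _; exact: sqr_ge0.
move: CS A0 B0; rewrite -/(\sum_i a i ^+ 2).
change (\sum_(i < d) (tnth (x : d.-tuple R) i - tnth (y : d.-tuple R) i) ^+ 2)
  with (\sum_i a i ^+ 2).
change (\sum_(i < d) (tnth (y : d.-tuple R) i - tnth (z : d.-tuple R) i) ^+ 2)
  with (\sum_i b i ^+ 2).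
move: (\sum_i a i ^+ 2) (\sum_i b i ^+ 2) (\sum_i a i * b i) => A B C CS A0 B0.
have sA := sqrtr_ge0 A; have sB := sqrtr_ge0 B.
rewrite -[leRHS]ger0_norm ?addr_ge0// -sqrtr_sqr ler_wsqrtr// sqrrD !sqr_sqrtr//.
rewrite lerD2r lerD2l mulr_natl ler_wMn2r//.
apply: le_trans (ler_norm _) _; rewrite -sqrtr_sqr -sqrtrM//.
by rewrite ler_wsqrtr.
Qed.

Section box_measure.
Context {R : realType}.

(** Balls of the sup norm: the product measure gives their volume exactly, and Euclidean balls are
    compared with them. *)
Definition box d (a : d.-tuple R) (r : R) : set (d.-tuple (measurableTypeR R)) :=
  [set x | forall i, `|tnth (x : d.-tuple R) i - tnth a i| < r].

Lemma measurable_box d (a : d.-tuple R) r : measurable (box a r).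
Proof.
have -> : box a r = \bigcap_(i in [set: 'I_d])
    ((fun x : d.-tuple (measurableTypeR R) => tnth x i) @^-1`
       `]tnth a i - r, tnth a i + r[).
  apply/seteqP; split => [x H i _|x H i].
    by rewrite /= in_itv/= -ltr_distl; exact: H.
  by have := H i Logic.I; rewrite /= in_itv/= -ltr_distl.
apply: fin_bigcap_measurable => // i _.
rewrite -[X in measurable X]setTI; apply: (measurable_tnth i) => //.
Qed.

Lemma borel_lebesgue_box d (a : d.-tuple R) (r : R) : 0 < r ->
  borel_lebesgue d (box a r) = ((2 * r) ^+ d)%:E.
Proof.
move=> r0; elim: d a => [|d IH] a.
  rewrite expr0 /= diracE mem_set// => i; by case: i.
case/tupleP: a => a0 a.
have -> : borel_lebesgue d.+1 (box [tuple of a0 :: a] r) =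
  (@lebesgue_measure R \x borel_lebesgue d)%E
    (`]a0 - r, a0 + r[%classic `*` box a r).
  rewrite /= /cons_measure; congr (_ _); apply/seteqP; split => -[x0 x] /=.
    move=> H; split.
      by have := H ord0; rewrite !tnth0 in_itv/= -ltr_distl.
    by move=> i; have := H (lift ord0 i); rewrite !tnthS.
  move=> [H0 H] i; case: (unliftP ord0 i) => [j|] ->.
    by rewrite !tnthS; exact: H.
  by rewrite !tnth0; move: H0; rewrite in_itv/= -ltr_distl.
rewrite product_measure1E//; last exact: measurable_box.
rewrite IH; transitivity ((2 * r)%:E * ((2 * r) ^+ d)%:E)%E; last first.
  by rewrite -EFinM exprS.
congr (_ * _)%E; have := @lebesgue_measure_itv R `]a0 - r, a0 + r[.
rewrite /= lte_fin => ->; rewrite ifT; last by lra.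
by rewrite -EFinD; congr EFin; ring.
Qed.

End box_measure.

Section ball_measure.
Context {R : realType} (d : nat).
Hypothesis d_gt0 : (0 < d)%N.

Lemma eball_sub_box (x : Rd R d) r : eball x r `<=` box (x : d.-tuple R) r.
Proof.
move=> y; rewrite /eball /= => yr i; apply: le_lt_trans yr.
rewrite /edist -sqrtr_sqr ler_wsqrtr// (bigD1 i)//= lerDl sumr_ge0// => j _.
exact: sqr_ge0.
Qed.

(** With half side r/d the squared distance stays below d (r/d)^2 = r^2/d, which is at most r^2; no
    square root of d enters. *)
Lemma box_sub_eball (x : Rd R d) r : 0 < r ->
  box (x : d.-tuple R) (r / d%:R) `<=` eball x r.
Proof.
move=> r0 y H; rewrite /eball /=.
have dR0 : 0 < d%:R :> R by rewrite ltr0n.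
have dR1 : 1 <= d%:R :> R by rewrite ler1n.
rewrite -[ltRHS](ger0_norm (ltW r0)) -sqrtr_sqr /edist ltr_sqrt ?exprn_gt0//.
apply: (@lt_le_trans _ _ (\sum_(i < d) (r / d%:R) ^+ 2)).
  apply: ltr_sum; last first.
    move=> i _; rewrite -[ltLHS]real_normK ?num_real//.
    rewrite ltr_pXn2r ?nnegrE ?divr_ge0 ?(ltW r0) ?(ltW dR0)//.
  by apply/hasP; exists (Ordinal d_gt0); rewrite ?mem_index_enum.
rewrite sumr_const card_ord -(mulr_natl (_ ^+ 2)).
have -> : d%:R * (r / d%:R) ^+ 2 = r ^+ 2 / d%:R by field; rewrite gt_eqF.
by rewrite ler_pdivrMr// ler_peMr// sqr_ge0.
Qed.

Lemma measurable_eball (x : Rd R d) r : measurable (eball x r).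
Proof.
have mx : measurable_fun [set: Rd R d] (fun y => edist y x).
  exact: (measurableT_comp (@measurable_edist R d) (pair2_measurable x)).
rewrite -[eball x r]setTI.
exact: (mx measurableT _ (measurable_itv `]-oo, r[)).
Qed.

Lemma lebesgue_eball_le (x : Rd R d) r : 0 < r ->
  (lebesgue R d (eball x r) <= (2 ^+ d * r `^ d%:R)%:E)%E.
Proof.
move=> r0; apply: (@le_trans _ _ (lebesgue R d (box (x : d.-tuple R) r))).
  apply: le_measure; rewrite ?inE.
  - exact: measurable_eball.
  - by apply: borel_measurable_Rd; exact: measurable_box.
  - exact: eball_sub_box.
rewrite lebesgue_borelE; last exact: measurable_box.
by rewrite borel_lebesgue_box// powR_mulrn ?(ltW r0)// exprMn.
Qed.

Lemma lebesgue_eball_ge (x : Rd R d) r : 0 < r ->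
  (((2 / d%:R) ^+ d * r `^ d%:R)%:E <= lebesgue R d (eball x r))%E.
Proof.
move=> r0; have dR0 : 0 < d%:R :> R by rewrite ltr0n.
have rd0 : 0 < r / d%:R by rewrite divr_gt0.
apply: (@le_trans _ _ (lebesgue R d (box (x : d.-tuple R) (r / d%:R)))).
  rewrite lebesgue_borelE; last exact: measurable_box.
  by rewrite borel_lebesgue_box// powR_mulrn ?(ltW r0)// -exprMn mulrAC mulrA.
apply: le_measure; rewrite ?inE.
- by apply: borel_measurable_Rd; exact: measurable_box.
- exact: measurable_eball.
- exact: box_sub_eball.
Qed.

End ball_measure.

(** * Geometric decay of the growth function *)

Section dyadic_decay.
Context {R : realType}.
Local Notation mu := (@completed_lebesgue_measure R).

Let cR := caratheodory_type ((@wlength R idfun)^*)%mu.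

Lemma measurable_completed_id :
  measurable_fun [set: cR] (id : cR -> measurableTypeR R).
Proof. by move=> _ A mA; rewrite setTI; exact: sub_caratheodory. Qed.

Lemma measurable_completed_itv (i : interval R) : measurable ([set` i] : set cR).
Proof.
rewrite -[X in measurable X]setTI.
exact: (measurable_completed_id measurableT (measurable_itv i)).
Qed.

Lemma completed_lebesgue_itvoc (a b : R) : a <= b ->
  mu `]a, b]%classic = (b - a)%:E.
Proof.
move=> ab; have := @lebesgue_measure_itv R `]a, b].
rewrite /= lte_fin => E; rewrite [LHS]E.
by move: ab; rewrite le_eqVlt => /predU1P[->|->]//; rewrite ltxx subrr.
Qed.

(** On an interval from a to 2a the integrand is at least c/(2a) and the length is a, so each of the
    N dyadic intervals gives c/2. *)
Lemma dyadic_integral_ge (c r : R) N : 0 <= c -> 0 < r ->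
  ((c * (N%:R / 2))%:E <=
   \int[mu]_(t in `]r, (r * 2 ^+ N)%R]) (c * t `^ (-1))%:E)%E.
Proof.
move=> c0 r0; elim: N => [|N IH].
  by rewrite mul0r mulr0; apply: integral_ge0 => t _; rewrite lee_fin mulr_ge0 ?powR_ge0.
have t0 : 0 < r * 2 ^+ N by rewrite mulr_gt0// exprn_gt0.
have tt : r * 2 ^+ N <= r * 2 ^+ N.+1.
  by rewrite exprSr mulrA ler_peMr ?(ltW t0)// ler1n.
have rt : r <= r * 2 ^+ N by rewrite ler_peMr ?(ltW r0)// exprn_ege1// ler1n.
have mf (D : set cR) : measurable_fun D (fun t : cR => (c * (t : R) `^ (-1))%:E).
  apply/measurable_EFinP; apply: measurable_funTS; apply: measurable_funM.
    exact: measurable_cst.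
  exact: (measurableT_comp (measurable_powR _) measurable_completed_id).
have -> : `]r, (r * 2 ^+ N.+1)]%classic =
    `]r, (r * 2 ^+ N)]%classic `|` `](r * 2 ^+ N), (r * 2 ^+ N.+1)]%classic.
  by rewrite -itv_bndbnd_setU// bnd_simp.
rewrite ge0_integral_setU//; first last.
- apply/disj_setPS => x [] /=; rewrite !in_itv/= => /andP[_ xt] /andP[tx _].
  by move: xt; rewrite leNgt tx.
- by move=> t _; rewrite lee_fin mulr_ge0 ?powR_ge0.
- exact: measurable_completed_itv.
- exact: measurable_completed_itv.
rewrite -natr1 mulrDl mulrDr EFinD; apply: leeD => //.
apply: (@le_trans _ _ (\int[mu]_(t in `](r * 2 ^+ N)%R, (r * 2 ^+ N.+1)%R])
   cst (c * (r * 2 ^+ N.+1) `^ (-1))%:E t)%E).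
  rewrite integral_cst; last exact: measurable_completed_itv.
  rewrite [X in (_ * X)%E]completed_lebesgue_itvoc// -EFinM lee_fin -mulrA.
  apply: ler_wpM2l => //; rewrite powR_inv1 ?(le_trans (ltW t0))// exprSr mulrA.
  have -> // : (r * 2 ^+ N * 2)^-1 * (r * 2 ^+ N * 2 - r * 2 ^+ N) = 1 / 2.
  by field; rewrite !gt_eqF// exprn_gt0.
apply: le_integral_ge0 => t; first by rewrite lee_fin mulr_ge0 ?powR_ge0.
rewrite /= in_itv/= => /andP[ta tb]; have tp : 0 < t by exact: lt_trans ta.
rewrite lee_fin; apply: ler_wpM2l => //.
by rewrite !powR_inv1 ?(ltW tp) ?(le_trans (ltW t0))// lef_pV2 ?posrE// (lt_le_trans tp).
Qed.

(* By almost monotonicity the integral over [`]r, r 2^N]] is at least a multiple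
   of [N h(r 2^N)^q], where [h t = phi t * t^e]; a large [N] halves [h]. *)
Lemma dyadic_decay (q e C C1 : R) (phi : R -> R) :
  0 < q -> positive_fun phi -> 0 < C -> 0 < C1 ->
  (forall r s, 0 < r -> r <= s -> phi s * s `^ e <= C * (phi r * r `^ e)) ->
  (forall r, 0 < r ->
    (\int[mu]_(t in `]r, +oo[) (phi t `^ q * t `^ (q * e - 1))%:E
       <= (C1 * phi r `^ q * r `^ (q * e))%:E)%E) ->
  exists Ch k : R, [/\ 0 < Ch, 0 < k < 1 & forall r i, 0 < r ->
    phi (r * 2 ^+ i) * (r * 2 ^+ i) `^ e <= Ch * k ^+ i * (phi r * r `^ e)].
Proof.
move=> q0 phi0 C0 C10 dec int; pose h t := phi t * t `^ e.
have h0 t : 0 < t -> 0 < h t by move=> t0; rewrite mulr_gt0 ?powR_gt0 ?phi0.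
have step N r : 0 < r ->
    (h (r * 2 ^+ N) / C) `^ q * (N%:R / 2) <= C1 * h r `^ q.
  move=> r0; have T0 : 0 < r * 2 ^+ N by rewrite mulr_gt0// exprn_gt0.
  rewrite -lee_fin.
  apply: le_trans (dyadic_integral_ge N (powR_ge0 _ _) r0) _.
  have -> : C1 * h r `^ q = C1 * phi r `^ q * r `^ (q * e).
    by rewrite /h powRM ?powR_ge0 ?(ltW (phi0 _ r0))// -powRrM mulrA [e * q]mulrC.
  apply: le_trans (int r r0); apply: le_integral_subset.
  - by move=> t /=; rewrite !in_itv/= andbT => /andP[].
  - by move=> t _; rewrite lee_fin mulr_ge0 ?powR_ge0.
  - by move=> t _; rewrite lee_fin mulr_ge0 ?powR_ge0.
  move=> t /=; rewrite in_itv/= => /andP[rt tT]; rewrite lee_fin.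
  have t0 : 0 < t by exact: lt_trans rt.
  rewrite powRD ?(gt_eqF t0) ?implybT// mulrA; apply: ler_wpM2r.
    exact: powR_ge0.
  rewrite [q * e]mulrC powRrM -powRM ?powR_ge0 ?(ltW (phi0 _ t0))//.
  apply: ge0_ler_powR; rewrite ?nnegrE ?divr_ge0 ?(ltW q0) ?(ltW (h0 _ _))//.
  - by rewrite -/(h t) ltW// h0.
  - by rewrite ler_pdivrMr// [leRHS]mulrC; exact: dec t0 tT.
have [N [N0 half]] : exists N, (0 < N)%N /\
    forall r, 0 < r -> h (r * 2 ^+ N) <= h r / 2.
  (* If h(r 2^N) > h(r)/2, the left side of [step] exceeds (h(r)/(2C))^q N/2, which is at least C1
     h(r)^q once N >= X: a contradiction. *)
  pose X := 2 * C1 * (2 * C) `^ q.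
  have X0 : 0 <= X by rewrite !mulr_ge0 ?powR_ge0// ltW.
  exists (Num.bound X).+1; split => // r r0.
  set N := (Num.bound X).+1.
  have NX : X <= N%:R.
    by apply: ltW; apply: lt_trans (archi_boundP X0) _; rewrite ltr_nat.
  have T0 : 0 < r * 2 ^+ N by rewrite mulr_gt0// exprn_gt0.
  have hT := h0 _ T0; have hr := h0 _ r0.
  have N0 : 0 < N%:R :> R by rewrite ltr0n.
  have := step N r r0; move: (h (r * 2 ^+ N)) (h r) hT hr => u v u0 v0 H.
  rewrite leNgt; apply/negP => vu.
  have uv : v < 2 * u by rewrite mulrC -ltr_pdivrMr.
  have {}uv : v `^ q < (2 * u) `^ q.
    by rewrite gt0_ltr_powR// ?nnegrE ?(ltW v0)// mulr_ge0// ltW.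
  have E1 : (2 * C) `^ q * (u / C) `^ q = (2 * u) `^ q.
    have C20 : 0 <= 2 * C by rewrite mulr_ge0// ltW.
    have uC0 : 0 <= u / C by rewrite divr_ge0// ltW.
    rewrite -(powRM _ C20 uC0).
    by congr powR; field; rewrite gt_eqF.
  have w0 : 0 < (u / C) `^ q by apply: powR_gt0; exact: divr_gt0.
  suff : C1 * v `^ q < (u / C) `^ q * (N%:R / 2) by rewrite ltNge H.
  apply: (@lt_le_trans _ _ (C1 * (2 * u) `^ q)); first by rewrite ltr_pM2l.
  rewrite -E1 mulrA mulrC; apply: ler_wpM2l; first exact: ltW.
  by rewrite ler_pdivlMr// mulrC mulrA.
have iter m r : 0 < r -> h (r * 2 ^+ (N * m)) <= h r / 2 ^+ m.
  move=> r0; elim: m => [|m IH]; first by rewrite muln0 !expr0 mulr1 divr1.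
  rewrite mulnS addnC exprD mulrA.
  have T0 : 0 < r * 2 ^+ (N * m) by rewrite mulr_gt0// exprn_gt0.
  apply: le_trans (half _ T0) _.
  by rewrite exprSr invfM mulrA ler_pM2r.
(* Chosen so that k^N = 1/2: a halving every N doublings is a decay by [k] per doubling. *)
pose k := 2 `^ (- N%:R^-1) : R.
have N0R : 0 < N%:R :> R by rewrite ltr0n.
have k0 : 0 < k by rewrite powR_gt0.
have k1 : k < 1.
  by rewrite /k powR_expR// expR_lt1 mulNr oppr_lt0 mulr_gt0 ?invr_gt0// ln_gt0 ?ltr1n.
have kN : k ^+ N = 2^-1.
  by rewrite -powR_mulrn ?(ltW k0)// /k -powRrM mulNr mulVf ?gt_eqF// powR_inv1.
(* Write i = m N + j with j < N. The first m N doublings give k^(N m), which is at most 2 k^i, and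
   the last j cost the factor C of almost monotonicity. *)
exists (2 * C), k; split; rewrite ?k0 ?k1//; first by rewrite mulr_gt0.
move=> r i r0; rewrite -!/(h _).
have := divn_eq i N; set m := (i %/ N)%N; set j := (i %% N)%N => iE.
have T0 : 0 < r * 2 ^+ (N * m) by rewrite mulr_gt0// exprn_gt0.
apply: (@le_trans _ _ (C * h (r * 2 ^+ (N * m)))).
  apply: dec => //; rewrite ler_pM2l// ler_eXn2l ?ltr1n//.
  by rewrite iE mulnC leq_addr.
have -> : 2 * C * k ^+ i * h r = C * (2 * k ^+ i * h r) by ring.
apply: ler_wpM2l; first exact: ltW.
apply: le_trans (iter m r r0) _; rewrite [leLHS]mulrC.
apply: ler_wpM2r; first exact/ltW/h0.
have : k ^+ N * k ^+ (N * m) <= k ^+ i.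
  rewrite -exprD ler_iXn2l ?k0 ?k1//.
  by rewrite iE [(m * N)%N]mulnC addnC leq_add2r ltnW// ltn_pmod.
rewrite exprM kN exprVn => km.
by rewrite -ler_pdivrMl.
Qed.

End dyadic_decay.

(** * Norm estimate for the fractional integral *)

Lemma cmod_ge0 (R : realType) (z : R[i]) : 0 <= cmod z.
Proof. by case: z => a b; exact: sqrtr_ge0. Qed.

Lemma cmod_le_ReIm (R : realType) (z : R[i]) :
  cmod z <= `|complex.Re z| + `|complex.Im z|.
Proof.
case: z => a b /=; rewrite -[leRHS]ger0_norm ?addr_ge0// -sqrtr_sqr /cmod /=.
rewrite ler_wsqrtr// sqrrD !real_normK ?num_real// lerD2r lerDl.
by rewrite mulrn_wge0// mulr_ge0.
Qed.

Lemma Re_le_cmod (R : realType) (z : R[i]) : `|complex.Re z| <= cmod z.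
Proof.
by case: z => a b /=; rewrite -sqrtr_sqr /cmod /= ler_wsqrtr// lerDl sqr_ge0.
Qed.

Lemma Im_le_cmod (R : realType) (z : R[i]) : `|complex.Im z| <= cmod z.
Proof.
by case: z => a b /=; rewrite -sqrtr_sqr /cmod /= ler_wsqrtr// lerDr sqr_ge0.
Qed.

Lemma measurable_cmod (R : realType) d (f : Rd R d -> R[i]) :
  cmeasurable f -> measurable_fun [set: Rd R d] (fun x => cmod (f x)).
Proof.
move=> [mre mim].
rewrite (_ : (fun x => _) =
    fun x => Num.sqrt (complex.Re (f x) ^+ 2 + complex.Im (f x) ^+ 2)).
  apply: (measurableT_comp (continuous_measurable_fun _)).
    exact: sqrt_continuous.
  by apply: measurable_funD; apply: measurable_funX.
by apply/funext => x; rewrite /cmod; case: (f x).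
Qed.

Section frac_int_bound.
Context {R : realType} (d : nat) (rho : R -> R) (gamma C : R).
Hypothesis d_gt0 : (0 < d)%N.
Hypothesis rho_gt0 : positive_fun rho.
Hypothesis C_gt0 : 0 < C.
Hypothesis rho_le : forall r, 0 < r -> rho r <= C * r `^ gamma.
Local Notation riesz := (mker (@edist R d) (d%:R - gamma)).

(** At distance 0 the kernel divides by 0^d = 0 and is therefore 0, so the value of [rho] at 0 never
    matters. *)
Lemma frac_kernel_ge0 (x y : Rd R d) : 0 <= frac_kernel rho x y.
Proof.
have := edist_ge0 x y; rewrite /frac_kernel le_eqVlt => /predU1P[<-|d0].
  by rewrite expr0n eqn0Ngt d_gt0/= invr0 mulr0.
by rewrite divr_ge0 ?exprn_ge0 ?edist_ge0// ltW// rho_gt0.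
Qed.

Lemma frac_kernel_le (x y : Rd R d) : frac_kernel rho x y <= C * riesz x y.
Proof.
have := edist_ge0 x y; rewrite /frac_kernel /mker le_eqVlt => /predU1P[<-|d0].
  rewrite expr0n eqn0Ngt d_gt0/= invr0 mulr0.
  by rewrite mulr_ge0 ?powR_ge0// ltW.
rewrite ler_pdivrMr ?exprn_gt0// -mulrA -powR_mulrn ?edist_ge0//.
rewrite -powRD ?(gt_eqF d0) ?implybT//.
have -> : - (d%:R - gamma) + d%:R = gamma by ring.
exact: rho_le.
Qed.

(** Real and imaginary parts obey the same bound by [abs_fine_integral_le], which holds without
    integrability; their sum accounts for the factor 2. *)
Lemma cmod_frac_int_le (f : Rd R d -> R[i]) x : cmeasurable f ->
  ((cmod (frac_int rho f x))%:E <=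
   (2 * C)%:E * mpot (lebesgueS d) (@edist R d) d%:R gamma (cmod \o f) x)%E.
Proof.
move=> mf; set M := mpot _ _ _ _ _ _.
have kf y (z : R) : `|z| <= cmod (f y) ->
    (`|frac_kernel rho x y * z|%:E <= (C * (riesz x y * cmod (f y)))%:E)%E.
  move=> zf; rewrite lee_fin normrM ger0_norm ?frac_kernel_ge0// mulrA.
  by apply: ler_pM; rewrite ?frac_kernel_ge0 ?frac_kernel_le.
have CM : (\int[lebesgue R d]_y (C * (riesz x y * cmod (f y)))%:E <= C%:E * M)%E.
  under eq_integral do rewrite EFinM.
  rewrite ge0_integralZl_EFin; first exact: lexx.
  - exact: measurableT.
  - by move=> y _; rewrite lee_fin mulr_ge0 ?mker_ge0 ?cmod_ge0.
  - apply/measurable_EFinP; apply: measurable_funM; last exact: measurable_cmod.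
    exact: (measurable_mker (@measurable_edist R d)).
  - exact: ltW.
have re : ((`|complex.Re (frac_int rho f x)|)%:E <= C%:E * M)%E.
  apply: le_trans CM; apply: abs_fine_integral_le => y.
  have -> : complex.Re ((frac_kernel rho x y)%:C%C * f y) =
      frac_kernel rho x y * complex.Re (f y).
    by case: (f y) => a b /=; rewrite mul0r subr0.
  by apply: kf; exact: Re_le_cmod.
have im : ((`|complex.Im (frac_int rho f x)|)%:E <= C%:E * M)%E.
  apply: le_trans CM; apply: abs_fine_integral_le => y.
  have -> : complex.Im ((frac_kernel rho x y)%:C%C * f y) =
      frac_kernel rho x y * complex.Im (f y).
    by case: (f y) => a b /=; rewrite mul0r addr0.
  by apply: kf; exact: Im_le_cmod.
apply: (@le_trans _ _ (`|complex.Re (frac_int rho f x)|%:E +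
    `|complex.Im (frac_int rho f x)|%:E)%E).
  by rewrite -EFinD lee_fin cmod_le_ReIm.
rewrite (_ : (2 * C)%:E * M = C%:E * M + C%:E * M)%E; first exact: leeD.
rewrite EFinM -muleA (mule_natl _ 2).
by rewrite mule2n.
Qed.

End frac_int_bound.

(* The norm estimate does not assume [rho] measurable, so it has to handle norms of
   the possibly nonmeasurable function [frac_int rho f]. *)
Section Lnorm_without_measurability.
Context dd (T : measurableType dd) (R : realType) (mu : {measure set T -> \bar R}).
Local Open Scope ereal_scope.
Import HBNNSimple.

Let integral_scale_le (c : R) (f : T -> \bar R) : (0 < c)%R ->
  (forall x, 0 <= f x) ->
  \int[mu]_x (c%:E * f x) <= c%:E * \int[mu]_x f x.
Proof.
move=> c0 f0; have cf0 x : 0 <= c%:E * f x.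
  by rewrite mule_ge0// lee_fin ltW.
rewrite (ge0_integralTE _ cf0); apply: ge_ereal_sup => _ [h /= hf <-].
have c10 : (0 <= c^-1)%R by rewrite invr_ge0 ltW.
rewrite muleC -lee_pdivrMr// muleC -sintegralrM.
rewrite (ge0_integralTE _ f0); apply: ereal_sup_ubound.
exists (scale_nnsfun h c10) => // x /=.
by rewrite EFinM muleC lee_pdivrMr// muleC.
Qed.

(** Dividing by c turns the simple functions below c f into simple functions below f, which gives
    one inequality; applying it to the factor 1/c gives the other. *)
Lemma integral_scale D (c : R) (f : T -> \bar R) : (0 < c)%R ->
  (forall x, D x -> 0 <= f x) ->
  \int[mu]_(x in D) (c%:E * f x) = c%:E * \int[mu]_(x in D) f x.
Proof.
move=> c0 f0; rewrite integral_mkcond [in RHS]integral_mkcond.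
have pf0 x : 0 <= (f \_ D) x by exact: erestrict_ge0.
have -> : (fun x => c%:E * f x) \_ D = fun x => c%:E * (f \_ D) x.
  by apply/funext => x; rewrite /patch; case: ifP; rewrite ?mule0.
apply/eqP; rewrite eq_le integral_scale_le//=.
rewrite muleC -lee_pdivlMr// muleC.
have c10 : (0 < c^-1)%R by rewrite invr_gt0.
apply: le_trans (integral_scale_le c10 _) => [|x]; last first.
  by rewrite mule_ge0// lee_fin ltW.
rewrite le_eqVlt; apply/orP; left; apply/eqP; apply: eq_integral => x _.
by rewrite muleA -EFinM mulVf ?gt_eqF// mul1e.
Qed.

Lemma Lnorm_indic (h : T -> R) (A : set T) (s : R) :
  (forall x, (0 <= h x)%R) -> (0 < s)%R ->
  Lnorm mu s%:E (fun x => (h x * \1_A x)%:E) =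
  (\int[mu]_(x in A) (h x `^ s)%:E) `^ s^-1.
Proof.
move=> h0 s0; rewrite Lnorm.unlock; apply: (f_equal (fun z => poweR z s^-1)).
rewrite [RHS]integral_mkcond; apply: eq_integral => x _.
rewrite /patch indicE; case: ifP => _ /=.
  by rewrite mulr1 ger0_norm.
by rewrite mulr0 normr0 powR0// gt_eqF.
Qed.

Lemma Lnorm_ge0E (s : R) (f : T -> \bar R) : (forall x, 0 <= f x) ->
  Lnorm mu s%:E f = (\int[mu]_x (f x `^ s)) `^ s^-1.
Proof.
move=> f0; rewrite Lnorm.unlock; apply: (f_equal (fun z => poweR z s^-1)).
by apply: eq_integral => x _; rewrite gee0_abs.
Qed.

Lemma le_Lnorm (p : \bar R) (f g : T -> \bar R) : 0 < p ->
  (forall x, 0 <= f x) -> (forall x, f x <= g x) ->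
  Lnorm mu p f <= Lnorm mu p g.
Proof.
move=> p0 f0 fg; have g0 x : 0 <= g x by exact: le_trans (fg x).
case: p p0 => [s|_|//].
  rewrite lte_fin => s0; rewrite !Lnorm_ge0E//; apply: le_poweR.
  - by rewrite invr_ge0 ltW.
  - by apply: integral_ge0 => x _; exact: poweR_ge0.
  apply: le_integral_ge0 => x _; first exact: poweR_ge0.
  by apply: le_poweR => //; exact: ltW.
rewrite Lnorm.unlock; case: ifP => // _.
by apply: le_ess_sup; apply: nearW => x /=; rewrite !gee0_abs.
Qed.

Lemma Lnorm_scale (p : \bar R) (c : R) (f : T -> \bar R) : 0 < p ->
  (0 < c)%R -> (forall x, 0 <= f x) ->
  Lnorm mu p (fun x => c%:E * f x) = c%:E * Lnorm mu p f.
Proof.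
move=> p0 c0 f0; have cf0 x : 0 <= c%:E * f x.
  by rewrite mule_ge0// lee_fin ltW.
case: p p0 => [s|_|//].
  rewrite lte_fin => s0; rewrite !Lnorm_ge0E//.
  have c0' : 0 <= c%:E by rewrite lee_fin ltW.
  under eq_integral do rewrite (poweRM _ c0' (f0 _)) poweR_EFin.
  rewrite integral_scale ?powR_gt0//; last by move=> x _; exact: poweR_ge0.
  rewrite poweRM ?lee_fin ?powR_ge0//; last first.
    by apply: integral_ge0 => x _; exact: poweR_ge0.
  by rewrite poweR_EFin -powRrM mulfV ?gt_eqF// powRr1// ltW.
rewrite Lnorm.unlock; case: ifP => [_|]; last by rewrite mule0.
rewrite -ess_sup_pZl//; congr ess_sup; apply/funext => x /=.
by rewrite !gee0_abs.
Qed.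

End Lnorm_without_measurability.

(** * Transfer of the potential bounds to the Fofana norms *)

Section fofana_estimate.
Context {R : realType} (d : nat) (q : R) (p : \bar R).
Variables (gamma beta : R) (phi rho : R -> R) (qbar : R) (pbar : \bar R).
Hypothesis d_gt0 : (0 < d)%N.
Hypothesis q_gt1 : 1 < q.
Hypothesis q_le_p : (q%:E <= p)%E.
Hypothesis gamma_gt0 : 0 < gamma.
Hypothesis gamma_lt : gamma < d%:R / q.
Hypothesis beta_lt : beta < - gamma.
Variables (Cg Ch k : R).
Hypothesis phi_gt0 : positive_fun phi.
Hypothesis Cg_gt0 : 0 < Cg.
Hypothesis phi_le : forall r, 0 < r -> phi r <= Cg * r `^ beta.
Hypothesis Ch_gt0 : 0 < Ch.
Hypothesis k01 : 0 < k < 1.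
Hypothesis phi_dec : forall r i, 0 < r ->
  phi (r * 2 ^+ i) * (r * 2 ^+ i) `^ (d%:R * einv p) <=
  Ch * k ^+ i * (phi r * r `^ (d%:R * einv p)).
Hypothesis rho_gt0 : positive_fun rho.
Hypothesis rho_le : forall r, 0 < r -> rho r <= Cg * r `^ gamma.
Local Notation theta := (1 + gamma / beta).
Hypothesis pbarE : (pbar^-1 = p^-1 * theta%:E)%E.
Hypothesis qbarE : qbar^-1 = q^-1 * theta.
Local Notation n := (d%:R : R).
Local Notation mu := (lebesgueS (R := R) d).
Local Notation dist := (@edist R d).
Local Notation lmass := (lmass mu dist q).
Local Notation mpot := (mpot mu dist n gamma).
(** The inverse of the weight at radius r in the norm of the source space. *)
Let A r := phi r * r `^ (n * einv p) * r `^ (n / q).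

Let q_gt0 : 0 < q. Proof. exact: lt_trans q_gt1. Qed.

Let beta_lt0 : beta < 0.
Proof. by apply: lt_trans beta_lt _; rewrite oppr_lt0. Qed.

Let theta_gt0 : 0 < theta. Proof. exact: one_plus_ratio_gt0. Qed.

Let qbarE' : qbar = q / theta.
Proof. by rewrite -[LHS]invrK qbarE invfM invrK. Qed.

Let qbar_gt0 : 0 < qbar. Proof. by rewrite qbarE' divr_gt0. Qed.

Let gamma_ltn : gamma < n.
Proof.
by apply: lt_le_trans gamma_lt _; rewrite ler_pdivrMr// ler_peMr// ltW.
Qed.

Let c1_gt0 : 0 < 2 ^+ d :> R. Proof. by rewrite exprn_gt0. Qed.

Let c0_gt0 : 0 < (2 / n) ^+ d :> R.
Proof. by rewrite exprn_gt0// divr_gt0// ltr0n. Qed.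

Let mball_eball x r : mball dist x r = eball x r.
Proof. by apply/seteqP; split => y; rewrite /mball /eball /= edist_sym. Qed.

Let mball_le x r : 0 < r -> (mu (mball dist x r) <= (2 ^+ d * r `^ n)%:E)%E.
Proof. by move=> r0; rewrite mball_eball; exact: lebesgue_eball_le. Qed.

Let mball_ge x r : 0 < r ->
  (((2 / n) ^+ d * r `^ n)%:E <= mu (mball dist x r))%E.
Proof. by move=> r0; rewrite mball_eball; exact: lebesgue_eball_ge. Qed.

Let p_gt0 : (0 < p)%E.
Proof. by apply: lt_le_trans q_le_p; rewrite lte_fin. Qed.

(** [Lnorm] at infinite exponent is an essential supremum only on a space of positive measure; the
    unit ball at the origin ensures this. *)
Let mu_gt0 : (0 < lebesgue R d [set: Rd R d])%E.
Proof.
have := mball_ge [tuple of nseq d 0] ltr01.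
move=> /le_trans => /(_ _ (le_measure mu _ _ (@subsetT _ _))).
rewrite !inE => H; apply: (@lt_le_trans _ _ (((2 / n) ^+ d * 1 `^ n)%:E)).
  by rewrite lte_fin mulr_gt0// powR_gt0.
apply: H => //.
exact: (measurable_mball (@measurable_edist R d)).
Qed.

Lemma fofana_norm_le_local (f : Rd R d -> R[i]) (D r : R) : 0 < r ->
  (fofana_norm q%:E p phi f <= D%:E)%E ->
  (local_norm q%:E p r f <= (D * A r)%:E)%E.
Proof.
move=> r0 fD.
pose B := (phi r)^-1 * r `^ (n * (- einv q%:E - einv p)).
have B0 : 0 < B by rewrite mulr_gt0 ?invr_gt0 ?phi_gt0 ?powR_gt0.
have : (B%:E * local_norm q%:E p r f <= D%:E)%E.
  by apply: le_trans fD; apply: ereal_sup_ubound; exists r.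
rewrite muleC -lee_pdivlMr// -EFinM => /le_trans; apply.
rewrite lee_fin le_eqVlt; apply/orP; left; apply/eqP; congr (_ * _).
rewrite /B invfM invrK /A -mulrA; congr (_ * _).
rewrite -powRN -powRD ?(gt_eqF r0) ?implybT//; congr powR.
by rewrite /einv inver (gt_eqF q_gt0) /=; ring.
Qed.

(** The quantities 1/pbar, 1/qbar and q/qbar all carry the factor [theta], so the weight of the
    target space is exactly the inverse of [A r] to the power [theta]. *)
Lemma fofana_norm_ge_local (h : Rd R d -> R[i]) (K : R) :
  (forall r, 0 < r -> (local_norm qbar%:E pbar r h <= (K * A r `^ theta)%:E)%E) ->
  (fofana_norm qbar%:E pbar (fun r => (phi r `^ (q / qbar))%R) h <= K%:E)%E.
Proof.
move=> H; apply: ge_ereal_sup => _ [r /= r0 <-].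
set B := _ * _ `^ _.
have B0 : 0 <= B by rewrite mulr_ge0 ?invr_ge0 ?powR_ge0.
apply: le_trans (lee_wpmul2l _ (H r r0)) _; first by rewrite lee_fin.
rewrite -EFinM lee_fin le_eqVlt; apply/orP; left; apply/eqP.
have qE : q / qbar = theta.
  by rewrite qbarE mulrA mulfV ?mul1r// gt_eqF.
have einvp : einv pbar = einv p * theta.
  rewrite /einv pbarE; case: p p_gt0 => [s|_|//].
    by rewrite lte_fin => s0; rewrite inver (gt_eqF s0) -EFinM.
  by rewrite invey mul0e /= mul0r.
rewrite mulrCA -[RHS]mulr1; congr (_ * _).
rewrite /B qE /einv inver (gt_eqF qbar_gt0) /= -/(einv pbar) einvp qbarE /A.
have p0 := phi_gt0 r0.
rewrite -[phi r * _ * _]mulrA (powRM _ (ltW p0)); last first.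
  by rewrite mulr_ge0 ?powR_ge0.
rewrite -powRD ?(gt_eqF r0) ?implybT// -powRrM mulrACA.
rewrite mulVf ?gt_eqF ?powR_gt0// mul1r -powRD ?(gt_eqF r0) ?implybT//.
rewrite [X in r `^ X](_ : _ = 0) ?powRr0//.
by ring.
Qed.

Lemma lmass_scale (f : Rd R d -> R[i]) (D r : R) y : 0 < D ->
  (\int[mu]_(x in mball dist y r) (cmod (f x) `^ q)%:E =
   (D `^ q)%:E * lmass (fun x => (cmod (f x) / D)%R) r y)%E.
Proof.
move=> D0; transitivity (\int[mu]_(x in mball dist y r)
    ((D `^ q)%:E * ((cmod (f x) / D) `^ q)%:E))%E.
  apply: eq_integral => x _.
  have fD0 : 0 <= cmod (f x) / D by rewrite divr_ge0 ?cmod_ge0// ltW.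
  by rewrite -EFinM -(powRM _ (ltW D0) fD0) mulrC divfK// gt_eqF.
apply: integral_scale; first exact: powR_gt0.
by move=> x _; rewrite lee_fin; exact: powR_ge0.
Qed.

Lemma poweR_cancel (D s : R) (X : \bar R) : 0 < D -> 0 < s -> (0 <= X)%E ->
  (((D `^ s)%:E * X) `^ s^-1 = D%:E * X `^ s^-1)%E.
Proof.
move=> D0 s0 X0; have Ds0 : (0 <= (D `^ s)%:E)%E by rewrite lee_fin powR_ge0.
rewrite (poweRM _ Ds0 X0) poweR_EFin -powRrM mulfV ?(gt_eqF s0)//.
by rewrite powRr1 ?(ltW D0).
Qed.

Lemma local_normE (f : Rd R d -> R[i]) (D r : R) : 0 < D ->
  local_norm q%:E p r f =
  (D%:E * Lnorm (lebesgue R d) p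
     (fun y => lmass (fun x => (cmod (f x) / D)%R) r y `^ q^-1))%E.
Proof.
move=> D0; rewrite -(Lnorm_scale (lebesgue R d) p_gt0 D0); last first.
  by move=> y; exact: poweR_ge0.
apply: (f_equal (Lnorm (lebesgue R d) p)); apply/funext => y.
rewrite (Lnorm_indic _ _ _ q_gt0); last by move=> x; exact: cmod_ge0.
rewrite -(poweR_cancel D0 q_gt0 (lmass_ge0 _ _ _ _ _ _)) -lmass_scale//.
by rewrite mball_eball.
Qed.

Lemma local_norm_frac_int_le (f : Rd R d -> R[i]) (D r : R) :
  cmeasurable f -> 0 < D -> (0 < pbar)%E ->
  (local_norm qbar%:E pbar r (frac_int rho f) <=
  (2 * Cg * D)%:E * Lnorm (lebesgue R d) pbar (fun y =>
     (\int[mu]_(x in mball dist y r)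
        (mpot (fun x => cmod (f x) / D)%R x `^ (q / theta))) `^ (theta / q)))%E.
Proof.
move=> mf D0 pb0; pose g := fun x : Rd R d => (cmod (f x) / D)%R; rewrite -/g.
have g0 x : 0 <= g x by rewrite divr_ge0 ?cmod_ge0// ltW.
have mp0 x : (0 <= mpot g x)%E by exact: mpot_ge0.
have CD : 0 < 2 * Cg * D by rewrite !mulr_gt0.
have fE x : (mpot (cmod \o f) x = D%:E * mpot g x)%E.
  transitivity (\int[mu]_y
      (D%:E * (mker dist (n - gamma) x y * g y)%:E))%E; last first.
    apply: integral_scale => // y _; rewrite lee_fin; apply: mulr_ge0 => //.
    exact: mker_ge0.
  apply: eq_integral => y _; rewrite -EFinM /g /=; congr EFin.
  by field; rewrite gt_eqF.
rewrite -(Lnorm_scale (lebesgue R d) pb0 CD); last first.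
  by move=> y; exact: poweR_ge0.
apply: le_Lnorm => // y; first exact: Lnorm_ge0.
rewrite (Lnorm_indic _ _ _ qbar_gt0); last by move=> x; exact: cmod_ge0.
have -> : theta / q = qbar^-1 by rewrite qbarE mulrC.
rewrite -qbarE'.
have J0 : (0 <= \int[mu]_(x in mball dist y r) (mpot g x `^ qbar))%E.
  by apply: integral_ge0 => x _; exact: poweR_ge0.
rewrite -(poweR_cancel CD qbar_gt0 J0).
apply: le_poweR.
- by rewrite invr_ge0 ltW.
- by apply: integral_ge0 => x _; rewrite lee_fin powR_ge0.
apply: (@le_trans _ _ (\int[mu]_(x in mball dist y r)
    (((2 * Cg * D) `^ qbar)%:E * mpot g x `^ qbar))%E); last first.
  rewrite le_eqVlt; apply/orP; left; apply/eqP; apply: integral_scale.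
    exact: powR_gt0.
  by move=> x _; exact: poweR_ge0.
rewrite mball_eball; apply: le_integral_ge0 => x _.
  by rewrite lee_fin powR_ge0.
have CD0 : (0 <= (2 * Cg * D)%:E)%E by rewrite lee_fin ltW.
rewrite -!poweR_EFin -(poweRM _ CD0 (mp0 x)); apply: le_poweR.
- exact: ltW.
- by rewrite lee_fin cmod_ge0.
apply: le_trans (cmod_frac_int_le d_gt0 rho_gt0 Cg_gt0 rho_le x mf) _.
by rewrite fE muleA -EFinM.
Qed.

(** [D] is any positive bound of the norm, not the norm itself, which may be 0. The potential bounds
    are applied to |f|/D and D is factored out, so the result is linear in D. *)
Lemma fofana_core : exists2 K : R, 0 < K &
  forall (f : Rd R d -> R[i]) (D : R), cmeasurable f -> 0 < D ->
  (fofana_norm q%:E p phi f <= D%:E)%E ->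
  (fofana_norm qbar%:E pbar (fun r => (phi r `^ (q / qbar))%R) (frac_int rho f)
     <= (K * D)%:E)%E /\
  forall y r, 0 < r ->
    (\int[mu]_(x in mball dist y r)
       (mpot (fun x => (cmod (f x) / D)%R) x `^ (q / theta)) < +oo)%E.
Proof.
have th0 := theta_gt0; have q0 := q_gt0.
have mg (f : Rd R d -> R[i]) (D : R) : cmeasurable f ->
    measurable_fun setT (fun x => (cmod (f x) / D)%R).
  by move=> mf; apply: measurable_funM; [exact: measurable_cmod|exact: measurable_cst].
have g0 (f : Rd R d -> R[i]) (D : R) : 0 < D -> forall x, 0 <= cmod (f x) / D.
  by move=> D0 x; rewrite divr_ge0 ?cmod_ge0// ltW.
have ptri (x y z : Rd R d) : edist x z <= edist x y + edist y z.
  exact: edist_triangle.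
have := p_gt0; have := phi_dec; have := pbarE.
case pE : (p) => [s| |//].
  move=> pbE dec; rewrite lte_fin => s0.
  have es : einv p = s^-1 by rewrite /einv pE inver (gt_eqF s0).
  have pbE' : pbar = (s / theta)%:E.
    rewrite -[LHS]inveK pbE inver (gt_eqF s0) -EFinM inver.
    by rewrite mulf_eq0 invr_eq0 !gt_eqF// invfM invrK.
  have {}dec r i : 0 < r -> phi (r * 2 ^+ i) * (r * 2 ^+ i) `^ (n / s) <=
      Ch * k ^+ i * (phi r * r `^ (n / s)).
    by move=> /(dec r i); rewrite -pE es.
  have [B [K [B0 K0 HK]]] := fofana_pot_Lp (@edist_ge0 R d) (@edist_sym R d)
    (@measurable_edist R d) c1_gt0 mball_le gamma_gt0 gamma_ltn beta_lt q_gt1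
    c0_gt0 mball_ge ptri phi_gt0 Cg_gt0 phi_le Ch_gt0 k01 s0 dec.
  exists (2 * Cg * K `^ (theta / s)); first by rewrite !mulr_gt0 ?powR_gt0.
  move=> f D mf D0; rewrite -[X in fofana_norm _ X _ _]pE => fD.
  have AE r : A r = phi r * r `^ (n / s) * r `^ (n / q) by rewrite /A es.
  have Hl r : 0 < r -> (\int[mu]_y (lmass (fun x => (cmod (f x) / D)%R) r y
      `^ (s / q)) <= ((phi r * r `^ (n / s) * r `^ (n / q)) `^ s)%:E)%E.
    move=> r0; have := fofana_norm_le_local r0 fD.
    rewrite (local_normE _ _ D0) pE EFinM lee_pmul2l ?lte_fin//.
    rewrite Lnorm_ge0E; last by move=> y; exact: poweR_ge0.
    move=> H; have := le_poweR (ltW s0) (poweR_ge0 _ _) H.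
    have I0 : (0 <= \int[lebesgue R d]_y
        ((lmass (fun x => (cmod (f x) / D)%R) r y `^ q^-1) `^ s))%E.
      by apply: integral_ge0 => y _; exact: poweR_ge0.
    rewrite (poweRVK s0 I0).
    rewrite poweR_EFin AE => /(le_trans _); apply; apply: le_integral_ge0 => y _.
      exact: poweR_ge0.
    by rewrite -poweRrM mulrC.
  have [bg Hp] := HK _ (mg f D mf) (g0 f D D0) Hl.
  split; last first.
    move=> y r r0; exact: (local_pot_lty (@edist_ge0 R d) (@edist_sym R d)
      (@measurable_edist R d) c1_gt0 mball_le gamma_gt0 gamma_ltn beta_lt q_gt1
      ptri y B0 (mg f D mf) (g0 f D D0) bg r0).
  apply: fofana_norm_ge_local => r r0.
  apply: le_trans (local_norm_frac_int_le _ mf D0 _) _.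
    by rewrite pbE' lte_fin divr_gt0.
  rewrite pbE' Lnorm_ge0E; last by move=> y; exact: poweR_ge0.
  pose J y := (\int[mu]_(x in mball dist y r)
    (mpot (fun x => (cmod (f x) / D)%R) x `^ (q / theta)))%E.
  have J0 y : (0 <= J y)%E by apply: integral_ge0 => x _; exact: poweR_ge0.
  rewrite [X in (_ * (X `^ _))%E](_ : _ = \int[mu]_y (J y `^ (s / q)))%E; last first.
    apply: eq_integral => y _; rewrite -/(J y) -poweRrM.
    by congr (_ `^ _)%E; rewrite mulrC mulrA divfK ?gt_eqF.
  rewrite invf_div.
  have JI0 : (0 <= \int[mu]_y (J y `^ (s / q)))%E.
    by apply: integral_ge0 => y _; exact: poweR_ge0.
  have ts : 0 <= theta / s by rewrite divr_ge0// ltW.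
  have := le_poweR ts JI0 (Hp r r0); rewrite -AE.
  have CD0 : (0 <= (2 * Cg * D)%:E)%E by rewrite lee_fin ltW// !mulr_gt0.
  move=> /(lee_wpmul2l CD0) /le_trans; apply.
  rewrite poweR_EFin -EFinM lee_fin (powRM _ (ltW K0) (powR_ge0 _ _)) -powRrM.
  rewrite [s * _]mulrC divfK ?gt_eqF// le_eqVlt; apply/orP; left; apply/eqP.
  by ring.
(* The case of infinite [p]: then [pbar] is infinite too, and the almost everywhere bound on the
   masses yields a bound on the potential at every center. *)
move=> pbE dec _; have e0 : einv p = 0 by rewrite /einv pE invey.
have pbE' : pbar = +oo%E by rewrite -[LHS]inveK pbE invey mul0e inve0.
have {}dec r i : 0 < r -> phi (r * 2 ^+ i) <= Ch * k ^+ i * phi r.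
  by move=> /(dec r i); rewrite -pE e0 mulr0 !powRr0 !mulr1.
have [B [K [B0 K0 HK]]] := fofana_pot_Linfty (@edist_ge0 R d) (@edist_sym R d)
  (@measurable_edist R d) c1_gt0 mball_le gamma_gt0 gamma_ltn beta_lt q_gt1
  c0_gt0 mball_ge ptri phi_gt0 Cg_gt0 phi_le Ch_gt0 k01 dec.
exists (2 * Cg * K `^ (theta / q)); first by rewrite !mulr_gt0 ?powR_gt0.
move=> f D mf D0; rewrite -[X in fofana_norm _ X _ _]pE => fD.
have AE r : A r = phi r * r `^ (n / q) by rewrite /A e0 mulr0 powRr0 mulr1.
have Hl r : 0 < r -> {ae mu, forall y, (lmass (fun x => (cmod (f x) / D)%R) r y
    <= ((phi r * r `^ (n / q)) `^ q)%:E)%E}.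
  move=> r0; have := fofana_norm_le_local r0 fD.
  rewrite (local_normE _ _ D0) pE EFinM lee_pmul2l ?lte_fin//.
  rewrite Lnorm.unlock mu_gt0 => /ess_supP; apply: filterS => y /=.
  rewrite gee0_abs ?poweR_ge0// => H.
  have := le_poweR (ltW q0) (poweR_ge0 _ _) H.
  by rewrite (poweRVK q0 (lmass_ge0 _ _ _ _ _ _)) poweR_EFin AE.
have [bg Hp] := HK _ (mg f D mf) (g0 f D D0) Hl.
split; last first.
  move=> y r r0; exact: (local_pot_lty (@edist_ge0 R d) (@edist_sym R d)
    (@measurable_edist R d) c1_gt0 mball_le gamma_gt0 gamma_ltn beta_lt q_gt1
    ptri y B0 (mg f D mf) (g0 f D D0) bg r0).
apply: fofana_norm_ge_local => r r0.
apply: le_trans (local_norm_frac_int_le _ mf D0 _) _.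
  by rewrite pbE'.
rewrite pbE' Lnorm.unlock mu_gt0.
have CD0 : (0 <= (2 * Cg * D)%:E)%E by rewrite lee_fin ltW// !mulr_gt0.
have tq : 0 <= theta / q by rewrite divr_ge0// ltW.
apply: (@le_trans _ _ ((2 * Cg * D)%:E * ((K * A r `^ q) `^ (theta / q))%:E)%E).
  apply: (lee_wpmul2l CD0); apply/ess_supP; apply: nearW => y /=.
  rewrite gee0_abs ?poweR_ge0// AE -poweR_EFin; apply: le_poweR => //.
    by apply: integral_ge0 => x _; exact: poweR_ge0.
  exact: Hp.
rewrite -EFinM lee_fin (powRM _ (ltW K0) (powR_ge0 _ _)) -powRrM.
rewrite [q * _]mulrC divfK ?gt_eqF// le_eqVlt; apply/orP; left; apply/eqP.
by ring.
Qed.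

End fofana_estimate.

(** * Measurability of the fractional integral *)

Section borel_up_to_null.
Context dd (T : measurableType dd) (R : realType).
Variable mu : {measure set T -> \bar R}.

(** Intersect countable measurable covers whose total measures exceed the outer measure by at most
    1/(m+1). *)
Lemma mu_ext_hull (X : set T) : exists G, [/\ measurable G, X `<=` G &
  (mu G <= (mu^*)%mu X)%E].
Proof.
have [Xoo|Xoo] := eqVneq ((mu^*)%mu X) +oo%E.
  by exists setT; split => //; rewrite Xoo leey.
have Xfin : (mu^*)%mu X \is a fin_num.
  by rewrite ge0_fin_numE ?mu_ext_ge0// ltey.
have inv0 m : (0 < m.+1%:R^-1 :> R) by rewrite invr_gt0.
have cov m : exists A : (set T)^nat, [/\ forall i, measurable (A i),
    X `<=` \bigcup_i A i &
    (\sum_(i <oo) mu (A i) < (mu^*)%mu X + m.+1%:R^-1%:E)%E].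
  have [_ [A [mA XA] <-] lt] := lb_ereal_inf_adherent (inv0 m) Xfin.
  by exists A; split.
have [A HA] := choice cov.
exists (\bigcap_m \bigcup_i A m i); split.
- apply: bigcapT_measurable => m; apply: bigcupT_measurable => i.
  by have [] := HA m.
- by move=> x Xx m _; have [_ XA _] := HA m; exact: XA.
apply/lee_addgt0Pr => e e0.
have [m me] : exists m, m.+1%:R^-1 < e.
  exists (Num.bound e^-1); rewrite invf_plt ?posrE//.
  by apply: lt_trans (archi_boundP _) _; rewrite ?invr_ge0 ?ltW// ltr_nat.
have [mA _ lt] := HA m.
apply: (@le_trans _ _ (mu (\bigcup_i A m i))).
  apply: le_measure; rewrite ?inE.
  - apply: bigcapT_measurable => j; apply: bigcupT_measurable => i.
    by have [] := HA j.
  - exact: bigcupT_measurable.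
  - exact: bigcap_inf.
apply: le_trans (measure_sigma_subadditive mu mA (bigcupT_measurable _ mA) (fun _ => id)) _.
by apply: le_trans (ltW lt) _; rewrite leeD2l// lee_fin ltW.
Qed.

(** Take for [B] a hull of [E]. Finiteness allows subtraction in the Carathéodory identity, so the
    outer measure of B minus E is 0, and [N] is a hull of this difference. *)
Lemma caratheodory_borel_fin (E : set T) : (mu^*)%mu.-caratheodory E ->
  ((mu^*)%mu E < +oo)%E ->
  exists B N, [/\ measurable B, measurable N, mu N = 0%E &
    forall x, ~ N x -> (E x <-> B x)].
Proof.
move=> mE Efin; have [B [mB EB BE]] := mu_ext_hull E.
have BC : (mu^*)%mu.-caratheodory B.
  by apply: sub_caratheodory; exact: sub_sigma_algebra.
have D0 : (mu^*)%mu (B `\` E) = 0%E.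
  have := mE B; rewrite setIC (setIidl EB) -setDE.
  rewrite [X in X = _ -> _]measurable_mu_extE// => BEE.
  have EE : (mu^*)%mu E \is a fin_num by rewrite ge0_fin_numE ?mu_ext_ge0.
  move: BE; rewrite BEE -[leRHS]adde0 leeD2lE// => D0.
  by apply/eqP; rewrite eq_le D0 mu_ext_ge0.
have [N [mN BN N0]] := mu_ext_hull (B `\` E).
exists B, N; split => //.
  by apply/eqP; rewrite eq_le measure_ge0 andbT -D0.
move=> x Nx; split; first exact: EB.
by move=> Bx; apply: contrapT => Ex; apply: Nx; exact: BN.
Qed.

Lemma caratheodory_borel (E : set T) : sigma_finite setT mu ->
  (mu^*)%mu.-caratheodory E ->
  exists B N, [/\ measurable B, measurable N, mu N = 0%E &
    forall x, ~ N x -> (E x <-> B x)].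
Proof.
move=> [S ST Sfin] mE.
have step i : exists BN : set T * set T, [/\ measurable BN.1, measurable BN.2,
    mu BN.2 = 0%E & forall x, ~ BN.2 x -> ((E `&` S i) x <-> BN.1 x)].
  have [mS Sfi] := Sfin i.
  have CS : (mu^*)%mu.-caratheodory (S i).
    by apply: sub_caratheodory; exact: sub_sigma_algebra.
  have [||B [N [? ? ? ?]]] := @caratheodory_borel_fin (E `&` S i).
  - exact: caratheodory_measurable_setI.
  - apply: le_lt_trans Sfi; rewrite -[leRHS]measurable_mu_extE//.
    by apply: le_mu_ext; exact: subIsetr.
  by exists (B, N).
have [F HF] := choice step.
exists (\bigcup_i (F i).1), (\bigcup_i (F i).2); split.
- by apply: bigcupT_measurable => i; have [] := HF i.
- by apply: bigcupT_measurable => i; have [] := HF i.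
- apply/eqP; rewrite eq_le measure_ge0 andbT.
  apply: le_trans (measure_sigma_subadditive mu _ _ (fun _ => id)) _.
  + by move=> i; have [] := HF i.
  + by apply: bigcupT_measurable => i; have [] := HF i.
  by rewrite eseries0// => i _ _; have [] := HF i.
move=> x Nx; have Ni i : ~ (F i).2 x by move=> H; apply: Nx; exists i.
split.
  move=> Ex; have [i _ Si] : (\bigcup_i S i) x by rewrite -ST.
  by exists i => //; have [_ _ _ H] := HF i; apply/H => //; exact: Ni.
by move=> [i _ Bi]; have [_ _ _ H] := HF i; have [] := (H x (Ni i)).2 Bi.
Qed.

(** Only the countably many superlevel sets at rational heights are replaced, so their exceptional
    sets have a null union; every other superlevel set is a union of rational ones off that set. *)
Lemma caratheodory_borel_fun (f : T -> R) : sigma_finite setT mu ->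
  (forall c, (mu^*)%mu.-caratheodory [set x | c < f x]) ->
  exists N, [/\ measurable N, mu N = 0%E &
    measurable_fun setT (fun x => f x * \1_(~` N) x)].
Proof.
move=> sf mf.
pose c_ (m : nat) : R := if unpickle m is Some r then ratr r else 0.
have cE (r : rat) : c_ (pickle r) = ratr r by rewrite /c_ pickleK.
have [F HF] := choice (fun m => caratheodory_borel sf (mf (c_ m))).
have [N HN] := choice HF.
exists (\bigcup_m N m); have mN : measurable (\bigcup_m N m).
  by apply: bigcupT_measurable => m; have [] := HN m.
split => //.
  apply/eqP; rewrite eq_le measure_ge0 andbT.
  apply: le_trans (measure_sigma_subadditive mu _ mN (fun _ => id)) _.
    by move=> m; have [] := HN m.
  by rewrite eseries0// => m _ _; have [] := HN m.
apply: (measurability _ (RGenOInfty.measurableE R)) => //.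
move=> _ [_ [c ->] <-]; rewrite setTI.
pose V := \bigcup_(r : rat) if c < ratr r then F (pickle r) else set0.
have mV : measurable V.
  apply: bigcupT_measurable_rat => r; case: ifP => // _.
  by have [] := HN (pickle r).
(* The modified function is 0 on the exceptional set, which therefore lies in the superlevel set
   exactly when c < 0. *)
have -> : (fun x => f x * \1_(~` \bigcup_m N m) x) @^-1` `]c, +oo[ =
    (V `&` ~` \bigcup_m N m) `|` (if c < 0 then \bigcup_m N m else set0).
  have VE x : ~ (\bigcup_m N m) x -> (V x <-> c < f x).
    move=> Nx; have Ni i : ~ N i x by move=> H; apply: Nx; exists i.
    split.
      move=> [r _]; case: ifP => // cr Fr; have [_ _ _ H] := HN (pickle r).
      by have := (H x (Ni _)).2 Fr; rewrite /= cE; exact: lt_trans.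
    move=> cf; have [r] := rat_in_itvoo cf; rewrite in_itv/= => /andP[cr rf].
    exists r => //; rewrite cr; have [_ _ _ H] := HN (pickle r).
    by apply/(H x (Ni _)); rewrite /= cE.
  apply/seteqP; split => x /=; rewrite in_itv/= andbT indicE.
    have [xN|xN] := pselect ((\bigcup_m N m) x).
      rewrite memNset; last by move/(_ xN).
      by rewrite mulr0 => -> ; right.
    by rewrite mem_set// mulr1 => cf; left; split => //; apply/VE.
  move=> [[Vx xN]|]; first by rewrite mem_set// mulr1; apply/VE.
  case: (boolP (c < 0)) => [c0 xN|_ []].
  by rewrite memNset ?mulr0// => /(_ xN).
apply: measurableU; first by apply: measurableI => //; exact: measurableC.
by case: ifP.
Qed.

End borel_up_to_null.

(** * Translation invariance of Lebesgue measure *)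

Section translation.
Context {R : realType}.

(** The image of the measure under the shift agrees with it on half-open intervals, and these
    determine it. *)
Lemma lebesgue_measure_shift (a : R) (A : set (measurableTypeR R)) :
  measurable A ->
  lebesgue_measure ((fun t : R => t - a) @^-1` A) = lebesgue_measure A.
Proof.
move=> mA; have mf : measurable_fun setT
    ((fun t => t - a) : measurableTypeR R -> measurableTypeR R).
  exact: measurable_funB.
have := @lebesgue_measure_unique R
  (measure_function_pushforward__canonical__measure_function_Measure
    (@lebesgue_measure R) mf) _ A mA.
move=> -> // _ [[x y]] _ <-; rewrite /= /pushforward.
have -> : (fun t : R => t - a) @^-1` `]x, y]%classic = `]x + a, y + a]%classic.
  by apply/seteqP; split => t /=; rewrite !in_itv/= ltrBrDr lerBlDr.
rewrite /= !lebesgue_measure_itv/= !lte_fin ltrD2r.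
by case: ifP => // _; rewrite -!EFinB; congr EFin; ring.
Qed.

Lemma integral_lebesgue_shift (a : R) (f : R -> \bar R) :
  measurable_fun [set: measurableTypeR R] f -> (forall t, 0 <= f t)%E ->
  (\int[@lebesgue_measure R]_t f (t - a)%R = \int[@lebesgue_measure R]_t f t)%E.
Proof.
move=> mf f0; have mg : measurable_fun setT
    ((fun t => t - a) : measurableTypeR R -> measurableTypeR R).
  exact: measurable_funB.
have := @ge0_integral_pushforward _ _ _ _ R _ mg (@lebesgue_measure R) setT f
  measurableT mf (fun y _ => f0 y).
rewrite preimage_setT => <-; apply: eq_measure_integral => A mA _.
exact: lebesgue_measure_shift.
Qed.

Definition tshift d (a x : d.-tuple R) : d.-tuple R :=
  [tuple tnth x i - tnth a i | i < d].

Lemma measurable_tshift d (a : d.-tuple R) :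
  measurable_fun setT
    (tshift a : d.-tuple (measurableTypeR R) -> d.-tuple (measurableTypeR R)).
Proof.
apply/measurable_fun_tnthP => i.
rewrite (_ : _ \o _ = fun x : d.-tuple (measurableTypeR R) => tnth x i - tnth a i).
  by apply: measurable_funB => //; exact: measurable_tnth.
by apply/funext => x /=; rewrite tnth_mktuple.
Qed.

Lemma borel_lebesgueS d (A : set (d.+1.-tuple (measurableTypeR R))) :
  borel_lebesgue d.+1 A = (\int[@lebesgue_measure R]_t
    borel_lebesgue d [set x | A (tuple_cons (t, x))])%E.
Proof.
rewrite /= /cons_measure /product_measure1; apply: eq_integral => t _ /=.
congr (borel_lebesgue d _); apply/seteqP; split => x; rewrite /xsection /= inE;
  by rewrite /tuple_cons.
Qed.

(** Induction on the dimension: slices along the first coordinate are translated by the induction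
    hypothesis, and the integral over that coordinate by one-dimensional invariance. *)
Lemma borel_lebesgue_tshift d (a : d.-tuple R)
    (A : set (d.-tuple (measurableTypeR R))) : measurable A ->
  borel_lebesgue d (tshift a @^-1` A) = borel_lebesgue d A.
Proof.
elim: d a A => [|d IH] a A mA.
  congr (borel_lebesgue 0 _); apply/seteqP; split => x /=;
    by rewrite [tshift a x]tuple0 [x]tuple0.
case/tupleP: a => a0 a; rewrite !borel_lebesgueS.
pose F t := borel_lebesgue d [set x | A (tuple_cons (t, x))].
have mpre : measurable ((@tuple_cons _ (measurableTypeR R) d) @^-1` A).
  rewrite -[X in measurable X]setTI.
  exact: (measurable_tuple_cons measurableT mA).
have FE t : F t =
    borel_lebesgue d (xsection ((@tuple_cons _ (measurableTypeR R) d) @^-1` A) t).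
  congr (borel_lebesgue d _); apply/seteqP; split => x; rewrite /xsection /= inE;
  by rewrite /tuple_cons.
have mF : measurable_fun [set: measurableTypeR R] F.
  rewrite (_ : F =
    borel_lebesgue d \o xsection ((@tuple_cons _ (measurableTypeR R) d) @^-1` A)).
    exact: measurable_fun_xsection.
  exact/funext.
have mS t : measurable [set x | A (tuple_cons (t, x))].
  have := measurable_xsection t mpre; congr (measurable _).
  apply/seteqP; split => x; rewrite /xsection /= inE; by rewrite /tuple_cons.
rewrite -(integral_lebesgue_shift a0 mF); last by move=> t; exact: measure_ge0.
apply: eq_integral => t _; rewrite /F -(IH a _ (mS (t - a0))).
congr (borel_lebesgue d _); apply/seteqP; split => x /=;
  suff -> : tshift [tuple of a0 :: a] (tuple_cons (t, x)) =
    tuple_cons (t - a0, tshift a x) by [].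
- apply: eq_from_tnth => i; rewrite tnth_mktuple.
  by case: (unliftP ord0 i) => [j|] ->; rewrite ?tnthS ?tnth0// tnth_mktuple.
- apply: eq_from_tnth => i; rewrite tnth_mktuple.
  by case: (unliftP ord0 i) => [j|] ->; rewrite ?tnthS ?tnth0// tnth_mktuple.
Qed.

End translation.

(** * Measurability of convolutions with a radial kernel *)

Section frac_int_measurability.
Context {R : realType} (d : nat).
Local Notation mu := (lebesgueS (R := R) d).

Lemma measurable_tshift2 :
  measurable_fun [set: Rd R d * Rd R d]
    ((fun z => tshift z.1 z.2) :
      Rd R d * Rd R d -> d.-tuple (measurableTypeR R)).
Proof.
apply/measurable_fun_tnthP => i.
rewrite (_ : _ \o _ = fun z : Rd R d * Rd R d =>
    tnth (z.2 : d.-tuple R) i - tnth (z.1 : d.-tuple R) i).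
  apply: measurable_funB.
    exact: (measurableT_comp (measurable_coord i)).
  exact: (measurableT_comp (measurable_coord i)).
by apply/funext => z /=; rewrite tnth_mktuple.
Qed.

(* [kappa] is only Lebesgue measurable, so [kappa (y - x)] need not be measurable
   for the product sigma-algebra; a Borel version of [kappa] is used instead, and
   the exceptional null set stays null under every translation. *)
Lemma measurable_convolution (kappa v : Rd R d -> R) :
  measurable_fun setT kappa -> (forall z, 0 <= kappa z) ->
  (forall x, measurable_fun [set: Rd R d] (fun y => kappa (tshift x y))) ->
  measurable_fun setT v -> (forall y, 0 <= v y) ->
  measurable_fun [set: Rd R d]
    (fun x => \int[lebesgue R d]_y (kappa (tshift x y) * v y)%:E)%E.
Proof.
move=> mk k0 mks mv v0.
have [|N [mN N0 mk']] := @caratheodory_borel_fun _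
  (d.-tuple (measurableTypeR R)) R (borel_lebesgue d) kappa
  (sigma_finiteT (borel_lebesgue d)).
  move=> c; have := mk measurableT _ (measurable_itv `]c, +oo[).
  rewrite setTI; congr (caratheodory_measurable _ _).
  by apply/seteqP; split => x /=; rewrite in_itv/= andbT.
pose k' := fun x : d.-tuple (measurableTypeR R) => kappa x * \1_(~` N) x.
pose F (z : Rd R d * Rd R d) := (k' (tshift z.1 z.2) * v z.2)%:E.
have k'0 x : 0 <= k' x by rewrite /k' mulr_ge0.
have mF : measurable_fun setT F.
  apply/measurable_EFinP; apply: measurable_funM.
    exact: (measurableT_comp mk' measurable_tshift2).
  exact: (measurableT_comp mv).
have F0 z : (0 <= F z)%E by rewrite lee_fin mulr_ge0.
rewrite [X in measurable_fun _ X](_ : _ = fubini_F mu F).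
  exact: measurable_fun_fubini_tonelli_F.
apply/funext => x; transitivity (\int[lebesgue R d]_y F (x, y))%E; last by [].
apply: ge0_ae_eq_integral.
- exact: measurableT.
- by apply/measurable_EFinP; apply: measurable_funM.
- exact: (measurableT_comp mF (pair1_measurable x)).
- by move=> y _; rewrite lee_fin mulr_ge0.
- by move=> y _; exact: F0.
exists (tshift x @^-1` N); split.
- apply: borel_measurable_Rd; rewrite -[X in measurable X]setTI.
  exact: (measurable_tshift x measurableT mN).
- rewrite [LHS]lebesgue_borelE ?borel_lebesgue_tshift//.
  rewrite -[X in measurable X]setTI.
  exact: (measurable_tshift x measurableT mN).
move=> y /= H; apply: contrapT => Ny; apply: H => _.
by rewrite /F /k' /= indicE mem_set// mulr1.
Qed.

Variable rho : R -> R.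
Hypothesis d_gt0 : (0 < d)%N.
Hypothesis rho_gt0 : positive_fun rho.
Hypothesis mkernel :
  forall x, measurable_fun [set: Rd R d] (frac_kernel rho x).
Let kernel_ge0 := frac_kernel_ge0 d_gt0 rho_gt0.
Let origin : Rd R d := [tuple 0 | i < d].

Lemma frac_kernel_tshift (x y : Rd R d) :
  frac_kernel rho x y = frac_kernel rho origin (tshift x y).
Proof.
rewrite /frac_kernel; suff -> : edist x y = edist origin (tshift x y) by [].
rewrite /edist; congr Num.sqrt; apply: eq_bigr => i _.
by rewrite /origin !tnth_mktuple sub0r opprB.
Qed.

(** The positive and negative parts of [u] give two nonnegative convolutions. Where both are
    infinite, the extended difference and [fine] take default values that keep the result
    measurable. *)
Lemma measurable_frac_int_real (u : Rd R d -> R) : measurable_fun setT u ->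
  measurable_fun [set: Rd R d]
    (fun x => fine (\int[lebesgue R d]_y (frac_kernel rho x y * u y)%:E)%E).
Proof.
move=> mu_; apply: (measurableT_comp (fine_measurable measurableT)).
have part (v : Rd R d -> R) : measurable_fun setT v -> (forall y, 0 <= v y) ->
    measurable_fun [set: Rd R d]
    (fun x => \int[lebesgue R d]_y (frac_kernel rho x y * v y)%:E)%E.
  move=> mv v0; under eq_fun do under eq_integral do rewrite frac_kernel_tshift.
  apply: (@measurable_convolution (frac_kernel rho origin) v).
  - exact: mkernel.
  - exact: kernel_ge0.
  - by move=> x; under eq_fun do rewrite -frac_kernel_tshift; exact: mkernel.
  - exact: mv.
  - exact: v0.
rewrite [X in measurable_fun _ X](_ : _ = fun x =>
  (\int[lebesgue R d]_y (frac_kernel rho x y * Num.max (u y) 0)%:E -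
   \int[lebesgue R d]_y (frac_kernel rho x y * Num.max (- u y) 0)%:E)%E).
  apply: emeasurable_funB; apply: part.
  - by apply: measurable_maxr; [exact: mu_|exact: measurable_cst].
  - by move=> y; rewrite le_max lexx orbT.
  - apply: measurable_maxr; last exact: measurable_cst.
    exact: measurable_funN.
  - by move=> y; rewrite le_max lexx orbT.
apply/funext => x; rewrite integralE; congr (_ - _)%E; apply: eq_integral => y _.
  by rewrite /= funeposE /= -EFin_max maxr_pMr ?kernel_ge0// mulr0.
rewrite /= funenegE /=.
by rewrite -EFin_max maxr_pMr ?kernel_ge0// mulr0 mulrN.
Qed.

Lemma measurable_frac_int (f : Rd R d -> R[i]) : cmeasurable f ->
  cmeasurable (frac_int rho f).
Proof.
move=> [mre mim]; split.
  rewrite (_ : (fun x => _) = fun x => fine (\int[lebesgue R d]_y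
      (frac_kernel rho x y * complex.Re (f y))%:E)%E).
    exact: measurable_frac_int_real.
  apply/funext => x; rewrite /frac_int /cintegral /Rintegral /=.
  congr fine; apply: eq_integral => y _; congr EFin.
  by case: (f y) => a b /=; rewrite mul0r subr0.
rewrite (_ : (fun x => _) = fun x => fine (\int[lebesgue R d]_y
    (frac_kernel rho x y * complex.Im (f y))%:E)%E).
  exact: measurable_frac_int_real.
apply/funext => x; rewrite /frac_int /cintegral /Rintegral /=.
congr fine; apply: eq_integral => y _; congr EFin.
by case: (f y) => a b /=; rewrite mul0r addr0.
Qed.

End frac_int_measurability.

(** * Almost everywhere convergence and conclusion *)

Lemma ae_lty_of_integral_poweR dd (T : measurableType dd) (R : realType)
    (mu : {measure set T -> \bar R}) (D : (set T)^nat) (s : R)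
    (M : T -> \bar R) : 0 < s -> (forall n, measurable (D n)) ->
  (forall x, exists n, D n x) ->
  measurable_fun setT M -> (forall x, 0 <= M x)%E ->
  (forall n, \int[mu]_(x in D n) (M x `^ s) < +oo)%E ->
  {ae mu, forall x, (M x < +oo)%E}.
Proof.
move=> s0 mD Dc mM M0 H.
have : {ae mu, forall x n, D n x -> (M x `^ s)%E \is a fin_num}.
  apply: ae_foralln => n; apply: integrable_ae; first exact: mD.
  apply/integrableP; split.
    by apply: measurable_funTS; apply: (measurableT_comp (measurable_poweR _)).
  under eq_integral do rewrite gee0_abs ?poweR_ge0//.
  exact: H.
apply: filterS => x Hx; have [n /Hx] := Dc x.
case: (M x) (M0 x) => [r _ _|_|//]; first by rewrite ltry.
by rewrite poweRyr ?gt_eqF.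
Qed.

(** A power of the potential of |f|/D has finite integral over each ball around the origin, so the
    potential is finite almost everywhere, and it dominates the integral of kernel times |f| up to
    the factor C D. *)
Lemma ae_frac_kernel_integrable (R : realType) (d : nat) (rho : R -> R)
    (gamma C D s : R) (f : Rd R d -> R[i]) : (0 < d)%N ->
  positive_fun rho -> 0 < C -> 0 < D -> 0 < s ->
  (forall r, 0 < r -> rho r <= C * r `^ gamma) ->
  cmeasurable f ->
  (forall x, measurable_fun [set: Rd R d] (frac_kernel rho x)) ->
  (forall (y : Rd R d) (r : R), (0 < r)%R ->
     \int[lebesgueS d]_(x in mball (@edist R d) y r)
     (mpot (lebesgueS d) (@edist R d) d%:R gamma
        (fun x => (cmod (f x) / D)%R) x `^ s) < +oo)%E ->
  {ae lebesgue R d, forall x, (lebesgue R d).-integrable [set: Rd R d]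
     (fun y => (frac_kernel rho x y * cmod (f y))%:E)}.
Proof.
move=> d0 rho0 C0 D0 s0 rhoC mf mk H.
pose g x := cmod (f x) / D.
have g0 x : 0 <= g x by rewrite divr_ge0 ?cmod_ge0// ltW.
have mg : measurable_fun setT g.
  by apply: measurable_funM; [exact: measurable_cmod|exact: measurable_cst].
have mM := @measurable_mpot _ _ _ (lebesgueS d) _ (@measurable_edist R d)
  d%:R gamma g mg g0.
pose B (n : nat) := mball (@edist R d) [tuple 0 | i < d] n.+1%:R.
have mB n : measurable (B n).
  by apply: measurable_mball; exact: measurable_edist.
have cover x : exists n, B n x.
  exists (Num.bound (edist [tuple 0 | i < d] x)).
  have /archi_boundP := edist_ge0 [tuple 0 | i < d] x.
  by move=> bx; apply: (lt_le_trans bx); rewrite ler_nat.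
have M0 x : (0 <= mpot (lebesgueS d) (@edist R d) d%:R gamma g x)%E.
  exact: mpot_ge0.
have HB n : (\int[lebesgueS d]_(x in B n)
    (mpot (lebesgueS d) (@edist R d) d%:R gamma g x `^ s) < +oo)%E.
  by apply: H; rewrite ltr0n.
have := ae_lty_of_integral_poweR s0 mB cover mM M0 HB.
apply: filterS => x Mx.
have k0 := @frac_kernel_ge0 R d rho d0 rho0.
have kf0 y : 0 <= frac_kernel rho x y * cmod (f y).
  by rewrite mulr_ge0 ?cmod_ge0.
apply/integrableP; split.
  apply/measurable_EFinP; apply: measurable_funM; first exact: mk.
  exact: measurable_cmod.
apply: (@le_lt_trans _ _
  ((C * D)%:E * mpot (lebesgueS d) (@edist R d) d%:R gamma g x)%E); last first.
  by rewrite lte_mul_pinfty// lee_fin ltW// mulr_gt0.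
apply: (@le_trans _ _
  (\int[lebesgue R d]_y ((C * D)%:E * (mker (@edist R d) (d%:R - gamma) x y * g y)%:E))%E).
  apply: le_integral_ge0 => y _; first exact: abse_ge0.
  rewrite gee0_abs; last by rewrite lee_fin.
  rewrite -EFinM lee_fin.
  rewrite (_ : C * D * _ =
    C * mker (@edist R d) (d%:R - gamma) x y * (D * g y)); last by ring.
  rewrite [D * g y]mulrC /g divfK ?gt_eqF//; apply: ler_wpM2r; first exact: cmod_ge0.
  exact: frac_kernel_le.
rewrite ge0_integralZl_EFin; first exact: lexx.
- exact: measurableT.
- by move=> y _; rewrite lee_fin mulr_ge0 ?mker_ge0.
- apply/measurable_EFinP; apply: measurable_funM; last exact: mg.
  exact: (measurable_mker (@measurable_edist R d)).
- by rewrite ltW// mulr_gt0.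
Qed.

Lemma fofana_norm_ge0 (R : realType) d (q p : \bar R) phi (f : Rd R d -> R[i]) :
  positive_fun phi -> (0 <= fofana_norm q p phi f)%E.
Proof.
move=> phi0; apply: ereal_sup_ge; eexists.
  by exists 1%R; [exact: ltr01|reflexivity].
by rewrite mule_ge0 ?Lnorm_ge0// lee_fin mulr_ge0 ?powR_ge0// invr_ge0 ltW// phi0.
Qed.

(** As integrals are total, a norm bound alone could concern default values. The conclusions under
    measurability of the kernel show that T_rho f is then given by an absolutely convergent integral
    at almost every point and is measurable. *)
Theorem theorem4p1 (R : realType) (d : nat) (q : R) (p : \bar R)
    (gamma beta : R) (phi rho : R -> R) (qbar : R) (pbar : \bar R)
    (d_gt0 : (0 < d)%N)
    (q_gt1 : 1 < q) (q_le_p : (q%:E <= p)%E)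
    (gamma_gt0 : 0 < gamma) (gamma_lt : gamma < d%:R / q)
    (beta_ge : - (d%:R / q) <= beta) (beta_lt : beta < - gamma)
    (phiG : Gclass d q%:E p phi)
    (phi_int : exists2 C : R, 0 < C & forall r : R, 0 < r ->
      (\int[completed_lebesgue_measure]_(t in `]r, +oo[)
         (phi t `^ q * t `^ (d%:R * q * einv p - 1))%:E
       <= (C * phi r `^ q * r `^ (d%:R * q * einv p))%:E)%E)
    (rho_gt0 : positive_fun rho) (rho_doubling : doubling rho)
    (growth : exists2 C' : R, 0 < C' & forall r : R, 0 < r ->
      phi r <= C' * r `^ beta /\ rho r <= C' * r `^ gamma)
    (pbarE : (pbar^-1 = p^-1 * (1 + gamma / beta)%:E)%E)
    (qbarE : qbar^-1 = q^-1 * (1 + gamma / beta)) :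
  let psi : R -> R := fun r => phi r `^ (q / qbar) in
  exists2 K : R, 0 < K & forall f : Rd R d -> R[i],
    fofana_space q%:E p phi f ->
    (fofana_norm qbar%:E pbar psi (frac_int rho f)
       <= K%:E * fofana_norm q%:E p phi f)%E /\
    ((forall x, measurable_fun [set: Rd R d] (frac_kernel rho x)) ->
      {ae lebesgue R d, forall x, (lebesgue R d).-integrable [set: Rd R d]
         (fun y => (frac_kernel rho x y * cmod (f y))%:E)} /\
      cmeasurable (frac_int rho f)).
Proof.
move=> psi; have [phi0 [Cd Cd0 phid] _] := phiG.
have [Ci Ci0 phii] := phi_int; have [Cg Cg0 gr] := growth.
have q0 : 0 < q by rewrite (lt_trans ltr01).
have [||Ch [k [Ch0 k01 dec]]] :=
    @dyadic_decay R q (d%:R * einv p) Cd Ci phi q0 phi0 Cd0 Ci0.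
- by move=> r s r0 rs; exact: phid.
- by move=> r /phii; rewrite [d%:R * q]mulrC -!mulrA.
have phiC r : 0 < r -> phi r <= Cg * r `^ beta by move=> /gr[].
have rhoC r : 0 < r -> rho r <= Cg * r `^ gamma by move=> /gr[].
have [K K0 core] := @fofana_core R d q p gamma beta phi rho qbar pbar d_gt0
  q_gt1 q_le_p gamma_gt0 gamma_lt beta_lt Cg Ch k phi0 Cg0 phiC Ch0 k01 dec
  rho_gt0 rhoC pbarE qbarE.
exists K; first exact: K0.
move=> f [mf foo].
have N0 := fofana_norm_ge0 q%:E p f phi0.
have Nfin : fofana_norm q%:E p phi f \is a fin_num by rewrite ge0_fin_numE.
move: N0; rewrite -(fineK Nfin); set N := fine _ => N0.
(* The normalizing constant has to be positive while the norm N may be 0; N + e is used and e then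
   tends to 0. *)
have le_core e : 0 < e -> (fofana_norm qbar%:E pbar psi (frac_int rho f)
    <= K%:E * N%:E + (K * e)%:E)%E.
  move=> e0; rewrite -EFinM -EFinD -mulrDr.
  have Ne0 : 0 < N + e by rewrite ltr_wpDl.
  have NNe : (fofana_norm q%:E p phi f <= (N + e)%:E)%E.
    by rewrite -(fineK Nfin) lee_fin lerDl ltW.
  exact: (core f (N + e) mf Ne0 NNe).1.
split.
  apply/lee_addgt0Pr => e e0; have := le_core (e / K) (divr_gt0 e0 K0).
  by rewrite mulrC divfK ?gt_eqF.
move=> mk; split; last exact: measurable_frac_int.
have N1 : 0 < N + 1 by rewrite ltr_wpDl.
have NN1 : (fofana_norm q%:E p phi f <= (N + 1)%:E)%E.
  by rewrite -(fineK Nfin) lee_fin lerDl.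
have [_ loc] := core f (N + 1) mf N1 NN1.
have s0 : 0 < q / (1 + gamma / beta).
  by apply: divr_gt0; [exact: q0|exact: one_plus_ratio_gt0].
apply: (ae_frac_kernel_integrable (C := Cg) (D := N + 1) _ _ _ _ s0 _ _ _ loc).
- exact: d_gt0.
- exact: rho_gt0.
- exact: Cg0.
- exact: N1.
- exact: rhoC.
- exact: mf.
- exact: mk.
Qed.
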